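(* Let $\dim V=(n|2r)$ with the orthosymplectic structure below, and consider the algebra homomorphism $S^\bullet(S^2(W))\to S^\bullet(V^*\otimes W)$, $x_{st}\mapsto(v_s,v_t)$. Its kernel (the ideal of relations between the scalar products) is generated by the polynomials $\mathrm{Pf}_t(I)$, where $t$ is the rectangular tableau with $n+1$ rows of length $2r+2$ filled consecutively along the rows, and $I$ runs over the $t$-semistandard sequences with entries in $R_W$.
   Context: $V$ has basis $e_1,\dots,e_n$ (even), $e_{\bar1},\dots,e_{\overline{2r}}$ (odd), dual basis $e_i^*$; $W$ has homogeneous basis $w_s$, $s\in R_W$. $x_{is}$ (in $S^\bullet(V^*\otimes W)$) $=e_i^*\otimes w_s$ and $(v_s,v_t)=\sum_{i=1}^n x_{is}x_{n-i+1,t}+(-1)^{p(s)}\sum_{j=1}^r\big(x_{\overline{2r-j+1},s}x_{\bar j,t}-x_{\bar j,s}x_{\overline{2r-j+1},t}\big)$. In $S^\bullet(S^2(W))$, $x_{st}$ is the image of $w_s\otimes w_t$. For a sequence $I$ of length $2k$, $X(I)=x_{i_1i_2}\cdots x_{i_{2k-1}i_{2k}}$; $c(I,\sigma)=\pm1$ is defined by $x_{\sigma^{-1}I}=c(I,\sigma)x_I$ in the free supercommutative algebra on generators $x_i$ of parity $p(i)$ ($\mathfrak S_{2k}$ permuting positions); $\mathrm{Pf}_t(I)=\sum_{\tau\in C_t,\sigma\in R_t}\varepsilon(\tau)c(I,(\sigma\tau)^{-1})X(\sigma\tau I)$, with $R_t,C_t$ row/column stabilizers. $t$-semistandard: placing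 the $\alpha$-th entry in the cell containing $\alpha$, entries weakly increase along rows and down columns, even indices strictly increase down columns, odd indices strictly increase along rows (even indices precede odd). *)

(* Defs.v *)
From HB Require Import structures.
From mathcomp Require Import all_boot all_order all_algebra all_fingroup.
From mathcomp.multinomials Require Import mpoly.

Set Implicit Arguments.
Unset Strict Implicit.
Unset Printing Implicit Defensive.

Import GRing.Theory.
Local Open Scope ring_scope.

(* The free supercommutative algebra on a finite set G of generators    *)
(* with parity p : G -> bool (true = odd), over a field F.              *)
(* Concrete model: an element is a polynomial in the #|G| variables     *)
(* 'X_(enum_rank g) whose monomials have exponent <= 1 in every odd     *)
(* variable ("svalid").  The monomial 'X_[m] stands for the ORDERED     *)
(* product x_{g_0}^{m 0} x_{g_1}^{m 1} ... (enum order of G).           *)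
(* The supercommutative product of two such monomials is 0 if an odd    *)
(* variable would be repeated and otherwise the Koszul sign times       *)
(* 'X_[m1 + m2].                                                        *)
Section SuperAlgebra.
Variable F : fieldType.
Variable G : finType.
Variable p : G -> bool.

Definition SC := {mpoly F[#|G|]}.

Definition spar (i : 'I_#|G|) : bool := p (enum_val i).

Definition svalid (f : SC) : Prop :=
  forall m, m \in msupp f -> forall i, spar i -> (m i <= 1)%N.

Definition msign (m1 m2 : 'X_{1..#|G|}) : F :=
  (-1) ^+ (\sum_(i < #|G|) \sum_(j < #|G| | (j < i)%N && spar i && spar j)
             (m1 i * m2 j))%N.

Definition mmul (m1 m2 : 'X_{1..#|G|}) : SC :=
  if [exists i, spar i && (1 < m1 i + m2 i)%N] then 0
  else msign m1 m2 *: 'X_[(m1 + m2)%MM].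

Definition smul (f g : SC) : SC :=
  \sum_(m1 <- msupp f) \sum_(m2 <- msupp g) ((f@_m1 * g@_m2) *: mmul m1 m2).

Definition spow (f : SC) (k : nat) : SC := iter k (smul f) 1.

Definition sgen (g : G) : SC := 'X_(enum_rank g).

End SuperAlgebra.

Definition shom (F : fieldType) (G H : finType) (p : G -> bool) (q : H -> bool)
    (img : G -> SC F H) (f : SC F G) : SC F H :=
  \sum_(m <- msupp f)
     (f@_m *: \big[@smul F H q/1]_(i < #|G|) spow q (img (enum_val i)) (m i)).

(*  V^* : basis indices 'I_(n + 2r): 0..n-1 are e_1..e_n (even),         *)
(*        n + j (j < 2r) is e_{bar (j+1)} (odd).                         *)
(*  W   : basis indices R_W = 'I_(m0 + m1) with its natural order;       *)
(*        0..m0-1 even, m0..m0+m1-1 odd (even indices precede odd).     *)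
Section Setting.
Variable F : fieldType.
Variables n r m0 m1 : nat.

Definition pW (s : 'I_(m0 + m1)) : bool := (m0 <= s)%N.
Definition pV (i : 'I_(n + 2 * r)) : bool := (n <= i)%N.

(* generators of S(V^* (x) W): x_{is} = e_i^* (x) w_s *)
Definition GB := ('I_(n + 2 * r) * 'I_(m0 + m1))%type.
Definition pB (g : GB) : bool := pV g.1 (+) pW g.2.
Definition B := SC F GB.

Definition xB (i : nat) (s : 'I_(m0 + m1)) : B :=
  if insub i is Some i' then @sgen F GB (i', s) else 0.

Definition vprod (s t : 'I_(m0 + m1)) : B :=
  \sum_(i < n) smul pB (xB i s) (xB (n - i.+1) t)
  + (-1) ^+ pW s *:
      \sum_(j < r) (smul pB (xB (n + 2 * r - j.+1) s) (xB (n + j) t)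
                    - smul pB (xB (n + j) s) (xB (n + 2 * r - j.+1) t)).

(* generators of S(S^2 W): x_{st} with s <= t, excluding s = t odd
   (a basis of S^2(W)) *)
Definition okpair (st : 'I_(m0 + m1) * 'I_(m0 + m1)) : bool :=
  (st.1 <= st.2)%N && ~~ ((st.1 == st.2) && pW st.1).
Definition GA := {st : 'I_(m0 + m1) * 'I_(m0 + m1) | okpair st}.
Definition pA (g : GA) : bool := pW (val g).1 (+) pW (val g).2.
Definition A := SC F GA.

(* x_{st} for arbitrary s, t: x_{ts} = (-1)^{p(s)p(t)} x_{st}, x_{ss} = 0
   for s odd *)
Definition xA (s t : 'I_(m0 + m1)) : A :=
  match (insub (s, t) : option GA) with
  | Some g => @sgen F GA g
  | None => match (insub (t, s) : option GA) with
            | Some g => (-1) ^+ (pW s && pW t) *: @sgen F GA g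
            | None => 0
            end
  end.

Definition phi (f : A) : B := shom pA pB (fun g : GA => vprod (val g).1 (val g).2) f.

(* the tableau t: n+1 rows of length 2r+2, filled along rows;
   positions are 0-indexed: alpha sits in row alpha %/ (2r+2),
   column alpha %% (2r+2).  K = 2k with k = (n+1)(r+1). *)
Definition kk := ((n + 1) * (r + 1))%N.
Definition K := (2 * kk)%N.
Definition trow (a : 'I_K) : nat := (a %/ (2 * r + 2))%N.
Definition tcol (a : 'I_K) : nat := (a %% (2 * r + 2))%N.

Definition Rt : {set 'S_K} := [set s : 'S_K | [forall a, trow (s a) == trow a]].
Definition Ct : {set 'S_K} := [set s : 'S_K | [forall a, tcol (s a) == tcol a]].

Lemma ltn_double_l (a : 'I_kk) : (2 * a < K)%N.
Proof. rewrite /K ltn_pmul2l //. Qed.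
Lemma ltn_double_r (a : 'I_kk) : (2 * a + 1 < K)%N.
Proof.
have h := ltn_ord a; rewrite /K.
by apply: (@leq_trans (2 * a.+1)%N); [rewrite mulnS addn1 add2n | rewrite leq_pmul2l].
Qed.

Definition pos1 (a : 'I_kk) : 'I_K := Ordinal (ltn_double_l a).
Definition pos2 (a : 'I_kk) : 'I_K := Ordinal (ltn_double_r a).

Definition Seq := 'I_K -> 'I_(m0 + m1).

Definition pact (s : 'S_K) (I : Seq) : Seq := fun a => I ((s^-1)%g a).

(* c(I, sigma):  x_{sigma^-1 I} = c(I, sigma) x_I  (Koszul sign) *)
Definition csign (I : Seq) (s : 'S_K) : F :=
  \prod_(a : 'I_K) \prod_(b : 'I_K | (a < b)%N && (s b < s a)%N)
     (-1) ^+ (pW (I (s a)) && pW (I (s b))).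

Definition XI (I : Seq) : A :=
  \big[smul pA/1]_(a < kk) xA (I (pos1 a)) (I (pos2 a)).

(* Pf_t(I); note that for mathcomp permutations (tau * sig) x = sig (tau x),
   i.e. (tau * sig)%g is the composite sigma o tau of the paper. *)
Definition Pf (I : Seq) : A :=
  \sum_(tau in Ct) \sum_(sig in Rt)
     (((-1) ^+ odd_perm tau * csign I ((tau * sig)^-1)%g)
        *: XI (pact (tau * sig)%g I)).

Definition semistandard (I : Seq) : bool :=
  [forall a : 'I_K, forall b : 'I_K,
     ((trow a == trow b) && (tcol a < tcol b)%N) ==>
        ((I a <= I b)%N && ((I a == I b) ==> ~~ pW (I a)))]
  && [forall a : 'I_K, forall b : 'I_K,
     ((tcol a == tcol b) && (trow a < trow b)%N) ==>
        ((I a <= I b)%N && ((I a == I b) ==> pW (I a)))].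

End Setting.

(* Main.v *)
(* The relations hold: phi (Pf_t (I)) is a combination of monomials whose coefficients are the
   Pfaffian sums of the form on V, indexed by sequences of basis vectors of V.  By Garnir
   straightening these reduce to semistandard sequences with letters in V, and there are none for
   an (n+1) x (2r+2) rectangle and dim V = (n|2r).  The same straightening, applied with letters in
   W, reduces arbitrary Pf_t (I) to semistandard ones.

   There are no further relations: an element of degree k is a family w of coefficients indexed by
   words of length N = 2k, and phi f = 0 says that all functions s |-> c(I, s) w(I o s) on the
   symmetric group S_N are orthogonal to the functions s |-> c(J, s) omega(J o s) of the form.  It
   suffices that these are spanned by the translates of the delta_h - delta_1, h in the centralizer
   Hk of the pairing (they act by zero on products x_{st} ... x_{uv}), and of the Young symmetrizer
   of the rectangle on the last K positions (they produce multiples of Pf_t).  All these vectors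
   being integral, the span has an orthogonal complement in characteristic 0, so it is enough to
   show that a function on words annihilated by all three conditions vanishes (ann_eq0).  This is a
   highest weight argument: raising operators preserve the conditions, which reduces to words with
   equal paired letters and decreasing letter multiplicities; if their shape lies in the
   (n, 2r)-hook, an explicit vector of V (bosonic rows, fermionic columns) contradicts the form
   condition, and otherwise the shape contains the rectangle and the symmetrizer condition applies. *)

Require Import Defs.
From HB Require Import structures.
From mathcomp Require Import all_boot all_order all_algebra all_fingroup.
From mathcomp.multinomials Require Import mpoly.
From mathcomp Require Import zify ring.
Set Implicit Arguments.
Unset Strict Implicit.
Unset Printing Implicit Defensive.
Import Order.TTheory GRing.Theory Num.Theory.
Local Open Scope ring_scope.

(** * Koszul signs *)

(** The field is an arbitrary one of characteristic 0, where a sum of squares may vanish. Hence the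
    vectors that must be shown nonzero get integer coefficients, and their nonvanishing is read off
    from sums of squares of integers. Semisimplicity is replaced by a multiplicity-one argument,
    [hw_unique]: a function invariant under [Hk] and killed by the raising operators is determined
    by its values on words with equal paired letters. Such words of a given content form one
    [Hk]-orbit, so a solution is unique up to a scalar. To kill an unknown solution [u] it then
    suffices to pair it with one explicit solution: the pairing becomes [u I0] times a nonzero
    integer ([hw_core]). The explicit vectors are highest only for part of the letters. Letters are
    therefore grouped into blocks, and both the raising relations and the words are restricted to
    pairs inside a block. The row length is 2r+2 because letters come in equal pairs and
    multiplicities are even: a row that leaves the (n,2r)-hook has more than 2r cells, hence at
    least 2r+2. *)

Section Signs.
Variable F : comNzRingType.

(** The sign [csign] of the statement, with parities given on positions, so that one theory serves
    words in [V] and in [W], over the integers and over the field. *)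
Definition cs N (P : 'I_N -> bool) (s : 'S_N) : F :=
  \prod_(a : 'I_N) \prod_(b : 'I_N | (a < b)%N && (s b < s a)%N)
     (-1) ^+ (P (s a) && P (s b)).

Lemma prod_pairs_sym N (G : 'I_N -> 'I_N -> F) (s : 'S_N) :
  (forall x y, G x y = G y x) ->
  \prod_(a < N) \prod_(b < N | (a < b)%N) G (s a) (s b) =
  \prod_(a < N) \prod_(b < N | (a < b)%N) G a b.
Proof.
move=> symG; rewrite !pair_big_dep /=.
pose s2 (p : 'I_N * 'I_N) := (s^-1%g p.1, s^-1%g p.2).
have s2inj : injective s2 by move=> [a b] [c d] [] /perm_inj -> /perm_inj ->.
rewrite (reindex_inj s2inj) /=.
under eq_bigr => p _ do rewrite !permKV.
have swinj : injective (fun p : 'I_N * 'I_N => (p.2, p.1)).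
  by move=> [a b] [c d] [] -> ->.
rewrite (bigID (fun p : 'I_N * 'I_N => (p.1 < p.2)%N)) /=.
rewrite [X in _ * X](reindex_inj swinj) /=.
rewrite [RHS](bigID (fun p : 'I_N * 'I_N => (s^-1%g p.1 < s^-1%g p.2)%N)) /=.
congr (_ * _); first by apply: eq_bigl => p; rewrite andbC.
apply: eq_big => [p|p _]; last exact: symG.
case: (ltngtP p.1 p.2) => [lt|gt|/ord_inj e]; rewrite ?andbF ?andbT //=.
  rewrite -leqNgt [RHS]leq_eqVlt; case: eqP => [/ord_inj /perm_inj e|_]; last by [].
  by move: lt; rewrite e ltnn.
by rewrite e ltnn.
Qed.

(** Symmetrize [g] by evaluating it on increasing pairs; the symmetric product is invariant under
    [s]. The two differ exactly at the inversions of [s], where [g x y] is traded for [g y x]. *)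
Lemma prod_pairs N (g : 'I_N -> 'I_N -> F) (s : 'S_N) :
  (forall x y, g x y * g x y = 1) ->
  \prod_(a < N) \prod_(b < N | (a < b)%N) g (s a) (s b) =
  (\prod_(a < N) \prod_(b < N | (a < b)%N) g a b) *
  \prod_(a < N) \prod_(b < N | (a < b)%N && (s b < s a)%N)
     (g (s a) (s b) * g (s b) (s a)).
Proof.
move=> g2; pose G (x y : 'I_N) : F := if (x < y)%N then g x y else if (y < x)%N then g y x else 1.
have symG x y : G x y = G y x by rewrite /G; case: ltngtP.
have := prod_pairs_sym s symG.
rewrite [RHS](_ : _ = \prod_(a < N) \prod_(b < N | (a < b)%N) g a b); last first.
  by apply: eq_bigr => a _; apply: eq_bigr => b lt; rewrite /G lt.
move=> <-; rewrite -big_split; apply: eq_bigr => a _ /=.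
rewrite [X in _ * X]big_mkcondr -big_split; apply: eq_bigr => b lt.
rewrite /G; case: (ltngtP (s a) (s b)) => [h|h|h]; rewrite /= ?mulr1 //.
  by rewrite mulrCA g2 mulr1.
by move: lt; rewrite (perm_inj (ord_inj h)) ltnn.
Qed.

Lemma signb2 (b : bool) : (-1) ^+ b * (-1) ^+ b = 1 :> F.
Proof. by case: b; rewrite ?expr1 ?expr0 ?mulrNN ?mulr1. Qed.

(** The Koszul sign is a cocycle: since [(t * s) x = s (t x)], the factor [t] rearranges a word
    whose parities have already been moved by [s]. *)
Lemma csM N (P : 'I_N -> bool) (t s : 'S_N) :
  cs P (t * s)%g = cs (P \o s) t * cs P s.
Proof.
pose h (x y : 'I_N) : F := (-1) ^+ (P (s x) && P (s y)).
pose g (x y : 'I_N) : F := if (s y < s x)%N then h x y else 1.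
have g2 x y : g x y * g x y = 1 by rewrite /g /h; case: ifP; rewrite ?signb2 ?mulr1.
have -> : cs P (t * s)%g = \prod_(a < N) \prod_(b < N | (a < b)%N) g (t a) (t b).
  apply: eq_bigr => a _; rewrite big_mkcondr; apply: eq_bigr => b _.
  by rewrite /g /h !permM.
have -> : cs P s = \prod_(a < N) \prod_(b < N | (a < b)%N) g a b.
  by apply: eq_bigr => a _; rewrite big_mkcondr; apply: eq_bigr.
rewrite (prod_pairs t g2) mulrC; congr (_ * _).
apply: eq_bigr => a _; apply: eq_bigr => b /andP[lt lt'].
rewrite /g /h /= andbC; case: (ltngtP (s (t a)) (s (t b))) => [e|e|e]; rewrite ?mulr1 ?mul1r //.
by move: lt; rewrite (perm_inj (perm_inj (ord_inj e))) ltnn.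
Qed.

Lemma cs1 N (P : 'I_N -> bool) : cs P 1 = 1.
Proof.
rewrite /cs big1 // => a _; rewrite big1 // => b /andP[lt].
by rewrite !perm1 ltnNge ltnW.
Qed.

Lemma cs2 N (P : 'I_N -> bool) s : cs P s * cs P s = 1.
Proof.
rewrite /cs -big_split big1 // => a _; rewrite -big_split big1 // => b _ /=.
exact: signb2.
Qed.

Lemma eq_cs N (P Q : 'I_N -> bool) s : P =1 Q -> cs P s = cs Q s.
Proof. by move=> e; rewrite /cs; apply: eq_bigr => a _; apply: eq_bigr => b _; rewrite !e. Qed.

Lemma cs_fix N (P : 'I_N -> bool) (s : 'S_N) :
  (forall x, P x -> s x = x) -> cs P s = 1.
Proof.
move=> fx; rewrite /cs big1 // => a _; rewrite big1 // => b /andP[lt lt'].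
case Pa: (P (s a)) => //; case Pb: (P (s b)) => //.
by move: lt'; rewrite (perm_inj (fx _ Pa)) (perm_inj (fx _ Pb)) ltnNge ltnW.
Qed.

Lemma cs_adj N (P : 'I_N -> bool) (i j : 'I_N) :
  j = i.+1 :> nat -> cs P (tperm i j) = (-1) ^+ (P i && P j).
Proof.
move=> eij; rewrite /cs (bigD1 i) //= [X in _ * X]big1 ?mulr1 => [|a ai].
  rewrite (big_pred1 j) ?tpermL ?tpermR 1?andbC // => b /=.
  case: tpermP => [->|->|/eqP bi /eqP bj]; rewrite ?eqxx ?ltnn //.
  - by apply/esym/negbTE; rewrite -val_eqE /= neq_ltn eij ltnSn.
  - by rewrite eij ltnSn.
  by rewrite (negbTE bj); move: bi bj; rewrite -!val_eqE /=; lia.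
apply: big1 => b /andP[ab lt]; exfalso; move: ai ab lt.
have vE (x y : 'I_N) : (x != y) = (nat_of_ord x != nat_of_ord y) by [].
case: (tpermP i j a) => [->|->|/eqP ni /eqP nj]; rewrite ?eqxx //;
  case: (tpermP i j b) => [->|->|/eqP mi /eqP mj]; rewrite ?eij //;
  try (rewrite vE in ni); try (rewrite vE in nj); try (rewrite vE in mi);
  try (rewrite vE in mj); lia.
Qed.

End Signs.

Lemma tperm_conj (T : finType) (x y z : T) : x != y -> x != z ->
  (tperm y z * tperm x y * tperm y z)%g = tperm x z.
Proof.
move=> xy xz; apply/permP => u; rewrite !permM.
case: (tpermP x z u) => [->|->|/eqP ux /eqP uz].
- by rewrite (tpermD (z:=x)) 1?eq_sym // tpermL tpermL.
- by rewrite tpermR tpermR tpermD // eq_sym.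
case: (eqVneq u y) => [uy|uy]; last by rewrite !(tpermD (z:=u)) // eq_sym.
by rewrite -uy tpermL (tpermD (x:=x)) ?tpermR.
Qed.

Section AdjInd.
Variable N : nat.

(** A distant transposition is an adjacent conjugate of one at distance one less. The new factor
    stands on the left, where [csM] splits it off. *)
Lemma perm_adj_ind (Q : 'S_N -> Prop) :
  Q 1%g ->
  (forall (s : 'S_N) (i j : 'I_N), j = i.+1 :> nat -> Q s -> Q (tperm i j * s)%g) ->
  forall s, Q s.
Proof.
move=> Q1 Qadj.
have Qt d (i j : 'I_N) s : (j = i + d :> nat)%N -> Q s -> Q (tperm i j * s)%g.
  elim: d i j s => [|[|d] IH] i j s eij Qs.
  - have -> : i = j by apply: ord_inj; rewrite eij addn0.
    by rewrite tperm1 mul1g.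
  - by apply: Qadj => //; rewrite eij addn1.
  have lt : (i + d.+1 < N)%N by have := ltn_ord j; lia.
  have h1 : i != Ordinal lt by rewrite -val_eqE /=; lia.
  have h2 : i != j by rewrite -val_eqE /=; lia.
  rewrite -(tperm_conj h1 h2) -!mulgA.
  apply: (Qadj); first (rewrite /=; lia).
  by apply: IH => //; apply: Qadj => //=; rewrite eij addnS.
move=> s; have [ts -> _] := prod_tpermP s.
elim: ts => [|t ts IH]; first by rewrite big_nil.
rewrite big_cons; case: (ltngtP t.1 t.2) => [lt|lt|/ord_inj e].
- by apply: (Qt (t.2 - t.1)%N) => //; lia.
- by rewrite tpermC; apply: (Qt (t.1 - t.2)%N) => //; lia.
by rewrite e tperm1 mul1g.
Qed.

Lemma perm_supp_ind (D : pred 'I_N) (Q : 'S_N -> Prop) :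
  Q 1%g ->
  (forall (s : 'S_N) x y, D x -> D y -> x != y ->
     (forall z, ~~ D z -> s z = z) -> Q s -> Q (s * tperm x y)%g) ->
  forall s : 'S_N, (forall z, ~~ D z -> s z = z) -> Q s.
Proof.
move=> Q1 Qt s; have [n] := ubnP #|[set x | s x != x]|.
elim: n s => // n IH s le fx.
case: (pickP (fun x => s x != x)) => [x nx|all]; last first.
  rewrite (_ : s = 1%g) //; apply/permP => x; rewrite perm1.
  by apply/eqP; move: (all x) => /negbFE.
have Dx : D x by apply: contraNT nx => /fx ->.
have Dsx : D (s x) by apply: contraNT nx => /fx /perm_inj ->.
have -> : s = (s * tperm x (s x) * tperm x (s x))%g by rewrite -mulgA tperm2 mulg1.
have fx' z : ~~ D z -> (s * tperm x (s x))%g z = z.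
  move=> Dz; rewrite permM (fx z Dz) tpermD //; first by apply: contraNneq Dz => <-.
  by apply: contraNneq Dz => <-.
apply: Qt => //; first by rewrite eq_sym.
apply: IH => //; rewrite ltnS in le; apply: leq_trans le.
apply: proper_card; apply/properP; split; last first.
  by exists x; rewrite inE ?nx // permM tpermR eqxx.
apply/subsetP => z; rewrite !inE permM; apply: contraNN => /eqP sz.
rewrite sz tpermD //; first by apply: contraNneq nx => xz; rewrite [in X in s X]xz sz -xz.
by apply: contraNneq nx => sxz; rewrite -sz in sxz; move/perm_inj: sxz => ->; rewrite sz.
Qed.

End AdjInd.

Section Signs2.
Variable F : comNzRingType.

(** A letter strictly between [x] and [y] is passed by both exchanged letters, which have equal
    parity, so its two contributions cancel. *)
Lemma cs_tperm N (P : 'I_N -> bool) (x y : 'I_N) : x != y -> P x = P y ->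
  cs F P (tperm x y) = (-1) ^+ (P x).
Proof.
wlog lt : x y / (x < y)%N => [hw xy e|].
  case: (ltngtP x y) => [h|h|/ord_inj h]; first exact: hw.
    by rewrite tpermC e; apply: hw => //; rewrite eq_sym.
  by rewrite h eqxx in xy.
move=> _; have [d] : exists d, (y = x + d.+1 :> nat)%N by exists (y - x).-1; lia.
elim: d x y P {lt} => [|d IH] x y P eij e.
  by rewrite cs_adj ?addn1 -?e ?andbb //; lia.
have lt : (x + d.+1 < N)%N by have := ltn_ord y; lia.
have h1 : x != Ordinal lt by rewrite -val_eqE /=; lia.
have h2 : x != y by rewrite -val_eqE /=; lia.
rewrite -(tperm_conj h1 h2) -mulgA csM csM.
set t1 := tperm (Ordinal lt) y; set t2 := tperm x _.
have ey : y = (Ordinal lt).+1 :> nat by rewrite /=; lia.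
have t1x : t1 x = x by rewrite tpermD // eq_sym.
rewrite (IH _ _ (P \o t1)) //=; last by rewrite t1x /t1 tpermL.
rewrite t1x (cs_adj _ P ey) (cs_adj _ _ ey) /= !permM.
have t2y : t2 y = y by rewrite tpermD // -val_eqE /=; lia.
have -> : t2 (Ordinal lt) = x by rewrite tpermR.
have t1y : t1 y = Ordinal lt by rewrite tpermR.
by rewrite t2y t1y t1x -e [P _ && P x]andbC mulrCA signb2 mulr1.
Qed.

End Signs2.

Section SeqAction.
Variables (F : comNzRingType) (N : nat) (T : Type) (p : T -> bool).
Implicit Types (I : {ffun 'I_N -> T}) (s t : 'S_N).

Definition cmp I s : {ffun 'I_N -> T} := [ffun x => I (s x)].
Definition csI I s : F := cs F (fun x => p (I x)) s.

Lemma cmpM I t s : cmp I (t * s)%g = cmp (cmp I s) t.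
Proof. by apply/ffunP => x; rewrite !ffunE permM. Qed.

Lemma cmp1 I : cmp I 1%g = I.
Proof. by apply/ffunP => x; rewrite ffunE perm1. Qed.

Lemma cmpK I s : cmp (cmp I s) s^-1%g = I.
Proof. by rewrite -cmpM mulVg cmp1. Qed.

Lemma cmpKV I s : cmp (cmp I s^-1%g) s = I.
Proof. by rewrite -cmpM mulgV cmp1. Qed.

Lemma csIM I t s : csI I (t * s)%g = csI (cmp I s) t * csI I s.
Proof. by rewrite /csI csM; congr (_ * _); apply: eq_cs => x; rewrite /= ffunE. Qed.

Lemma csI1 I : csI I 1%g = 1. Proof. exact: cs1. Qed.

Lemma csI2 I s : csI I s * csI I s = 1. Proof. exact: cs2. Qed.

End SeqAction.

(** * Garnir straightening *)

Section Straightening.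
Variables (F : fieldType) (hF : [pchar F] =i pred0).
Variables (n r m0 m1 : nat) (E : lmodType F).
Let D := 'I_(m0 + m1).
Let seqK := {ffun 'I_(K n r) -> D}.
Variable Y : seqK -> E.
Implicit Types (I : seqK) (s t : 'S_(K n r)).
Local Notation c := (@csI F (K n r) D (@pW m0 m1)).
Local Notation R := (Rt n r).
Local Notation C := (Ct n r).

(** [Pf] with an arbitrary function [Y] of words in place of the monomial: [Y] will be the monomial
    for words in [W] and the form for words in [V]. The permutations are the inverses of those in
    [Pf], because [cmp] composes with [s] and [pact] with its inverse. *)
Definition PfY I : E :=
  \sum_(tau in C) \sum_(sig in R)
     ((-1) ^+ odd_perm tau * c I (sig * tau)%g) *: Y (cmp I (sig * tau)%g).

Lemma CtP (s : 'S_(K n r)) : reflect (forall a, tcol (s a) = tcol a) (s \in C).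
Proof. by rewrite inE; apply: (iffP forallP) => h a; apply/eqP; rewrite ?h. Qed.

Lemma RtP (s : 'S_(K n r)) : reflect (forall a, trow (s a) = trow a) (s \in R).
Proof. by rewrite inE; apply: (iffP forallP) => h a; apply/eqP; rewrite ?h. Qed.

Lemma CtM s t : t \in C -> ((s * t)%g \in C) = (s \in C).
Proof.
move=> /CtP tC; apply/CtP/CtP => h a; first by rewrite -tC -permM h.
by rewrite permM tC h.
Qed.

Lemma RtM s t : t \in R -> ((s * t)%g \in R) = (s \in R).
Proof.
move=> /RtP tC; apply/RtP/RtP => h a; first by rewrite -tC -permM h.
by rewrite permM tC h.
Qed.

Lemma PfY_col I t : t \in C -> PfY (cmp I t) = ((-1) ^+ odd_perm t * c I t) *: PfY I.
Proof.
move=> tC; rewrite /PfY [in RHS](reindex_inj (mulIg t)) /= scaler_sumr.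
under [RHS]eq_bigl => s do rewrite CtM //.
apply: eq_bigr => s _; rewrite scaler_sumr; apply: eq_bigr => u _.
rewrite scalerA mulgA (csIM _ _ I (u * s) t) -cmpM odd_permM signr_addb.
congr (_ *: _); have := signb2 F (odd_perm t); have := csI2 F (@pW m0 m1) I t.
set x := (-1) ^+ odd_perm t; set y := c I t => y2 x2.
set z := (-1) ^+ odd_perm s; set w := csI _ _ _ _.
by rewrite -[z * w]mul1r -[1]mulr1 -{1}x2 -y2; ring.
Qed.

Lemma natr_neq0 k : (0 < k)%N -> k%:R != 0 :> F.
Proof.
move=> k0; have := pcharf0P F; case=> [h _]; rewrite h; last exact: hF.
by rewrite -lt0n.
Qed.

Lemma eqN_eq0 (v : E) : v = - v -> v = 0.
Proof.
move=> /eqP; rewrite -subr_eq0 opprK -mulr2n -scaler_nat scaler_eq0.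
by rewrite (negbTE (natr_neq0 _)) //= => /eqP.
Qed.

(** For fixed [t], let [u] exchange two cells of one row that [t] sends into [X], and let [v] be its
    conjugate by [t]. The terms at [(pi, s)] and [(v * pi, s * u)] involve the same word with
    opposite signs, so the sum is its own negative. *)
Lemma PfY_garnir I (X : {set 'I_(K n r)}) :
  (forall t, t \in C -> exists z z', [/\ z != z', t z \in X, t z' \in X & trow z = trow z']) ->
  \sum_(pi | perm_on X pi) ((-1) ^+ odd_perm pi * c I pi) *: PfY (cmp I pi) = 0.
Proof.
move=> hX; under eq_bigr => pi _ do rewrite scaler_sumr.
rewrite exchange_big /= big1 // => t tC.
have [z [z' [zz' zX zX' zr]]] := hX t tC.
under eq_bigr => pi _ do rewrite scaler_sumr.
rewrite pair_big /=; apply: eqN_eq0.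
pose u : 'S_(K n r) := tperm z z'.
pose v := tperm (t z) (t z').
have ut : (u * t)%g = (t * v)%g.
  apply/permP => x; rewrite !permM; case: (tpermP z z' x) => [->|->|h1 h2].
  - by rewrite tpermL.
  - by rewrite tpermR.
  by rewrite tpermD // eq_sym (inj_eq perm_inj); apply/eqP.
pose f (q : 'S_(K n r) * 'S_(K n r)) := ((v * q.1)%g, (q.2 * u)%g).
have finj : injective f by move=> [a b] [a' b'] [/mulgI -> /mulIg ->].
rewrite [LHS](reindex_inj finj) -sumrN /=.
apply: eq_big => [[pi s] | [pi s] _] /=.
  congr andb; last first.
    by rewrite RtM //; apply/RtP => x; rewrite /u; case: tpermP => [->|->|].
  have vX : perm_on X v.
    by apply/subsetP => x; rewrite inE /v; case: tpermP => [->|->|]; rewrite ?eqxx.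
  apply/idP/idP => h; last exact: perm_onM.
  by rewrite -[pi](mulKg v) perm_onM // perm_onV.
rewrite !scalerA -!cmpM -scaleNr.
have e : (s * u * t * (v * pi) = s * t * pi)%g.
  by rewrite -(mulgA s) ut !mulgA -(mulgA (s * t)%g) tperm2 mulg1.
rewrite e; congr (_ *: _).
have vo : odd_perm v by rewrite odd_tperm (inj_eq perm_inj) zz'.
rewrite odd_permM vo addTb signrN !mulNr; congr (- _).
by rewrite mulrACA [c I _ * _]mulrC -csIM e csIM [_ * c I _]mulrC [RHS]mulrACA.
Qed.

(** Exchanging two entries equal to the odd letter [v0] costs a sign in the alternation and another
    in the Koszul sign, hence nothing. Such exchanges bring [pi] into the column group, where
    [PfY_col] applies. *)
Lemma PfY_movers I v0 (pi : 'S_(K n r)) :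
  (forall x, tcol (pi x) != tcol x -> I (pi x) = v0 /\ pW v0) ->
  ((-1) ^+ odd_perm pi * c I pi) *: PfY (cmp I pi) = PfY I.
Proof.
have [N] := ubnP #|[set x | tcol (pi x) != tcol x]|.
elim: N pi => // N IH pi leN mv.
case: (boolP (pi \in C)) => [piC|].
  by rewrite PfY_col // scalerA mulrACA signb2 csI2 mulr1 scale1r.
rewrite inE negb_forall => /existsP[x1 n1].
(* otherwise pi would map the column of pi x1 into, hence onto, itself *)
have [x2 e2 n2] : exists2 x2, tcol x2 = tcol (pi x1) & tcol (pi x2) != tcol x2.
  case: (pickP (fun x => (tcol x == tcol (pi x1)) && (tcol (pi x) != tcol x))) => [x /andP[/eqP h1 h2]|h].
    by exists x.
  pose S := [set x : 'I_(K n r) | tcol x == tcol (pi x1)].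
  have sub : [set pi x | x in S] \subset S.
    apply/subsetP => y /imsetP[x]; rewrite inE => xS ->; rewrite inE.
    by have := h x; rewrite /= xS /= => /negbFE /eqP ->.
  have eS : [set pi x | x in S] = S.
    apply/eqP; rewrite eqEcard sub card_imset ?leqnn //; exact: perm_inj.
  have : pi x1 \in [set pi x | x in S] by rewrite eS inE.
  by move=> /imsetP[y]; rewrite inE => yS /perm_inj e; move: n1; rewrite {2}e (eqP yS) eqxx.
have [v1 pv] := mv _ n1; have [v2 _] := mv _ n2.
have x12 : pi x1 != pi x2.
  by apply: contraNneq n2 => <-; rewrite e2.
pose t := tperm (pi x1) (pi x2).
have It : cmp I t = I.
  by apply/ffunP => x; rewrite ffunE /t; case: tpermP => // ->; rewrite v1 v2.
have ct : c I t = -1.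
  by rewrite /csI cs_tperm ?v1 ?v2 // pv.
have := IH (pi * t)%g; rewrite cmpM It csIM It ct odd_permM odd_tperm x12 addbT signrN.
rewrite mulrN1 mulrNN; apply.
  rewrite ltnS in leN; apply: leq_trans leN; apply: proper_card; apply/properP; split.
    apply/subsetP => x; rewrite !inE permM /t; case: tpermP => [e|/perm_inj ->|//].
      by move/perm_inj: e => ->.
    by rewrite e2 eqxx.
  by exists x2; rewrite !inE // permM /t tpermR e2 eqxx.
move=> x; rewrite permM /t; case: tpermP => [e _|e|h1 h2 nx]; [by []| |exact: mv].
by rewrite v1.
Qed.

Let L := (2 * r + 2)%N.
(** The termination measure of straightening: it drops when large letters move to the right. *)
Definition mes I : nat := \sum_(x < K n r) I x * (L - tcol x).

Lemma tcol_lt (x : 'I_(K n r)) : (tcol x < L)%N.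
Proof. by rewrite /tcol ltn_mod /L addn2. Qed.

Lemma trow_lt (x : 'I_(K n r)) : (trow x < n.+1)%N.
Proof.
rewrite /trow ltn_divLR ?addn2 //; have := ltn_ord x.
by rewrite /K /kk; move=> h; apply: leq_trans h _; nia.
Qed.

Lemma cell_lt i j : (i < n.+1 -> j < L -> i * L + j < K n r)%N.
Proof. by rewrite /K /kk /L; nia. Qed.

Lemma cellP i j : (i < n.+1)%N -> (j < L)%N ->
  exists x : 'I_(K n r), trow x = i /\ tcol x = j.
Proof.
move=> hi hj; exists (Ordinal (cell_lt hi hj)); rewrite /trow /tcol /=.
by rewrite divnMDl ?modnMDl ?divn_small ?modn_small ?addn0 // /L addn2.
Qed.

Lemma cell_inj (x y : 'I_(K n r)) : trow x = trow y -> tcol x = tcol y -> x = y.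
Proof.
by move=> hr hc; apply: ord_inj; rewrite (divn_eq x (2 * r + 2)) (divn_eq y (2 * r + 2));
  congr (_ * _ + _)%N.
Qed.

(** Column displacements add up to 0, so [v] may be subtracted from every letter. The measure then
    drops by the sum of [(I (pi x) - v) * (tcol x - tcol (pi x))], whose terms are nonnegative by
    hypothesis. *)
Lemma mes_threshold I (pi : 'S_(K n r)) (v : nat) :
  (forall x, ((I (pi x) >= v) && (tcol (pi x) <= tcol x)
           || (I (pi x) <= v) && (tcol x <= tcol (pi x)))%N) ->
  (mes (cmp I pi) <= mes I)%N /\
  (mes (cmp I pi) = mes I -> forall x, tcol (pi x) != tcol x -> I (pi x) = v :> nat).
Proof.
move=> h; pose T (x : 'I_(K n r)) : nat :=
  (absz ((I (pi x) : nat)%:Z - v%:Z) * absz ((tcol x)%:Z - (tcol (pi x))%:Z))%N.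
have TE x : (T x)%:Z = ((I (pi x) : nat)%:Z - v%:Z) * ((tcol x)%:Z - (tcol (pi x))%:Z).
  by rewrite /T; case/orP: (h x) => /andP[h1 h2]; nia.
have key : mes I = (mes (cmp I pi) + \sum_x T x)%N.
  have PS (f : 'I_(K n r) -> nat) : (\sum_x f x)%N%:Z = \sum_x (f x)%:Z.
    exact: (big_morph Posz PoszD (erefl _)).
  have S0 : \sum_x ((tcol x)%:Z - (tcol (pi x))%:Z) = 0.
    by rewrite sumrB -!PS [in X in X - _](reindex_inj (@perm_inj _ pi)) subrr.
  apply/eqP; rewrite -eqz_nat PoszD /mes !PS.
  rewrite [in X in X == _](reindex_inj (@perm_inj _ pi)) /=; apply/eqP.
  transitivity (\sum_x (((cmp I pi x * (L - tcol x))%N%:Z + (T x)%:Z)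
      + v%:Z * ((tcol x)%:Z - (tcol (pi x))%:Z))).
    apply: eq_bigr => x _; rewrite TE !PoszM ffunE -!subzn ?(ltnW (tcol_lt _)) //.
    lia.
  by rewrite !big_split /= -mulr_sumr S0 mulr0 addr0.
rewrite key; split; first exact: leq_addr.
move=> /eqP; rewrite -[X in X == _]addn0 eqn_add2l eq_sym sum_nat_eq0 => /forallP z x nx.
by move: (z x) nx; rewrite /T muln_eq0; lia.
Qed.

Lemma mes_col I t : t \in C -> mes (cmp I t) = mes I.
Proof.
move=> /CtP tC; rewrite /mes [RHS](reindex_inj (@perm_inj _ t)) /=.
by apply: eq_bigr => x _; rewrite ffunE tC.
Qed.

Lemma tperm_Ct (a b : 'I_(K n r)) : tcol a = tcol b -> tperm a b \in C.
Proof. by move=> e; apply/CtP => x; case: tpermP => [->|->|]. Qed.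

(** At a maximum of the sum of letter times row index no column has a descent, since exchanging its
    two cells would increase the sum. *)
Lemma column_sort I : exists2 t, t \in C & forall a b, tcol a = tcol b ->
  (trow a < trow b)%N -> (cmp I t a <= cmp I t b)%N.
Proof.
pose f (t : 'S_(K n r)) := (\sum_x cmp I t x * trow x)%N.
have C1 : 1%g \in C by apply/CtP => x; rewrite perm1.
have [t tC tmax] := arg_maxnP f C1; exists t => // a b ec lt; rewrite leqNgt; apply/negP => gt.
have abC : (tperm a b * t)%g \in C by rewrite CtM // tperm_Ct.
have := tmax _ abC; apply/negP.
have ab : b != a by apply: contraTneq lt => ->; rewrite ltnn.
rewrite -ltnNge /f cmpM; set J := cmp I t in gt *.
rewrite (bigD1 a) //= (bigD1 b) //= [X in (_ < X)%N](bigD1 a) //= [X in (_ < _ + X)%N](bigD1 b) //=.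
rewrite [X in (_ < _ + (_ + X))%N](eq_bigr (fun x => J x * trow x)%N); last first.
  by move=> x /andP[xa xb]; rewrite ffunE tpermD // eq_sym.
have -> : cmp J (tperm a b) a = J b by rewrite ffunE tpermL.
have -> : cmp J (tperm a b) b = J a by rewrite ffunE tpermR.
rewrite !addnA ltn_add2r; move: gt lt.
move: (nat_of_ord (J a)) (nat_of_ord (J b)) (trow a) (trow b); nia.
Qed.

Definition stdspan (v : E) := exists a : seqK -> F,
  v = \sum_(J : seqK | semistandard (fun x => J x)) a J *: PfY J.

Lemma stdspanD v w : stdspan v -> stdspan w -> stdspan (v + w).
Proof.
move=> [a ->] [b ->]; exists (fun J => a J + b J).
by rewrite -big_split; apply: eq_bigr => J _; rewrite scalerDl.
Qed.

Lemma stdspanZ k v : stdspan v -> stdspan (k *: v).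
Proof.
move=> [a ->]; exists (fun J => k * a J).
by rewrite scaler_sumr; apply: eq_bigr => J _; rewrite scalerA.
Qed.

Lemma stdspan_sum (T : finType) (P : pred T) (f : T -> E) :
  (forall i, P i -> stdspan (f i)) -> stdspan (\sum_(i | P i) f i).
Proof.
move=> h; apply: (big_ind stdspan) => //; last exact: stdspanD.
by exists (fun _ => 0); rewrite big1 // => J _; rewrite scale0r.
Qed.

Lemma stdspan_std I : semistandard (fun x => I x) -> stdspan (PfY I).
Proof.
move=> sI; exists (fun J => (J == I)%:R); rewrite (bigD1 I) //= eqxx scale1r.
by rewrite big1 ?addr0 // => J /andP[_ /negbTE ->]; rewrite scale0r.
Qed.

(** The Garnir set has n+2 cells, row [i] being counted in both columns, while the tableau has only
    n+1 rows. *)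
Lemma row_pigeonhole i a b (X : {set 'I_(K n r)}) : (i < n.+1)%N -> (a < L)%N -> (b < L)%N ->
  a != b -> (forall x, x \in X = ((tcol x == a) && (i <= trow x)%N) || ((tcol x == b) && (trow x <= i)%N)) ->
  forall t : 'S_(K n r), exists z z', [/\ z != z', t z \in X, t z' \in X & trow z = trow z'].
Proof.
move=> hi ha hb ab hX t.
have hc (j : 'I_n.+2) : exists x : 'I_(K n r), (trow x == (if (j <= i)%N then j : nat else j.-1)) &&
    (tcol x == (if (j <= i)%N then b else a)).
  have hj := ltn_ord j; case: leqP => h; [have [] := @cellP j b|have [] := @cellP j.-1 a]; try lia;
    by move=> x [e1 e2]; exists x; rewrite e1 e2 !eqxx.
have [f fP] := fin_all_exists hc.
have fX j : f j \in X.
  by rewrite hX; case/andP: (fP j); case: leqP => h /eqP -> /eqP ->; rewrite eqxx ?h ?orbT //=; lia.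
have finj j j' : f j = f j' -> j = j'.
  move=> e; apply: ord_inj; move: (fP j) (fP j'); rewrite e => /andP[/eqP h1 /eqP h2] /andP[/eqP h3 /eqP h4].
  by move: h1 h2 h3 h4 ab => ->-> ; do 2?case: leqP => ?; lia.
pose g j : 'I_n.+1 := Ordinal (trow_lt (t^-1%g (f j))).
have : ~~ injectiveb g.
  by apply/injectiveP => /leq_card; rewrite !card_ord ltnn.
move=> /injectivePn[j [j' jj' e]].
exists (t^-1%g (f j)), (t^-1%g (f j')); rewrite !permKV (inj_eq perm_inj); split => //.
  by apply: contraNneq jj' => /finj ->.
by case: e.
Qed.

Lemma PfY_straight I : stdspan (PfY I).
Proof.
have [N] := ubnP (mes I); elim: N I => // N IH I leN.
suff hs J : (mes J = mes I) -> (forall a b, tcol a = tcol b ->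
    (trow a < trow b)%N -> (J a <= J b)%N) -> stdspan (PfY J).
  have [t tC hJ] := column_sort I.
  have := hs _ (mes_col I tC) hJ; rewrite PfY_col //.
  move=> /(stdspanZ ((-1) ^+ odd_perm t * c I t)).
  by rewrite scalerA mulrACA signb2 csI2 mulr1 scale1r.
move=> mJ sJ; rewrite -mJ {I mJ} in leN.
case: (boolP (semistandard (fun x => J x))) => [/stdspan_std //|].
rewrite negb_and orbC => /orP[|].
  rewrite negb_forall => /existsP[a]; rewrite negb_forall => /existsP[b].
  rewrite negb_imply => /andP[/andP[/eqP ec lt]]; rewrite sJ //= negb_imply => /andP[/eqP Jab pa].
  rewrite (_ : PfY J = 0); first by exists (fun _ => 0); rewrite big1 // => I _; rewrite scale0r.
  have ab : a != b by apply: contraTneq lt => ->; rewrite ltnn.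
  apply: eqN_eq0; rewrite -[in LHS](_ : cmp J (tperm a b) = J); last first.
    by apply/ffunP => x; rewrite ffunE; case: tpermP => [->|->|].
  rewrite PfY_col ?tperm_Ct // /csI cs_tperm ?Jab // odd_tperm ab.
  by rewrite -Jab (negbTE pa) mulr1 scaleN1r.
rewrite negb_forall => /existsP[a]; rewrite negb_forall => /existsP[b].
rewrite negb_imply => /andP[/andP[/eqP er lt] viol].
(* The row condition fails at [a], [b]: take column [a] from this row downwards and column [b] down
   to this row. *)
pose X := [set x : 'I_(K n r) | ((tcol x == tcol a) && (trow a <= trow x)%N) || ((tcol x == tcol b) && (trow x <= trow a)%N)].
have ab : tcol a != tcol b by rewrite neq_ltn lt.
have hX := row_pigeonhole (trow_lt a) (tcol_lt a) (tcol_lt b) ab (fun x => in_set _ x : (x \in X) = _).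
have Jba : (J b <= J a)%N.
  by move: viol; rewrite negb_and => /orP[|]; [rewrite -ltnNge => /ltnW|rewrite negb_imply => /andP[/eqP -> ]].
have pJ : J a = J b :> nat -> pW (J a).
  by move=> /ord_inj e; move: viol; rewrite -e leqnn eqxx /= negbK.
have hi x : tcol x = tcol a -> (trow a <= trow x)%N -> (J a <= J x)%N.
  by move=> ec; rewrite leq_eqVlt => /orP[/eqP e|]; [rewrite (cell_inj e (esym ec))|exact: sJ].
have hl x : tcol x = tcol b -> (trow x <= trow a)%N -> (J x <= J b)%N.
  by move=> ec; rewrite er leq_eqVlt => /orP[/eqP e|]; [rewrite (cell_inj e ec)|exact: sJ].
(* As columns are sorted, letters of [X] in column [a] are at least [J a] and those in column [b] at
   most [J b]; any value in between is a threshold. *)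
have thr v (pi : 'S_(K n r)) : (J b <= v <= J a)%N -> perm_on X pi ->
    (forall x, ((J (pi x) >= v) && (tcol (pi x) <= tcol x)
           || (J (pi x) <= v) && (tcol x <= tcol (pi x)))%N).
  move=> /andP[vb va] piX x.
  case: (boolP (x \in X)) => [xX|xX]; last by rewrite (out_perm piX xX) leqnn !andbT leq_total.
  have : pi x \in X by rewrite (perm_closed _ piX).
  rewrite inE => /orP[] /andP[/eqP ec hr].
    rewrite (leq_trans va (hi _ ec hr)) ec /=; apply/orP; left.
    by move: xX; rewrite inE => /orP[] /andP[/eqP -> _] //; exact: ltnW.
  rewrite (leq_trans (hl _ ec hr) vb) ec /=; apply/orP; right.
  by move: xX; rewrite inE => /orP[] /andP[/eqP -> _] //; exact: ltnW.
have G := PfY_garnir J (fun t _ => hX t).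
have le pi : perm_on X pi -> (mes (cmp J pi) <= mes J)%N.
  by move=> h; apply: (mes_threshold (thr (J a) pi _ h)).1; rewrite Jba leqnn.
rewrite (bigID (fun pi => mes (cmp J pi) == mes J)) /= in G.
(* If the measure is kept, the thresholds [J a] and [J b] show that a letter changing column equals
   both. It is then odd, and [PfY_movers] makes every such term equal to [PfY J]. *)
have eqP1 : \sum_(pi | perm_on X pi && (mes (cmp J pi) == mes J))
    ((-1) ^+ odd_perm pi * c J pi) *: PfY (cmp J pi) =
    #|[pred pi | perm_on X pi && (mes (cmp J pi) == mes J)]|%:R *: PfY J.
  rewrite -[in RHS]sum1_card natr_sum scaler_suml.
  apply: eq_bigr => pi /andP[piX /eqP em]; rewrite scale1r; apply: (@PfY_movers J (J a)) => x nx.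
  have ha := (mes_threshold (thr (J a) pi (introT andP (conj Jba (leqnn _))) piX)).2 em x nx.
  have hb := (mes_threshold (thr (J b) pi (introT andP (conj (leqnn _) Jba)) piX)).2 em x nx.
  by split; [exact: ord_inj|apply: pJ; rewrite -ha].
rewrite eqP1 in G.
(* The identity is among these permutations, so [PfY J] can be solved for in terms of smaller
   measure. *)
have c0 : #|[pred pi | perm_on X pi && (mes (cmp J pi) == mes J)]|%:R != 0 :> F.
  apply: natr_neq0; apply/card_gt0P; exists 1%g.
  by rewrite inE perm_on1 cmp1 eqxx.
move/eqP: G; rewrite addr_eq0 => /eqP G.
rewrite -[PfY J](scalerK c0) G; apply: stdspanZ; rewrite -scaleN1r; apply: stdspanZ.
apply: stdspan_sum => pi /andP[piX ne]; apply: stdspanZ; apply: IH.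
by rewrite ltnS in leN; apply: leq_trans leN; rewrite ltn_neqAle ne le.
Qed.

End Straightening.

(** Down the first column the even letters increase strictly, so the last row starts with an odd
    letter. From there it increases strictly and would need 2r+1 odd letters. *)
Lemma no_semistandard n r (J : Seq n r n (2 * r)) : ~~ semistandard J.
Proof.
apply/negP => /andP[/forallP hrow /forallP hcol].
have col i : (i < n.+1)%N -> forall x, trow x = i -> tcol x = 0%N -> (minn i n <= J x)%N.
  elim: i => [|i IH] hi x rx cx; first by rewrite min0n.
  have [y [ry cy]] := @cellP n r i 0 (ltnW hi) ltac:(by rewrite addn2).
  have := IH (ltnW hi) y ry cy.
  have /forallP/(_ x) := hcol y; rewrite cy cx ry rx eqxx ltnSn /= => /andP[h1 /implyP h2].
  have : J y = J x :> nat -> (n <= J y)%N by move=> /ord_inj e; apply: h2; rewrite e.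
  lia.
have row j : (j < 2 * r + 2)%N -> forall x, trow x = n -> tcol x = j -> (n + j <= J x)%N.
  elim: j => [|j IH] hj x rx cx; first by have := col n (ltnSn n) x rx cx; rewrite minnn addn0.
  have [y [ry cy]] := @cellP n r n j (ltnSn n) (ltnW hj).
  have := IH (ltnW hj) y ry cy.
  have /forallP/(_ x) := hrow y; rewrite ry rx cy cx eqxx ltnSn /= => /andP[h1 /implyP h2].
  have : J y = J x :> nat -> (J y < n)%N by move=> /ord_inj e; rewrite ltnNge; apply: h2; rewrite e.
  lia.
have [y [ry cy]] := @cellP n r n (2 * r) (ltnSn n) ltac:(lia).
have := row _ _ y ry cy; have := ltn_ord (J y); lia.
Qed.

Lemma PfY_small (F : fieldType) (hF : [pchar F] =i pred0) n r (E : lmodType F)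
    (Y : {ffun 'I_(K n r) -> 'I_(n + 2 * r)} -> E) J : PfY Y J = 0.
Proof.
have [a ->] := PfY_straight hF Y J; rewrite big1 // => I.
by rewrite (negbTE (no_semistandard _)).
Qed.

(** * Highest weight vectors for the pairing *)

Section Pairing.
Variable k : nat.
Local Notation N := (2 * k)%N.

Lemma prpos_subproof (q : 'I_k * bool) : (2 * q.1 + q.2 < N)%N.
Proof. by case: q => a [] /=; have := ltn_ord a; lia. Qed.
Definition prpos q : 'I_N := Ordinal (prpos_subproof q).

Lemma half_subproof (x : 'I_N) : (x./2 < k)%N.
Proof. by have := ltn_ord x; lia. Qed.
Definition hf (x : 'I_N) : 'I_k := Ordinal (half_subproof x).

Lemma prposK : cancel prpos (fun x => (hf x, odd x)).
Proof.
move=> [a b]; congr (_, _); first apply: ord_inj; rewrite /=; case: b; lia.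
Qed.
Lemma hfK : cancel (fun x : 'I_N => (hf x, odd x)) prpos.
Proof. by move=> x; apply: ord_inj; rewrite /=; lia. Qed.

Lemma big_pairs (R : Type) (idx : R) (op : Monoid.com_law idx) (f : 'I_N -> R) :
  \big[op/idx]_x f x = \big[op/idx]_(a < k) op (f (prpos (a, false))) (f (prpos (a, true))).
Proof.
rewrite (reindex prpos); last by exists (fun x => (hf x, odd x)) => x _; [exact: prposK|exact: hfK].
rewrite (eq_bigr (fun q => f (prpos (q.1, q.2)))); last by case.
rewrite -(pair_bigA _ (fun a b => f (prpos (a, b)))) /=.
by apply: eq_bigr => a _; rewrite big_bool Monoid.mulmC.
Qed.

Definition partner_fun (x : 'I_N) := prpos (hf x, ~~ odd x).
Lemma partner_funK : involutive partner_fun.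
Proof. by move=> x; apply: ord_inj; rewrite /=; case: (boolP (odd x)) => /=; lia. Qed.
Definition partner : 'S_N := perm (inv_inj partner_funK).

Lemma partnerE x : partner x = prpos (hf x, ~~ odd x). Proof. by rewrite permE. Qed.
Lemma partner_val x : partner x = (if odd x then x.-1 else x.+1) :> nat.
Proof. by rewrite partnerE /=; case: (boolP (odd x)) => /=; lia. Qed.
Lemma partnerK : involutive partner.
Proof. by move=> x; rewrite !permE partner_funK. Qed.
Lemma partner_neq x : partner x != x.
Proof. by rewrite -val_eqE /= partner_val; case: ifP; lia. Qed.
Lemma partner_pr a b : partner (prpos (a, b)) = prpos (a, ~~ b).
Proof. by rewrite partnerE; congr prpos; have [-> ->] := prposK (a, b). Qed.

Definition Hk : {group 'S_N} := 'C[partner]%G.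

Lemma HkP (h : 'S_N) : reflect (forall x, h (partner x) = partner (h x)) (h \in Hk).
Proof.
apply: (iffP cent1P) => [e x|e]; first by rewrite -!permM e.
by apply/permP => x; rewrite !permM e.
Qed.

Lemma tperm_Hk x : tperm x (partner x) \in Hk.
Proof.
apply/HkP => y; case: (tpermP x (partner x) y) => [->|->|h1 h2].
- by rewrite tpermR partnerK.
- by rewrite partnerK tpermL.
rewrite tpermD //; first by apply: contra_not_neq h2 => ->; rewrite partnerK.
by apply: contra_not_neq h1 => /perm_inj ->.
Qed.

Lemma tperm2_Hk x y : y != partner x -> x != y ->
  (tperm (partner x) (partner y) * tperm x y)%g \in Hk.
Proof.
move=> yx xy; apply/HkP => z; rewrite !permM.
have h1 := partner_neq x; have h2 := partner_neq y.
have h3 : x != partner y by apply: contraNneq yx => ->; rewrite partnerK.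
have h4 : partner x != partner y by rewrite (inj_eq perm_inj).
have tp u v (s : 'I_N) : u != s -> v != s -> tperm u v s = s by move=> ? ?; rewrite tpermD.
have a1 : tperm x y (partner x) = partner x by rewrite tp // eq_sym.
have a2 : tperm x y (partner y) = partner y by rewrite tp // eq_sym.
have a3 : tperm (partner x) (partner y) x = x by rewrite tp // eq_sym.
have a4 : tperm (partner x) (partner y) y = y by rewrite tp // eq_sym.
have [->|nx] := eqVneq z x; first by rewrite a3 !tpermL a2.
have [->|ny] := eqVneq z y; first by rewrite a4 !tpermR a1.
have [->|npx] := eqVneq z (partner x).
  by rewrite partnerK a3 !tpermL a2 partnerK.
have [->|npy] := eqVneq z (partner y).
  by rewrite partnerK a4 !tpermR a1 partnerK.
have mp u : z != partner u -> u != partner z.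
  by apply: contraNneq => ->; rewrite partnerK.
rewrite (tp _ _ (partner z)) ?(inj_eq perm_inj) 1?eq_sym //.
rewrite (tp _ _ (partner z)) ?mp // (tp _ _ z) 1?eq_sym // (tp x y z) 1?eq_sym //.
Qed.

Section Lift.
Variable th : 'S_k.
Definition liftp_fun (x : 'I_N) := prpos (th (hf x), odd x).
Lemma liftp_inj : injective liftp_fun.
Proof. by move=> x y /(can_inj prposK) [/perm_inj e1 e2]; rewrite -[x]hfK -[y]hfK /= e1 e2. Qed.
Definition liftp : 'S_N := perm liftp_inj.
Lemma liftpE a b : liftp (prpos (a, b)) = prpos (th a, b).
Proof. by rewrite permE /liftp_fun; have [-> ->] := prposK (a, b). Qed.
Lemma liftp_Hk : liftp \in Hk.
Proof. by apply/HkP => x; rewrite -[x]hfK partner_pr !liftpE partner_pr. Qed.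
End Lift.

Lemma liftpM s t : liftp (s * t) = (liftp s * liftp t)%g.
Proof. by apply/permP => x; rewrite -[x]hfK permM !liftpE permM. Qed.

Section Diag.
Variable T : finType.
Implicit Types I : {ffun 'I_N -> T}.

Definition diag I := forall x, I (partner x) = I x.

(** Such words are words of k letters with each letter doubled, and equal contents are matched by a
    permutation of the pairs. *)
Lemma diag_conj I p : diag I -> diag (cmp I p) -> exists2 h, h \in Hk & cmp I p = cmp I h.
Proof.
set J := cmp I p => dI dJ.
pose ri := [tuple I (prpos (a, false)) | a < k].
pose rj := [tuple J (prpos (a, false)) | a < k].
have cnt I' s : diag I' -> (\sum_x (I' x == s) = 2 * count_mem s [tuple I' (prpos (a, false)) | a < k])%N.
  move=> dI'; rewrite big_pairs /= -sum1_count big_map big_distrr /= [RHS]big_mkcond /=.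
  rewrite big_enum /=; apply: eq_bigr => a _.
  rewrite -[prpos (a, true)](partner_pr a false) dI'.
  by case: eqP.
have : perm_eq rj ri.
  apply/allP => s _ /=; have := cnt _ s dJ; have := cnt _ s dI.
  rewrite (reindex_inj (@perm_inj _ p)) /=.
  rewrite (eq_bigr (fun x => nat_of_bool (J x == s))); last by move=> x _; rewrite ffunE.
  by move=> -> /eqP; rewrite eqn_pmul2l // eq_sym.
move=> /tuple_permP [th eth]; exists (liftp th); first exact: liftp_Hk.
apply/ffunP => x; rewrite [RHS]ffunE -[x]hfK liftpE.
have e a : J (prpos (a, false)) = I (prpos (th a, false)).
  have : tnth rj a = tnth [tuple tnth ri (th i) | i < k] a by rewrite (val_inj eth).
  by rewrite !tnth_mktuple.
case: (odd x); last exact: e.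
by rewrite -!(partner_pr _ false) dI dJ e.
Qed.
End Diag.

Lemma cmp_tperm (T : Type) (I : {ffun 'I_N -> T}) a b y :
  cmp I (tperm a b) y = if y == a then I b else if y == b then I a else I y.
Proof.
rewrite ffunE; case: tpermP => [->|->|/eqP/negbTE -> /eqP/negbTE -> //]; rewrite eqxx //.
by case: eqP => [->|].
Qed.

Section HighestWeight.
Variables (R : fieldType) (hR : [pchar R] =i pred0) (m : nat) (bl : 'I_m -> nat).
Implicit Types I : {ffun 'I_N -> 'I_m}.
Variable f : {ffun 'I_N -> 'I_m} -> R.

(** By [raising_upd] this is the vanishing of a raising operator at the word where [I a] is replaced
    by [i], for letters in one block only: the condition of a highest weight vector for a Levi
    subgroup. *)
Definition raising I := forall a (i : 'I_m), (i < I a)%N -> bl i = bl (I a) ->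
  f I + \sum_(b | I b == i) f (cmp I (tperm a b)) = 0.

Definition nocross I := forall x, bl (I (partner x)) = bl (I x).

(** Induction on the number of positions whose partner carries another letter. At such a position
    [a], whose partner carries a smaller letter [i], the raising relation consists of copies of
    [f I] and of values at words with fewer unequal pairs, so a positive multiple of [f I]
    vanishes. *)
Lemma hw_unique I0 :
  (forall I h, h \in Hk -> f (cmp I h) = f I) ->
  (forall s, nocross (cmp I0 s) -> raising (cmp I0 s)) ->
  (forall s, diag (cmp I0 s) -> f (cmp I0 s) = 0) ->
  forall s, nocross (cmp I0 s) -> f (cmp I0 s) = 0.
Proof.
move=> fH hw fd s.
have [n] := ubnP #|[set x | cmp I0 s (partner x) != cmp I0 s x]|.
elim: n s => // n IH s; set I := cmp I0 s => len nc.
case: (pickP (fun x => I (partner x) != I x)) => [x0 nx0|dI]; last first.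
  by apply: fd => x; apply/eqP; move: (dI x) => /negbFE.
have [a lta] : exists a, (I (partner a) < I a)%N.
  case: (ltngtP (I (partner x0)) (I x0)) => [h|h|/ord_inj h]; first by exists x0.
    by exists (partner x0); rewrite partnerK.
  by rewrite h eqxx in nx0.
pose i := I (partner a).
have nbI b : I b = i -> b != a.
  by move=> e; apply: contraTneq lta => eb; rewrite eb in e; rewrite e ltnn.
(* If [b] is the partner of [a], or lies in a pair with both letters [i], the exchange amounts to an
   element of [Hk]. Otherwise it makes the pair of [a] equal and spoils none, the pair of [b] being
   unequal already. *)
have term b : I b == i -> f (cmp I (tperm a b)) =
    if (b == partner a) || (I (partner b) == i) then f I else 0.
  move=> /eqP Ib; have ba := nbI b Ib.
  have [->|bpa] := eqVneq b (partner a); first by rewrite fH // tperm_Hk.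
  have ab : a != b by rewrite eq_sym.
  case: eqP => [Ipb|/eqP Ipb].
    rewrite -[RHS](fH I _ (tperm2_Hk bpa ab)) cmpM; congr f.
    apply/ffunP => y; rewrite [RHS]ffunE; case: tpermP => [->|->|//].
      have h1 := partner_neq a; have h2 := nbI _ Ipb.
      rewrite !cmp_tperm (negbTE h1) (negbTE h2) (negbTE (partner_neq b)).
      by case: eqP => [e|_]; [rewrite e eqxx in bpa|rewrite Ipb].
    have h1 := partner_neq a; have h2 := nbI _ Ipb.
    rewrite !cmp_tperm (negbTE h1) (negbTE h2) (negbTE (partner_neq b)).
    by case: eqP => [e|_]; [rewrite e eqxx in bpa|rewrite Ipb].
  have pba : partner b != a by apply: contraNneq bpa => <-; rewrite partnerK.
  have pab : partner a != b by rewrite eq_sym.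
  have E y : cmp I (tperm a b) y = if y == a then i else if y == b then I a else I y.
    by rewrite cmp_tperm Ib.
  rewrite -cmpM; apply: IH; rewrite cmpM -/I.
    rewrite ltnS in len; apply: leq_trans len; apply: proper_card; apply/properP; split.
      apply/subsetP => y; rewrite !inE !E; have [->|ya] := eqVneq y a.
        by rewrite (negbTE (partner_neq a)) (negbTE pab) eqxx.
      have [e|pya] := eqVneq (partner y) a.
        have -> : y = partner a by rewrite -e partnerK.
        by rewrite (negbTE pab) eqxx.
      have [-> _|yb] := eqVneq y b; first by rewrite Ib Ipb.
      have [e _|//] := eqVneq (partner y) b.
      have -> : y = partner b by rewrite -e partnerK.
      by rewrite partnerK Ib eq_sym.
    exists a; first by rewrite inE neq_ltn lta.
    by rewrite inE !E eqxx (negbTE (partner_neq a)) (negbTE pab) negbK.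
  have bia : bl i = bl (I a) by exact: nc.
  move=> y; rewrite !E; have [->|ya] := eqVneq y a.
    by rewrite (negbTE (partner_neq a)) (negbTE pab).
  have [e|pya] := eqVneq (partner y) a.
    have -> : y = partner a by rewrite -e partnerK.
    by rewrite (negbTE pab).
  have [->|yb] := eqVneq y b; first by rewrite (negbTE (partner_neq b)) nc Ib.
  have [e|_] := eqVneq (partner y) b; last exact: nc.
  have -> : y = partner b by rewrite -e partnerK.
  by rewrite nc Ib.
have := hw _ nc a i lta (nc a).
rewrite (eq_bigr _ term) -big_mkcondr /= sumr_const -[X in X + _]mulr1n -mulrnDr.
rewrite -mulr_natr => /eqP; rewrite mulf_eq0 (negbTE (natr_neq0 hR _)) ?add1n // orbF.
by move=> /eqP.
Qed.

End HighestWeight.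

Definition upd (T : Type) (I : {ffun 'I_N -> T}) x v : {ffun 'I_N -> T} :=
  [ffun y => if y == x then v else I y].

Section Orbit.
Variables (R : fieldType) (hR : [pchar R] =i pred0) (m : nat).
Implicit Types I : {ffun 'I_N -> 'I_m}.

Lemma raising_upd (f : {ffun 'I_N -> 'I_m} -> R) I a (i : 'I_m) : (i < I a)%N ->
  f I + \sum_(b | I b == i) f (cmp I (tperm a b)) =
  \sum_(b | upd I a i b == i) f (upd (upd I a i) b (I a)).
Proof.
move=> lt; rewrite [RHS](bigD1 a) /=; last by rewrite ffunE eqxx.
congr (f _ + _).
  by apply/ffunP => y; rewrite !ffunE; case: eqP => // ->.
have nba b : I b = i -> (b == a) = false.
  by move=> e; apply/eqP => eb; rewrite eb in e; rewrite e ltnn in lt.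
apply: eq_big => [b|b /eqP Ib].
  rewrite ffunE; have [->|//] := eqVneq b a; rewrite ?andbT ?andbF //.
  by apply/negbTE; rewrite neq_ltn lt orbT.
congr f; apply/ffunP => y; rewrite cmp_tperm !ffunE Ib.
by case: (eqVneq y a) => [->|//]; rewrite eq_sym nba.
Qed.

Definition orbsum (I0 : {ffun 'I_N -> 'I_m}) (Psi : 'S_N -> R) I : R :=
  \sum_p Psi p * (I == cmp I0 p)%:R.

(** After the letter of [I0] at [z] is replaced by [i], the exchange of [z] and [z'] no longer
    changes the word, whereas it negates [Psi]; so the sum belonging to each [z] is its own
    negative. *)
Lemma orbsum_raising I0 Psi I a (i : 'I_m) :
  (i < I a)%N ->
  (forall z, I0 z = I a -> exists z', [/\ z' != z, I0 z' = i &
     forall p, Psi (p * tperm z z')%g = - Psi p]) ->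
  orbsum I0 Psi I + \sum_(b | I b == i) orbsum I0 Psi (cmp I (tperm a b)) = 0.
Proof.
move=> lt anti; rewrite raising_upd //; set I' := upd I a i; set j := I a.
rewrite /orbsum exchange_big /=.
transitivity (\sum_(z | I0 z == j) \sum_p Psi p * (I' == cmp (upd I0 z i) p)%:R).
  rewrite [RHS]exchange_big; apply: eq_bigr => p _ /=.
  rewrite (reindex_inj (@perm_inj _ p^-1%g)) /= big_mkcond [RHS]big_mkcond /=.
  apply: eq_bigr => z _.
  case: (eqVneq (I' (p^-1%g z)) i) => h1; case: (eqVneq (I0 z) j) => h2 //.
  - congr (_ * _); congr (nat_of_bool _)%:R.
    have npy y : y != p^-1%g z -> (p y == z) = false.
      by move=> ny; apply/negbTE; apply: contraNneq ny => <-; rewrite permK.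
    apply/eqP/eqP => /ffunP e; apply/ffunP => y; move: (e y); rewrite !ffunE;
      have [->|ny] := eqVneq y (p^-1%g z); rewrite ?permKV ?eqxx ?npy ?h1 ?h2 //.
    by move: h1; rewrite !ffunE => ->.
  - rewrite (_ : (_ == _) = false) ?mulr0 //; apply/eqP => /ffunP /(_ (p^-1%g z)).
    by rewrite !ffunE eqxx permKV => e; rewrite e eqxx in h2.
  rewrite (_ : (_ == _) = false) ?mulr0 //; apply/eqP => /ffunP /(_ (p^-1%g z)).
    have -> : cmp (upd I0 z i) p (p^-1%g z) = i by rewrite !ffunE permKV eqxx.
    by move=> e; rewrite e eqxx in h1.
apply: big1 => z /eqP Iz; have [z' [nz' Iz' hz']] := anti z Iz.
have L : cmp (upd I0 z i) (tperm z z') = upd I0 z i.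
  apply/ffunP => y; rewrite cmp_tperm !ffunE (negbTE nz') eqxx.
  by case: (eqVneq y z) => // _; case: (eqVneq y z') => // ->; rewrite Iz'.
set S := \sum_p _; suff e : S = - S.
  apply/eqP; move/eqP: e; rewrite -subr_eq0 opprK -mulr2n -mulr_natr mulf_eq0.
  by rewrite (negbTE (natr_neq0 hR _)) // orbF.
rewrite {1}/S (reindex_inj (mulIg (tperm z z'))) -sumrN /=; apply: eq_bigr => p _.
by rewrite hz' mulNr cmpM L.
Qed.

Lemma orbsum_Hk I0 Psi I h : (forall h p, h \in Hk -> Psi (h * p)%g = Psi p) ->
  h \in Hk -> orbsum I0 Psi (cmp I h) = orbsum I0 Psi I.
Proof.
move=> hP hH; rewrite /orbsum (reindex_inj (mulgI h)) /=; apply: eq_bigr => p _.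
rewrite hP // cmpM; congr (_ * _%:R); congr nat_of_bool; apply/eqP/eqP => [e|-> //].
by rewrite -[I](cmpK _ h) e cmpK.
Qed.

Lemma orbsum_nz I0 Psi I : orbsum I0 Psi I != 0 -> exists2 p, I = cmp I0 p & Psi p != 0.
Proof.
move=> nz; case: (pickP (fun p => (I == cmp I0 p) && (Psi p != 0))) => [p /andP[/eqP h1 h2]|h].
  by exists p.
move: nz; rewrite /orbsum big1 ?eqxx // => p _.
by move: (h p); case: eqP => _ /=; rewrite ?mulr0 // => /negbFE /eqP ->; rewrite mul0r.
Qed.

End Orbit.

Section Core.
Variables (F : fieldType) (hF : [pchar F] =i pred0) (m : nat) (bl : 'I_m -> nat).
Implicit Types I : {ffun 'I_N -> 'I_m}.

Lemma intr_eq0P (z : int) : (z%:~R == 0 :> F) = (z == 0).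
Proof.
case: z => [[|z]|z]; rewrite ?eqxx //; first exact/negbTE/(natr_neq0 hF).
by rewrite NegzE rmorphN oppr_eq0; exact/negbTE/(natr_neq0 hF).
Qed.

Lemma orbsum_intr I0 (Psi : 'S_N -> int) I :
  orbsum I0 (fun p => (Psi p)%:~R : F) I = (\sum_p Psi p * (I == cmp I0 p)%:R)%:~R.
Proof.
rewrite rmorph_sum; apply: eq_bigr => p _; rewrite rmorphM /=.
by case: (_ == _).
Qed.

(** The orbit sum [Phi] of [Psi] satisfies the conditions imposed on [u], so uniqueness makes the
    two proportional on noncrossing words. In the vanishing pairing [u] may then be replaced by
    [Phi], which leaves a sum of squares of integers. *)
Lemma hw_core (u : {ffun 'I_N -> 'I_m} -> F) I0 (Psi : 'S_N -> int) :
  (forall I h, h \in Hk -> u (cmp I h) = u I) ->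
  (forall s, nocross bl (cmp I0 s) -> raising bl u (cmp I0 s)) ->
  diag I0 ->
  (forall h p, h \in Hk -> Psi (h * p)%g = Psi p) ->
  (forall p, Psi p != 0 -> nocross bl (cmp I0 p)) ->
  (forall z (i : 'I_m), (i < I0 z)%N -> bl i = bl (I0 z) ->
     exists z', [/\ z' != z, I0 z' = i & forall p, Psi (p * tperm z z')%g = - Psi p]) ->
  \sum_p (Psi p)%:~R * u (cmp I0 p) = 0 ->
  (exists I, \sum_p Psi p * (I == cmp I0 p)%:R != 0) ->
  u I0 = 0.
Proof.
move=> uH uR dI0 PH Pnc Pa Su [I1 nI1].
pose Phi := orbsum I0 (fun p => (Psi p)%:~R : F).
pose PhiZ I := \sum_p Psi p * (I == cmp I0 p)%:R.
have PE I : Phi I = (PhiZ I)%:~R by exact: orbsum_intr.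
have PhiH I h : h \in Hk -> Phi (cmp I h) = Phi I.
  by apply: orbsum_Hk => h' p hh; rewrite PH.
have PhiR I : raising bl Phi I.
  move=> a i lt eb; apply: orbsum_raising => // z Iz.
  have [||z' [h1 h2 h3]] := Pa z i; rewrite ?Iz //.
  by exists z'; split => // p; rewrite h3 rmorphN.
have Phinc I : Phi I != 0 -> exists2 p, I = cmp I0 p & nocross bl (cmp I0 p).
  move=> /orbsum_nz[p -> np]; exists p => //; apply: Pnc.
  by apply: contraNneq np => ->.
(* Otherwise uniqueness would annihilate [Phi] on all noncrossing rearrangements of [I0], in
   particular at [I1]. *)
have Phi0 : Phi I0 != 0.
  apply/negP => /eqP z0.
  have /Phinc[p eI nc] : Phi I1 != 0 by rewrite PE intr_eq0P.
  suff : Phi I1 = 0 by move=> /eqP; rewrite PE intr_eq0P (negbTE nI1).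
  rewrite eI; apply: (hw_unique hF PhiH _ _ nc) => // s ds.
  by have [h hH ->] := diag_conj dI0 ds; rewrite PhiH.
pose g I := u I * Phi I0 - u I0 * Phi I.
have g0 s : nocross bl (cmp I0 s) -> g (cmp I0 s) = 0.
  apply: (@hw_unique F hF m bl g I0).
  - by move=> I h hH; rewrite /g uH // PhiH.
  - move=> s' nc a i lt eb; have := uR s' nc a i lt eb; have := PhiR (cmp I0 s') a i lt eb.
    rewrite /g sumrB -mulr_suml -mulr_sumr => e1 e2.
    by rewrite addrACA -mulrDl -opprD -mulrDr e1 e2 mul0r mulr0 subr0.
  move=> s' ds; have [h hH ->] := diag_conj dI0 ds; rewrite /g uH // PhiH //.
  by rewrite subrr.
have key : u I0 * (\sum_I PhiZ I * PhiZ I)%:~R = 0.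
  rewrite -[RHS](mul0r (Phi I0)) -Su mulr_suml.
  transitivity (u I0 * \sum_p (Psi p)%:~R * Phi (cmp I0 p)).
    congr (_ * _); rewrite rmorph_sum /= .
    under eq_bigr => I _ do rewrite rmorphM /= -!PE {1}/Phi /orbsum mulr_suml.
    rewrite exchange_big; apply: eq_bigr => p _ /=.
    rewrite (bigD1 (cmp I0 p)) //= eqxx mulr1 big1 ?addr0 // => I.
    by move=> /negbTE ->; rewrite mulr0 mul0r.
  rewrite mulr_sumr; apply: eq_bigr => p _.
  have [->|nP] := eqVneq (Psi p) 0; first by rewrite !mul0r mulr0.
  have /eqP := g0 p (Pnc p nP); rewrite /g subr_eq0 => /eqP e.
  by rewrite mulrCA -e mulrA.
move/eqP: key; rewrite mulf_eq0 intr_eq0P => /orP[/eqP //|].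
have pos (J : {ffun 'I_N -> 'I_m}) : true -> 0 <= PhiZ J * PhiZ J by rewrite -expr2 Num.Theory.sqr_ge0.
by rewrite Num.Theory.psumr_eq0 // => /allP /(_ I1 (mem_index_enum _)) /=; rewrite mulf_eq0 orbb (negbTE nI1).
Qed.
End Core.

End Pairing.

(** * Young symmetrizers of rectangles *)

Section Antisymmetrizer.
Variable k : nat.
Local Notation N := (2 * k)%N.
Local Notation w := (partner k).
Implicit Types (S C : {set 'S_N}) (t h p : 'S_N).

(** [t] acts on [P] and, through the partner map, in the same way on the complement; so it is a
    permutation times a conjugate of it. *)
Lemma even_of_partner t (P : pred 'I_N) :
  (forall x, t (w x) = w (t x)) -> (forall x, P (w x) = ~~ P x) -> (forall x, P (t x) = P x) ->
  odd_perm t = false.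
Proof.
move=> tw Pw Pt; pose te x := if P x then t x else x.
have te_inj : injective te.
  move=> x y; rewrite /te; case: ifP => Px; case: ifP => Py; first exact: perm_inj.
  - by move=> e; move: (Pt x); rewrite e Py Px.
  - by move=> e; move: (Pt y); rewrite -e Py Px.
  by [].
have -> : t = (perm te_inj * (perm te_inj) ^ w)%g.
  apply/permP => x; rewrite permM /conjg !permM.
  have wV : (w^-1)%g =1 w by move=> y; apply: (@perm_inj _ w); rewrite permKV partnerK.
  have E y : perm te_inj y = te y by rewrite permE.
  rewrite wV !E; case Px: (P x).
    by rewrite [te x]/te Px /te Pw Pt Px partnerK.
  by rewrite [te x]/te Px /te Pw Px /= tw partnerK.
by rewrite odd_permM odd_permJ addbb.
Qed.

(** The coefficient of [p] in the group algebra product of the sum over [Hk], the sum over [S] and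
    the signed sum over [C]. *)
Definition antisym S C p : int :=
  \sum_(h in Hk k) \sum_(s in S) \sum_(t in C) (-1) ^+ odd_perm t * (h * s * t == p)%g%:R.

Lemma antisym_Hk S C h p : h \in Hk k -> antisym S C (h * p)%g = antisym S C p.
Proof.
move=> hH; rewrite /antisym (reindex_inj (mulgI h)) /=.
apply: eq_big => [x|x _]; first by rewrite groupMl.
apply: eq_bigr => s _; apply: eq_bigr => t _; congr (_ * _%:R).
by rewrite -!mulgA (inj_eq (mulgI h)).
Qed.

Lemma antisym_tperm S C p z z' : z != z' ->
  (forall t, (t * tperm z z' \in C)%g = (t \in C)) ->
  antisym S C (p * tperm z z')%g = - antisym S C p.
Proof.
move=> zz' hC; rewrite /antisym -sumrN; apply: eq_bigr => h _.
rewrite -sumrN; apply: eq_bigr => s _.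
rewrite (reindex_inj (mulIg (tperm z z'))) -sumrN /=; apply: eq_big => [t|t _]; first exact: hC.
rewrite mulgA (inj_eq (mulIg _)) odd_permM odd_tperm zz' addbT signrN.
by rewrite mulNr.
Qed.

Lemma antisym_sum (F : fieldType) S C (G : 'S_N -> F) :
  \sum_p (antisym S C p)%:~R * G p =
  \sum_(h in Hk k) \sum_(s in S) \sum_(t in C) (-1) ^+ odd_perm t * G (h * s * t)%g.
Proof.
transitivity (\sum_p \sum_(h in Hk k) \sum_(s in S) \sum_(t in C)
    ((-1) ^+ odd_perm t * (h * s * t == p)%g%:R * G p)).
  apply: eq_bigr => p _; rewrite rmorph_sum mulr_suml; apply: eq_bigr => h _.
  rewrite rmorph_sum mulr_suml; apply: eq_bigr => s _.
  rewrite rmorph_sum mulr_suml; apply: eq_bigr => t _.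
  by rewrite rmorphM /= rmorphXn /= rmorphN1; case: (_ == _).
rewrite exchange_big; apply: eq_bigr => h _; rewrite exchange_big; apply: eq_bigr => s _.
rewrite exchange_big; apply: eq_bigr => t _ /=.
rewrite (bigD1 (h * s * t)%g) //= eqxx mulr1 big1 ?addr0 // => p.
by rewrite eq_sym => /negbTE ->; rewrite mulr0 mul0r.
Qed.

Lemma antisym_sum_inv (F : fieldType) (T : Type) S C (u : {ffun 'I_N -> T} -> F) I0 :
  (forall I h, h \in Hk k -> u (cmp I h) = u I) ->
  \sum_p (antisym S C p)%:~R * u (cmp I0 p) =
  #|Hk k|%:R * \sum_(s in S) \sum_(t in C) (-1) ^+ odd_perm t * u (cmp I0 (s * t)%g).
Proof.
move=> uH; rewrite antisym_sum -[#|_|]sum1_card natr_sum mulr_suml; apply: eq_bigr => h hH.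
rewrite mul1r; apply: eq_bigr => s _; apply: eq_bigr => t _.
by rewrite -mulgA cmpM uH.
Qed.

Section Tableau.
Variables (m : nat) (I0 : {ffun 'I_N -> 'I_m}) (col : 'I_N -> nat) (C : {set 'S_N}).
Hypothesis dI0 : diag I0.
Hypothesis cell_inj : forall x y, I0 x = I0 y -> col x = col y -> x = y.
Hypothesis colw : forall x, col (w x) = if odd (col x) then (col x).-1 else (col x).+1.
Hypothesis Ccol : forall t x, t \in C -> col (t x) = col x.

(** A cell is known from its letter and its column, so [t] commutes with the partner map. Partners
    lie in columns of opposite parity, which gives the set required by [even_of_partner]. *)
Lemma diag_even t : t \in C -> diag (cmp I0 t) -> odd_perm t = false.
Proof.
move=> tC dt; apply: (@even_of_partner t (fun x => odd (col x))) => x.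
- apply: cell_inj; first by rewrite dI0; move: (dt x); rewrite !ffunE.
  by rewrite Ccol // !colw Ccol.
- by rewrite colw; case: ifP; lia.
by rewrite Ccol.
Qed.

(** By [diag_even] only even [t] contribute to the coefficient of [I0], so nothing cancels the
    contribution of the identity. *)
Lemma antisym_pos : 1%g \in C -> \sum_p antisym [set 1%g] C p * (I0 == cmp I0 p)%:R != 0.
Proof.
move=> C1; pose G p : rat := (I0 == cmp I0 p)%:R.
have eG : \sum_p (antisym [set 1%g] C p)%:~R * G p =
    (\sum_p antisym [set 1%g] C p * (I0 == cmp I0 p)%:R)%:~R.
  by rewrite rmorph_sum; apply: eq_bigr => p _; rewrite rmorphM /G /=; case: (_ == _).
rewrite -(@intr_eq0 rat) -eG.
rewrite antisym_sum.
have tm h t : h \in Hk k -> t \in C -> (-1) ^+ odd_perm t * G (h * t)%g = G (h * t)%g.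
  move=> hH tC; rewrite /G; case: eqP => [e|_]; last by rewrite mulr0.
  have e2 : cmp I0 t = cmp I0 (h^-1)%g by rewrite [in RHS]e cmpM cmpK.
  rewrite diag_even ?mul1r // => x; rewrite e2 !ffunE.
  by have /HkP -> := groupVr hH; rewrite dI0.
under eq_bigr => h hH do (rewrite big_set1; under eq_bigr => t tC do rewrite mulg1 tm //).
have ge0 p : 0 <= G p by rewrite /G ler0n.
apply: lt0r_neq0; rewrite (bigD1 1%g) ?group1 //= (bigD1 1%g) //= mulg1.
rewrite {1}/G cmp1 eqxx -addrA ltr_pwDl ?ltr01 // addr_ge0 //.
  by apply: sumr_ge0.
by apply: sumr_ge0 => h _; apply: sumr_ge0.
Qed.

End Tableau.
End Antisymmetrizer.

Section Rectangle.
Variables (F : fieldType) (hF : [pchar F] =i pred0) (n r m : nat).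
Local Notation k := (kk n r).
Local Notation N := (2 * k)%N.
Local Notation w := (partner k).
Local Notation R := (Rt n r : {set 'S_N}).
Local Notation C := (Ct n r : {set 'S_N}).
Variable I0 : {ffun 'I_N -> 'I_m}.
Hypothesis I0E : forall x : 'I_N, I0 x = trow (x : 'I_(K n r)) :> nat.
Implicit Types (I : {ffun 'I_N -> 'I_m}) (s t p : 'S_N).

Lemma partner_cell (x : 'I_(K n r)) : trow (w x : 'I_(K n r)) = trow x /\
  tcol (w x : 'I_(K n r)) = if odd (tcol x) then (tcol x).-1 else (tcol x).+1.
Proof.
set c' := if _ then _ else _.
have hc := tcol_lt x; have ec' : (c' < 2 * r + 2)%N by rewrite /c'; case: ifP; lia.
have [y [ry cy]] := cellP (trow_lt x) ec'.
suff -> : w x = y by [].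
apply: ord_inj; rewrite partner_val.
have ex : x = (trow x * (2 * r + 2) + tcol x)%N :> nat by exact: divn_eq.
have ey : y = (trow y * (2 * r + 2) + tcol y)%N :> nat by exact: divn_eq.
rewrite {}ey ry cy ex /c' oddD oddM (_ : odd (2 * r + 2) = false) ?andbF /=; last lia.
case: ifP => //; lia.
Qed.

Lemma rect_diag : diag I0.
Proof. by move=> x; apply: ord_inj; rewrite !I0E (partner_cell x).1. Qed.

Lemma rect_cell_inj x y : I0 x = I0 y -> tcol (x : 'I_(K n r)) = tcol (y : 'I_(K n r)) -> x = y.
Proof. by move=> e; apply: cell_inj; rewrite -!I0E e. Qed.

Lemma rect_pos : \sum_p antisym [set 1%g] C p * (I0 == cmp I0 p)%:R != 0.
Proof.
apply: (@antisym_pos _ m I0 (fun x => tcol (x : 'I_(K n r)))).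
- exact: rect_diag.
- exact: rect_cell_inj.
- by move=> x; exact: (partner_cell x).2.
- by move=> t x /CtP; exact.
by apply/CtP => x; rewrite perm1.
Qed.

Lemma rect_above (z : 'I_N) (i : 'I_m) : (i < I0 z)%N -> exists z',
  [/\ z' != z, I0 z' = i, tperm z z' \in C & forall t, (t * tperm z z' \in C)%g = (t \in C)].
Proof.
rewrite I0E => lt; have li : (i < n.+1)%N by apply: ltn_trans lt (trow_lt _).
have [z' [rz cz]] := cellP li (tcol_lt (z : 'I_(K n r))).
have tC : tperm z z' \in C by apply: tperm_Ct.
exists z'; split => //.
- by apply: contraTneq lt => <-; rewrite rz ltnn.
- by apply: ord_inj; rewrite I0E.
by move=> t; rewrite CtM.
Qed.

(** The analogue of [hw_unique] for the row group, reflecting that a Kostka number with equal shape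
    and content is 1. Rows are made constant from the top: at a wrong cell of row [i], exchanges
    inside the row reproduce [f I], and exchanges with lower rows reduce the number of wrong
    cells. *)
Lemma trow_unique (f : {ffun 'I_N -> 'I_m} -> F) :
  (forall I s, s \in R -> f (cmp I s) = f I) ->
  (forall s, raising (fun=> 0%N) f (cmp I0 s)) ->
  f I0 = 0 -> forall s, f (cmp I0 s) = 0.
Proof.
move=> fR hw f0.
suff cl d s : (forall x : 'I_N, (trow (x : 'I_(K n r)) + d < n.+1)%N -> cmp I0 s x = trow (x : 'I_(K n r)) :> nat) ->
    f (cmp I0 s) = 0.
  by move=> s; apply: (cl n.+1) => x; rewrite addnC ltnNge leq_addr.
elim: d s => [|d IHd] s pure.
  rewrite (_ : cmp I0 s = I0) //; apply/ffunP => x; apply: ord_inj.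
  by rewrite pure ?addn0 ?trow_lt // I0E.
have [dn|nd] := leqP d n; last first.
  by apply: IHd => x h; exfalso; move: h; apply/negP; rewrite -leqNgt; lia.
pose i := (n - d)%N.
have [e] := ubnP #|[set x : 'I_N | (trow (x : 'I_(K n r)) == i) && (cmp I0 s x != i :> nat)]|.
elim: e s pure => // e IHe s pure le.
set I := cmp I0 s in pure le *.
case: (pickP (fun x : 'I_N => (trow (x : 'I_(K n r)) == i) && (I x != i :> nat))) => [a /andP[/eqP ra na]|all]; last first.
  apply: IHd => x hx; have [lt|ge] := ltnP (trow (x : 'I_(K n r))) i; first by apply: pure; lia.
  have ei : trow (x : 'I_(K n r)) = i by lia.
  by move: (all x); rewrite ei eqxx /= => /negbFE /eqP.
(* letters below i are used up by the pure rows *)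
have used x : (I x < i)%N -> trow (x : 'I_(K n r)) = I x :> nat.
  move=> lt; pose j := I x.
  pose A := [set y : 'I_N | trow (y : 'I_(K n r)) == j]; pose B := [set y | I y == j].
  have AB : A \subset B.
    apply/subsetP => y; rewrite !inE => /eqP ry; apply/eqP/ord_inj.
    by rewrite pure ?ry // /j; move: lt; rewrite /i; lia.
  have cAB : #|B| = #|A|.
    rewrite -[RHS](card_preimset _ (@perm_inj _ s)); apply: eq_card => y; rewrite !inE.
    by rewrite /I ffunE -val_eqE /= I0E.
  have : A = B by apply/eqP; rewrite eqEcard AB cAB leqnn.
  by move=> /setP /(_ x); rewrite !inE eqxx => /eqP.
have lt : (i < I a)%N.
  by rewrite ltn_neqAle eq_sym na /= leqNgt; apply/negP => /[dup] /used; rewrite ra => ->; rewrite ltnn.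
have li : (i < m)%N by apply: ltn_trans lt (ltn_ord _).
have := hw s a (Ordinal li) lt erefl; rewrite -/I.
have term b : I b == Ordinal li -> f (cmp I (tperm a b)) =
   if trow (b : 'I_(K n r)) == i then f I else 0.
  move=> /eqP Ib; case: eqP => rb.
    by apply: fR; apply/RtP => x; case: tpermP => [->|->|//]; rewrite ra rb.
  have Ibn : I b = i :> nat by rewrite Ib.
  have rbi : (i < trow (b : 'I_(K n r)))%N.
    by rewrite ltn_neqAle eq_sym; apply/andP; split; [exact/eqP|rewrite leqNgt; apply/negP => h; apply: rb; rewrite -pure //; lia].
  rewrite -cmpM; apply: IHe; rewrite cmpM -/I.
    move=> x hx; rewrite cmp_tperm; case: eqP => [e1|_]; first by move: hx; rewrite e1 ra; lia.
    by case: eqP => [e1|_]; [move: hx; rewrite e1; lia|exact: pure].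
  rewrite ltnS in le; apply: leq_trans le; apply: proper_card; apply/properP; split.
    apply/subsetP => x; rewrite !inE => /andP[rx]; rewrite rx cmp_tperm.
    case: (eqVneq x a) => [_|_]; first by rewrite Ibn eqxx.
    by case: (eqVneq x b) => // e1; move: rbi; rewrite -e1 (eqP rx) ltnn.
  exists a; first by rewrite inE ra eqxx na.
  by rewrite inE cmp_tperm eqxx Ibn eqxx andbF.
rewrite (eq_bigr _ term) -big_mkcondr /= sumr_const -[X in X + _]mulr1n -mulrnDr.
rewrite -mulr_natr => /eqP; rewrite mulf_eq0 (negbTE (natr_neq0 hF _)) ?add1n // orbF.
by move=> /eqP.
Qed.

Lemma antisym_raising S I : raising (fun=> 0%N)
  (orbsum I0 (fun p => (antisym S C p)%:~R : F)) I.
Proof.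
move=> a i lt _; apply: orbsum_raising => // z Iz.
have [z' [h1 h2 _ h3]] := @rect_above z i ltac:(by rewrite Iz).
by exists z'; split => // p; rewrite antisym_tperm ?rmorphN // eq_sym.
Qed.

Definition rowsum (f : {ffun 'I_N -> 'I_m} -> F) I := \sum_(s in R) f (cmp I s).

Lemma rowsum_R f I s : s \in R -> rowsum f (cmp I s) = rowsum f I.
Proof.
move=> sR; rewrite /rowsum [RHS](reindex_inj (mulIg s)) /=.
by apply: eq_big => [t|t _]; rewrite ?RtM // cmpM.
Qed.

Lemma rowsum_raising f : (forall I, raising (fun=> 0%N) f I) ->
  forall I, raising (fun=> 0%N) (rowsum f) I.
Proof.
move=> hf I a i lt _; rewrite /rowsum exchange_big -big_split big1 //= => s _.
have lt' : (i < cmp I s (s^-1%g a))%N by rewrite ffunE permKV.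
rewrite -[RHS](hf _ _ _ lt' erefl); congr (_ + _).
rewrite [LHS](reindex_inj (@perm_inj _ s)) /=; apply: eq_big => [b|b _]; first by rewrite ffunE.
congr f; rewrite -!cmpM; congr cmp; apply/permP => x; rewrite !permM.
case: (tpermP (s^-1%g a) b x) => [->|->|h1 h2]; first by rewrite permKV tpermL.
  by rewrite tpermR permKV.
rewrite tpermD //; first by apply/eqP => e; apply: h1; rewrite e permK.
by apply/eqP => /perm_inj e; apply: h2.
Qed.

Lemma rect_row_cmp s : s \in R -> cmp I0 s = I0.
Proof. by move=> /RtP sR; apply/ffunP => x; apply: ord_inj; rewrite ffunE !I0E sR. Qed.

(** The polytabloid of the rectangle, as a function on words. *)
Let q I : int := \sum_(t in C) (-1) ^+ odd_perm t * (I == cmp I0 t)%:R.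
Let qF I : F := (q I)%:~R.

Lemma R_gt0 : (0 < #|R|)%N.
Proof. by apply/card_gt0P; exists 1%g; apply/RtP => x; rewrite perm1. Qed.

Lemma q_raising I : raising (fun=> 0%N) qF I.
Proof.
have qE J : qF J = orbsum I0 (fun p => if p \in C then (-1) ^+ odd_perm p else 0) J.
  rewrite /qF /q /orbsum rmorph_sum [LHS]big_mkcond; apply: eq_bigr => p _.
  case: ifP => _; last by rewrite mul0r.
  by rewrite rmorphM /= rmorphXn /= rmorphN1; case: (_ == _).
move=> a i lt _; rewrite qE; under eq_bigr => b _ do rewrite qE.
apply: orbsum_raising => // z Iz.
have [z' [h1 h2 _ h3]] := @rect_above z i ltac:(by rewrite Iz).
exists z'; split => // p; rewrite h3; case: ifP => _; last by rewrite oppr0.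
by rewrite odd_permM odd_tperm eq_sym h1 addbT signrN.
Qed.

Lemma q_I0 : q I0 = 1.
Proof.
have C1 : 1%g \in C by apply/CtP => x; rewrite perm1.
rewrite /q (bigD1 1%g) //= cmp1 eqxx odd_perm1 mulr1 big1 ?addr0 // => t /andP[/CtP tC t1].
case: eqP => [/ffunP e|]; last by rewrite mulr0.
case/eqP: t1; apply/permP => x; rewrite perm1; apply: rect_cell_inj; last exact: tC.
by rewrite [RHS]e ffunE.
Qed.

(** Times the order of the row group, this is the sum of the squares of the row-symmetrized
    polytabloid, whose value at [I0] is that order. *)
Lemma q_rowsum_neq0 : \sum_(t in C) (-1) ^+ odd_perm t * rowsum qF (cmp I0 t) != 0.
Proof.
pose f2 I : int := \sum_(s in R) q (cmp I s).
have f2E I : rowsum qF I = (f2 I)%:~R by rewrite rmorph_sum.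
have f2R I s : s \in R -> f2 (cmp I s) = f2 I.
  move=> sR; rewrite /f2 [RHS](reindex_inj (mulIg s)) /=.
  by apply: eq_big => [t|t _]; rewrite ?RtM // cmpM.
have e : (\sum_(t in C) (-1) ^+ odd_perm t * f2 (cmp I0 t)) *+ #|R| = \sum_I f2 I * f2 I.
  rewrite -sumr_const.
  have -> : \sum_(t in C) (-1) ^+ odd_perm t * f2 (cmp I0 t) = \sum_I q I * f2 I.
    under [RHS]eq_bigr => I _ do rewrite mulr_suml.
    rewrite exchange_big; apply: eq_bigr => t tC /=.
    rewrite (bigD1 (cmp I0 t)) //= eqxx mulr1 big1 ?addr0 // => I.
    by move=> /negbTE ->; rewrite mulr0 mul0r.
  under [RHS]eq_bigr => I _ do rewrite [in X in X * _]/f2 mulr_suml.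
  rewrite [RHS]exchange_big; apply: eq_bigr => s sR /=.
  have cinj : injective (fun I : {ffun 'I_N -> 'I_m} => cmp I s).
    by apply: (can_inj (g := fun I => cmp I s^-1%g)) => I; rewrite cmpK.
  by rewrite [LHS](reindex_inj cinj) /=; apply: eq_bigr => I _; rewrite f2R.
under eq_bigr => t _ do rewrite f2E.
have -> : \sum_(t in C) (-1) ^+ odd_perm t * (f2 (cmp I0 t))%:~R =
    (\sum_(t in C) (-1) ^+ odd_perm t * f2 (cmp I0 t))%:~R :> F.
  by rewrite rmorph_sum; apply: eq_bigr => t _; rewrite rmorphM /= rmorphXn /= rmorphN1.
rewrite intr_eq0P //; apply/eqP => e0; move: e; rewrite e0 mul0rn => /esym/eqP.
rewrite psumr_eq0 => [|I _]; last by rewrite -expr2 sqr_ge0.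
move=> /allP /(_ I0 (mem_index_enum _)) /=; rewrite mulf_eq0 orbb /f2.
rewrite (eq_bigr (fun=> 1)); last by move=> s sR; rewrite rect_row_cmp // q_I0.
by rewrite sumr_const pnatr_eq0 => /eqP e1; have := R_gt0; rewrite e1.
Qed.

(** The rectangle condition involves the whole Young symmetrizer, but only column antisymmetrizers
    fit larger shapes. Against an [Hk]-invariant function the row sum merely rescales: with it or
    without it one gets highest weight invariants of the same weight, proportional by
    [hw_unique]. *)
Lemma rect_row_free (u : {ffun 'I_N -> 'I_m} -> F) :
  (forall I h, h \in Hk k -> u (cmp I h) = u I) ->
  \sum_(s in R) \sum_(t in C) (-1) ^+ odd_perm t * u (cmp I0 (s * t)%g) = 0 ->
  \sum_(t in C) (-1) ^+ odd_perm t * u (cmp I0 t) = 0.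
Proof.
move=> uH u0.
pose Pab p := (antisym R C p)%:~R : F; pose Pb p := (antisym [set 1%g] C p)%:~R : F.
pose fab := orbsum I0 Pab; pose fb := orbsum I0 Pb.
have Hn0 : #|Hk k|%:R != 0 :> F by apply: natr_neq0 => //; apply: cardG_gt0.
have fabH I h : h \in Hk k -> fab (cmp I h) = fab I.
  by apply: orbsum_Hk => h' p hh; rewrite /Pab antisym_Hk.
have fbH I h : h \in Hk k -> fb (cmp I h) = fb I.
  by apply: orbsum_Hk => h' p hh; rewrite /Pb antisym_Hk.
have fb0 : fb I0 != 0 by rewrite /fb orbsum_intr // intr_eq0P // rect_pos.
have prop1 s : fab (cmp I0 s) * fb I0 - fab I0 * fb (cmp I0 s) = 0.
  apply: (@hw_unique k F hF m (fun=> 0%N) (fun I => fab I * fb I0 - fab I0 * fb I) I0) => //.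
  - by move=> I h hH; rewrite fabH // fbH.
  - move=> s' _ a i lt eb.
    have e1 := @antisym_raising R _ _ _ lt eb; have e2 := @antisym_raising [set 1%g] _ _ _ lt eb.
    rewrite sumrB -mulr_suml -mulr_sumr addrACA -mulrDl -opprD -mulrDr.
    have z (A B c d : F) : A = 0 -> B = 0 -> A * c - d * B = 0.
      by move=> -> ->; rewrite mul0r mulr0 subr0.
      exact: z e1 e2.
  move=> s' ds; have [h hH ->] := diag_conj rect_diag ds.
  by rewrite fabH // fbH // subrr.
have osum (P : 'S_N -> F) : \sum_p P p * u (cmp I0 p) = \sum_I orbsum I0 P I * u I.
  under [RHS]eq_bigr => I _ do rewrite mulr_suml.
  rewrite exchange_big; apply: eq_bigr => p _ /=.
  rewrite (bigD1 (cmp I0 p)) //= eqxx mulr1 big1 ?addr0 // => I.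
  by move=> /negbTE ->; rewrite mulr0 mul0r.
have prop2 I : fab I * fb I0 = fab I0 * fb I.
  have [z|/orbsum_nz[p -> _]] := eqVneq (fab I) 0; last by apply/eqP; rewrite -subr_eq0 prop1.
  have [z'|/orbsum_nz[p -> _]] := eqVneq (fb I) 0; last by apply/eqP; rewrite -subr_eq0 prop1.
  by rewrite z z' mul0r mulr0.
(* The factor is not 0: otherwise [fab] vanishes, and since the row sums of [fb] and of the
   polytabloid are proportional by [trow_unique], this contradicts [q_rowsum_neq0]. *)
have fab0 : fab I0 != 0.
  apply/negP => /eqP fz.
  have fabz s : fab (cmp I0 s) = 0.
    by apply/eqP; rewrite -(mulIr_eq0 _ (mulIf fb0)) prop2 fz mul0r.
  have f1prop s : rowsum fb (cmp I0 s) * rowsum qF I0 = rowsum fb I0 * rowsum qF (cmp I0 s).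
    apply/eqP; rewrite -subr_eq0; apply/eqP; move: s.
    apply: (@trow_unique (fun I => rowsum fb I * rowsum qF I0 - rowsum fb I0 * rowsum qF I)).
    - by move=> I s sR; rewrite !rowsum_R.
    - move=> s a i lt eb.
      have e1 := rowsum_raising (@antisym_raising [set 1%g]) lt eb.
      have e2 := rowsum_raising q_raising lt eb.
      rewrite sumrB -mulr_suml -mulr_sumr addrACA -mulrDl -opprD -mulrDr.
      have z (A B c d : F) : A = 0 -> B = 0 -> A * c - d * B = 0.
      by move=> -> ->; rewrite mul0r mulr0 subr0.
      exact: z e1 e2.
    by rewrite subrr.
  have f1I0 : rowsum fb I0 != 0.
    rewrite /rowsum (eq_bigr (fun=> fb I0)); last by move=> s sR; rewrite rect_row_cmp.
    rewrite sumr_const -mulr_natr mulf_neq0 // natr_neq0 // R_gt0 //.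
  (* Moving [h] to the other side of the equality of words, as its inverse, exchanges the roles of
     the two column sums and turns [fb] with a row sum into [fab]. *)
  have Z : \sum_(t in C) (-1) ^+ odd_perm t * rowsum fb (cmp I0 t) = 0.
    transitivity (\sum_(t in C) (-1) ^+ odd_perm t * fab (cmp I0 t)); last first.
      by rewrite big1 // => t _; rewrite fabz mulr0.
    pose W (a b : {ffun 'I_N -> 'I_m}) (t t' : 'S_N) : F :=
      (-1) ^+ odd_perm t * ((-1) ^+ odd_perm t' * (a == b)%:R).
    transitivity (\sum_(t in C) \sum_(s in R) \sum_(h in Hk k) \sum_(t' in C)
        W (cmp I0 (s * t)%g) (cmp I0 (h * t')%g) t t').
      apply: eq_bigr => t _; rewrite mulr_sumr; apply: eq_bigr => s _.
      rewrite /fb /orbsum antisym_sum mulr_sumr; apply: eq_bigr => h _.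
      by rewrite big_set1 mulr_sumr; apply: eq_bigr => t' _; rewrite -cmpM mulg1.
    transitivity (\sum_(t' in C) \sum_(h in Hk k) \sum_(s in R) \sum_(t in C)
        W (cmp I0 t') (cmp I0 (h * s * t)%g) t' t); last first.
      apply: eq_bigr => t _; rewrite /fab /orbsum antisym_sum mulr_sumr; apply: eq_bigr => h _.
      by rewrite mulr_sumr; apply: eq_bigr => s _; rewrite mulr_sumr.
    under eq_bigr => t _ do (under eq_bigr => s _ do rewrite exchange_big).
    under eq_bigr => t _ do rewrite exchange_big.
    rewrite exchange_big; apply: eq_bigr => t' _ /=.
    under eq_bigr => t _ do rewrite exchange_big.
    rewrite exchange_big (reindex_inj (@invg_inj _)) /=.
    apply: eq_big => [h|h _]; first by rewrite groupV.
    rewrite exchange_big; apply: eq_bigr => s _; apply: eq_bigr => t _.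
    rewrite /W mulrCA; congr (_ * (_ * (nat_of_bool _)%:R)).
    rewrite -!mulgA (cmpM _ h^-1%g) (cmpM _ h).
    by apply/eqP/eqP => [->|->]; rewrite ?cmpK ?cmpKV.
  have := q_rowsum_neq0; apply/negP; rewrite negbK.
  rewrite -(mulrI_eq0 _ (mulfI f1I0)) mulr_sumr.
  under eq_bigr => t _ do rewrite mulrCA -f1prop mulrA.
  by rewrite -mulr_suml Z mul0r.
have key := antisym_sum_inv R C I0 uH; rewrite u0 mulr0 osum in key.
have : fab I0 * \sum_p Pb p * u (cmp I0 p) = 0.
  transitivity ((\sum_I fab I * u I) * fb I0); last by rewrite [X in X * _]key mul0r.
  rewrite osum mulr_sumr mulr_suml; apply: eq_bigr => I _.
  by rewrite mulrA -prop2 mulrAC.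
move=> /eqP; rewrite mulf_eq0 (negbTE fab0) /= /Pb antisym_sum_inv // mulf_eq0 (negbTE Hn0) /=.
by rewrite big_set1 => /eqP; under eq_bigr => t _ do rewrite mul1g.
Qed.

End Rectangle.

(** * The orthosymplectic form on words *)

Section BlockPerm.
Variables (k0 N : nat) (e : 'I_k0 -> 'I_N).
Hypothesis e_inj : injective e.

Definition ext_fun (s : 'S_k0) x := if [pick y | e y == x] is Some y then e (s y) else x.

Lemma ext_fun_e s y : ext_fun s (e y) = e (s y).
Proof.
rewrite /ext_fun; case: pickP => [y' /eqP /e_inj -> //|/(_ y)].
by rewrite eqxx.
Qed.

Lemma ext_fun_out s x : (forall y, e y != x) -> ext_fun s x = x.
Proof. by move=> h; rewrite /ext_fun; case: pickP => // y; rewrite (negbTE (h y)). Qed.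

Lemma block_case x : (exists y, x = e y) \/ (forall y, e y != x).
Proof.
case: (pickP (fun y => e y == x)) => [y /eqP <-|h]; first by left; exists y.
by right => y; rewrite h.
Qed.

Lemma ext_fun_inj s : injective (ext_fun s).
Proof.
move=> x x'; case: (block_case x) => [[y ->]|h]; case: (block_case x') => [[y' ->]|h'];
  rewrite ?ext_fun_e ?ext_fun_out //.
- by move=> /e_inj /perm_inj ->.
- by move=> e1; case/eqP: (h' (s y)).
by move=> e1; case/eqP: (h (s y')).
Qed.

Definition ext s : 'S_N := perm (@ext_fun_inj s).

Lemma ext_e s y : ext s (e y) = e (s y). Proof. by rewrite permE ext_fun_e. Qed.
Lemma ext_out s x : (forall y, e y != x) -> ext s x = x.
Proof. by move=> h; rewrite permE ext_fun_out. Qed.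

Lemma extM s t : ext (s * t)%g = (ext s * ext t)%g.
Proof.
apply/permP => x; rewrite permM; case: (block_case x) => [[y ->]|h]; last by rewrite !ext_out.
by rewrite !ext_e permM.
Qed.

Lemma ext1 : ext 1%g = 1%g.
Proof.
apply/permP => x; case: (block_case x) => [[y ->]|h]; last by rewrite ext_out ?perm1.
by rewrite ext_e !perm1.
Qed.

Lemma ext_tperm x y : ext (tperm x y) = tperm (e x) (e y).
Proof.
apply/permP => z; case: (block_case z) => [[u ->]|h].
  rewrite ext_e; case: (tpermP x y u) => [->|->|h1 h2]; rewrite ?tpermL ?tpermR //.
  by rewrite tpermD //; apply/eqP => /e_inj e1; [apply: h1|apply: h2].
by rewrite ext_out // tpermD.
Qed.

Lemma odd_ext s : odd_perm (ext s) = odd_perm s.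
Proof.
apply: (@perm_supp_ind _ predT (fun s => ext s = s :> bool)) => [|{}s x y _ _ xy _ IH|//].
  by rewrite ext1 !odd_perm1.
by rewrite extM !odd_permM IH ext_tperm !odd_tperm (inj_eq e_inj).
Qed.

(** The block is an interval, so adjacent transpositions inside it stay adjacent in the whole
    word. *)
Lemma cs_ext (R : comNzRingType) (P : 'I_N -> bool) s M : (forall y, e y = M + y :> nat)%N ->
  cs R P (ext s) = cs R (P \o e) s.
Proof.
move=> eE; move: s P; apply: perm_adj_ind => [|s i j eij IH] P; first by rewrite ext1 !cs1.
rewrite extM !csM IH ext_tperm; congr (_ * _).
by rewrite !cs_adj ?eE ?eij ?addnS //= !ext_e.
Qed.

End BlockPerm.

Section Good.
Variable k : nat.
Local Notation N := (2 * k)%N.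
Local Notation lo a := (prpos (a, false)).
Local Notation hi a := (prpos (a, true)).

Lemma liftp1 : liftp 1%g = 1%g :> 'S_N.
Proof. by apply/permP => x; rewrite -[x]hfK liftpE !perm1. Qed.

(** [Hk] is the hyperoctahedral group: flipping the pairs whose orientation [h] reverses leaves a
    permutation of the pairs. *)
Lemma Hk_ind (Q : 'S_N -> Prop) : Q 1%g -> (forall s t, Q s -> Q t -> Q (s * t)%g) ->
  (forall a : 'I_k, Q (tperm (lo a) (hi a))) ->
  (forall i j : 'I_k, j = i.+1 :> nat -> Q (liftp (tperm i j))) ->
  forall h, h \in Hk k -> Q h.
Proof.
move=> Q1 QM Qw Ql.
have QL (th : 'S_k) : Q (liftp th).
  move: th; apply: perm_adj_ind => [|s i j eij IH]; first by rewrite liftp1.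
  by rewrite liftpM; apply: QM => //; apply: Ql.
move=> h; have [e] := ubnP #|[set a : 'I_k | odd (h (lo a))]|.
elim: e h => // e IH h le hH; have hw := HkP _ hH.
case: (pickP (fun a : 'I_k => odd (h (lo a)))) => [a oa|all].
  have -> : h = (tperm (lo a) (hi a) * (tperm (lo a) (hi a) * h))%g.
    by rewrite mulgA tperm2 mul1g.
  apply: QM => //; apply: IH; last first.
    by apply: groupM => //; rewrite -(partner_pr a false) tperm_Hk.
  rewrite ltnS in le; apply: leq_trans le; apply: proper_card; apply/properP; split.
    apply/subsetP => b; rewrite !inE permM; case: (eqVneq b a) => [-> //|ba].
    by rewrite tpermD //; apply/eqP => /(can_inj (@prposK k)) [e1]; rewrite e1 eqxx in ba.
  exists a; first by rewrite inE.
  by rewrite inE permM tpermL -(partner_pr a false) hw partner_val oa; case: (nat_of_ord _) oa => //= n0.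
pose th a := hf (h (lo a)).
have ev a : odd (h (lo a)) = false by exact: all.
have thE a : h (lo a) = lo (th a) by rewrite -[LHS]hfK ev.
have th_inj : injective th.
  by move=> a b ab; have := thE a; rewrite ab -thE => /perm_inj /(can_inj (@prposK k)) [].
suff -> : h = liftp (perm th_inj) by exact: QL.
apply/permP => x; rewrite -[x]hfK liftpE permE.
case: (odd x); last by rewrite thE.
by rewrite -!(partner_pr _ false) hw thE.
Qed.

(** Two neighbouring pairs are exchanged by four adjacent transpositions, one for each letter of the
    first pair passing one of the second. *)
Lemma cs_liftp_adj (R : comNzRingType) (P : 'I_N -> bool) (i j : 'I_k) : j = i.+1 :> nat ->
  cs R P (liftp (tperm i j)) = (-1) ^+ ((P (lo i) (+) P (hi i)) && (P (lo j) (+) P (hi j))).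
Proof.
move=> eij; pose x0 := lo i; pose x1 := hi i; pose x2 := lo j; pose x3 := hi j.
have e1 : x1 = x0.+1 :> nat by rewrite /=; lia.
have e2 : x2 = x1.+1 :> nat by rewrite /=; lia.
have e3 : x3 = x2.+1 :> nat by rewrite /=; lia.
have n01 : x0 != x1 by rewrite -val_eqE /=; lia.
have n02 : x0 != x2 by rewrite -val_eqE /=; lia.
have n03 : x0 != x3 by rewrite -val_eqE /=; lia.
have n12 : x1 != x2 by rewrite -val_eqE /=; lia.
have n13 : x1 != x3 by rewrite -val_eqE /=; lia.
have n23 : x2 != x3 by rewrite -val_eqE /=; lia.
have tD u v (z : 'I_N) : u != z -> v != z -> tperm u v z = z by exact: tpermD.
have E : liftp (tperm i j) = (tperm x1 x2 * (tperm x0 x1 * (tperm x2 x3 * tperm x1 x2)))%g.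
  apply/permP => x; rewrite -[x]hfK liftpE !permM.
  case: (tpermP i j (hf x)) => [->|->|/eqP h1 /eqP h2].
  - case: (odd x); rewrite -/x0 -/x1 -/x2 -/x3.
      by rewrite tpermL (tD x0 x1 x2) // tpermL (tD x1 x2 x3).
    by rewrite (tD x1 x2 x0) 1?eq_sym // tpermL (tD x2 x3 x1) 1?eq_sym // tpermL.
  - case: (odd x); rewrite -/x0 -/x1 -/x2 -/x3.
      by rewrite (tD x1 x2 x3) // (tD x0 x1 x3) // tpermR tpermR.
    by rewrite tpermR tpermR (tD x2 x3 x0) 1?eq_sym // (tD x1 x2 x0) // eq_sym.
  have ne a b c : a != hf x -> prpos (a, b) != prpos (hf x, c) :> 'I_N.
    by move=> h; apply: contraNneq h => /(can_inj (@prposK k)) [->].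
  by rewrite !tD ?ne // eq_sym.
rewrite E !csM !(cs_adj _ _ e1, cs_adj _ _ e2, cs_adj _ _ e3) /= !permM.
rewrite ?(tpermL, tpermR) (tD x2 x3 x1) 1?eq_sym // ?(tpermL, tpermR) (tD x2 x3 x0) 1?eq_sym //.
rewrite ?(tD x1 x2 x0) 1?eq_sym // ?(tD x1 x2 x3) // ?(tD x0 x1 x2) // ?(tD x2 x3 x1) 1?eq_sym // ?(tD x0 x1 x3) // ?(tpermL, tpermR).
rewrite (tD x1 x2 x3) // -/x0 -/x1 -/x2 -/x3 -!signr_addb; congr (_ ^+ nat_of_bool _).
by case: (P x0); case: (P x1); case: (P x2); case: (P x3).
Qed.

Variables (R : comNzRingType) (T : Type) (p : T -> bool) (E : lmodType R).
Variable Y : {ffun 'I_N -> T} -> E.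

Lemma good_functional :
  (forall (a : 'I_k) I, Y I = csI R p I (tperm (lo a) (hi a)) *: Y (cmp I (tperm (lo a) (hi a)))) ->
  (forall (i j : 'I_k) I, j = i.+1 :> nat ->
     Y I = csI R p I (liftp (tperm i j)) *: Y (cmp I (liftp (tperm i j)))) ->
  forall I h, h \in Hk k -> Y I = csI R p I h *: Y (cmp I h).
Proof.
move=> g1 g2 I h hH; move: h hH I.
apply: Hk_ind => [I|s t hs ht I|a I|i j eij I]; [|rewrite ht hs|exact: g1|exact: g2].
  by rewrite csI1 scale1r cmp1.
by rewrite scalerA csIM -cmpM mulrC.
Qed.

End Good.

Section Omega.
Variables n r : nat.
Local Notation V := 'I_(n + 2 * r).
Local Notation pV := (@pW n (2 * r)).

(** The Gram matrix of the form. Indices start at 0, so dual indices add up to n-1 in the even part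
    and, after subtracting n from each, to 2r-1 in the odd part. *)
Definition omz (i j : V) : int :=
  if ~~ pV i && ~~ pV j then (i + j + 1 == n)%N%:R
  else if pV i && pV j && ((i - n) + (j - n) + 1 == 2 * r)%N then
    (if (i - n < r)%N then -1 else 1) else 0.

Lemma omzC i j : omz i j = (-1) ^+ (pV i && pV j) * omz j i.
Proof.
rewrite /omz; case: (boolP (pV i)) => hi; case: (boolP (pV j)) => hj /=; rewrite ?mulr0 //.
  rewrite (addnC (j - n)%N); case: eqP => [e|_]; last by rewrite mulr0.
  rewrite expr1 mulN1r; case: ltnP => h1; case: ltnP => h2; rewrite ?opprK //; lia.
by rewrite (addnC j) mul1r.
Qed.

Lemma omz_parity i j : omz i j != 0 -> pV i = pV j.
Proof. by rewrite /omz; case: (pV i); case: (pV j); rewrite ?eqxx. Qed.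

Definition omega k (J : {ffun 'I_(2 * k) -> V}) : int :=
  \prod_(a < k) omz (J (prpos (a, false))) (J (prpos (a, true))).

Lemma omega_parity k (J : {ffun 'I_(2 * k) -> V}) a : omega J != 0 ->
  pV (J (prpos (a, false))) = pV (J (prpos (a, true))).
Proof. by move=> /prodf_neq0 h; apply: omz_parity; apply: h. Qed.

Lemma omega_good k (J : {ffun 'I_(2 * k) -> V}) h : h \in Hk k ->
  omega J = csI int pV J h * omega (cmp J h).
Proof.
move: J h; apply: (@good_functional k int V pV int^o (@omega k)) => [a J|i j J eij].
  rewrite /csI cs_adj /=; last lia.
  rewrite /omega (bigD1 a) //= [in RHS](bigD1 a) //= !ffunE tpermL tpermR omzC.
  rewrite -[RHS]/(_ * _) mulrA; congr (_ * _); apply: eq_bigr => b ba.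
  have ne c c' : prpos (a, c) != prpos (b, c') :> 'I_(2 * k).
    by apply: contraNneq ba => /(can_inj (@prposK k)) [->].
  by rewrite !ffunE !tpermD.
have e : omega (cmp J (liftp (tperm i j))) = omega J.
  rewrite /omega [RHS](reindex_inj (@perm_inj _ (tperm i j))).
  by apply: eq_bigr => a _; rewrite !ffunE !liftpE.
rewrite e; have [->|nz] := eqVneq (omega J) 0; first by rewrite scaler0.
by rewrite /csI cs_liftp_adj // (omega_parity i nz) addbb scale1r.
Qed.

Lemma csI_intr (R : comNzRingType) N (T : Type) (p : T -> bool) (I : {ffun 'I_N -> T}) s :
  (csI int p I s)%:~R = csI R p I s.
Proof.
rewrite /csI /cs rmorph_prod; apply: eq_bigr => a _; rewrite rmorph_prod.
by apply: eq_bigr => b _; rewrite rmorphXn /= rmorphN1.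
Qed.

End Omega.

(** * Columns of a word with equal paired letters *)

Section ReverseRank.
Variables (k m : nat).
Local Notation N := (2 * k)%N.
Local Notation w := (partner k).
Variable I : {ffun 'I_N -> 'I_m}.
Hypothesis dI : diag I.

(* Cells of a row are numbered from the right, so that a final block of positions
   filled row by row occupies the first columns. *)
Definition rcol (x : 'I_N) : nat := #|[set y : 'I_N | (x < y)%N && (I y == I x)]|.
Definition occ (i : 'I_m) : nat := #|[set y : 'I_N | I y == i]|.

Lemma rcol_lt_mono x y : I x = I y -> (x < y)%N -> (rcol y < rcol x)%N.
Proof.
move=> e lt; apply: proper_card; apply/properP; split.
  by apply/subsetP => z; rewrite !inE => /andP[h1 h2]; rewrite e h2 (ltn_trans lt h1).
by exists y; rewrite inE ?lt ?e ?eqxx // ltnn.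
Qed.

Lemma rcol_inj x y : I x = I y -> rcol x = rcol y -> x = y.
Proof.
move=> e ec; case: (ltngtP x y) => [lt|lt|/ord_inj //].
  by have := rcol_lt_mono e lt; rewrite ec ltnn.
by have := rcol_lt_mono (esym e) lt; rewrite ec ltnn.
Qed.

Lemma rcol_occ x : (rcol x < occ (I x))%N.
Proof.
apply: proper_card; apply/properP; split.
  by apply/subsetP => z; rewrite !inE => /andP[].
by exists x; rewrite inE ?eqxx // ltnn.
Qed.

Lemma rcol_surj i c : (c < occ i)%N -> exists2 x, I x = i & rcol x = c.
Proof.
move=> lt; have [d ed] : exists d, occ i = d.+1 by case: (occ i) lt => // d; exists d.
pose g (x : 'I_N) : 'I_d.+1 := inord (rcol x).
pose A := [set y : 'I_N | I y == i].
have gE x : x \in A -> g x = rcol x :> nat.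
  by rewrite inE => /eqP e; rewrite inordK // -ed -e rcol_occ.
have gi : {in A &, injective g}.
  move=> x y xA yA e; move: (xA) (yA); rewrite !inE => /eqP e1 /eqP e2.
  by apply: rcol_inj; rewrite ?e1 ?e2 // -!gE // e.
have : [set g x | x in A] = setT.
  by apply/eqP; rewrite eqEcard subsetT cardsT card_ord card_in_imset //= -/(occ i) ed.
move=> /setP /(_ (inord c)); rewrite inE => /imsetP[x xA e].
exists x; first by move: xA; rewrite inE => /eqP.
by rewrite -gE // -e inordK // -ed.
Qed.

(** A later pair with the same letter counts twice, and the first member of a pair also sees the
    second. *)
Lemma rcol_pair (a : 'I_k) : odd (rcol (prpos (a, true))) = false /\
  rcol (prpos (a, false)) = (rcol (prpos (a, true))).+1.
Proof.
have E x : rcol x = \sum_(b < k) (((x < prpos (b, false))%N && (I (prpos (b, false)) == I x)) +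
    ((x < prpos (b, true))%N && (I (prpos (b, true)) == I x)))%N.
  rewrite /rcol -sum1_card big_mkcond big_pairs; apply: eq_bigr => b _.
  by rewrite !inE; do 2!case: ifP.
have dp b : I (prpos (b, true)) = I (prpos (b, false)).
  by rewrite -(partner_pr b false) dI.
split.
  rewrite E; apply: (big_ind (fun c => odd c = false)) => [//|c c' hc hc'|b _].
    by rewrite oddD hc hc'.
  rewrite !dp (_ : (prpos (a, true) < prpos (b, false))%N = (a < b)%N); last by rewrite /=; lia.
  rewrite (_ : (prpos (a, true) < prpos (b, true))%N = (a < b)%N); last by rewrite /=; lia.
  by rewrite addnn odd_double.
have one : (\sum_(b < k) (b == a) = 1)%N.
  by rewrite (bigD1 a) //= eqxx big1 // => b /negbTE ->.
rewrite !E -[RHS]addn1 -[X in (_ = _ + X)%N]one -big_split; apply: eq_bigr => b _; rewrite !dp.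
have lt1 c : (prpos (a, true) < prpos (b, c))%N = (a < b)%N by rewrite /=; case: c; lia.
have lt0 c : (prpos (a, false) < prpos (b, c))%N = (a < b)%N || (b == a) && c.
  by rewrite -val_eqE /=; case: c; lia.
rewrite !lt1 !lt0 andbF andbT orbF.
by case: (eqVneq b a) => [->|ba]; rewrite ?ltnn ?eqxx /= ?orbF ?addn0.
Qed.

Lemma rcol_partner x : rcol (w x) = if odd (rcol x) then (rcol x).-1 else (rcol x).+1.
Proof.
rewrite -[x]hfK partner_pr; have [e1 e2] := rcol_pair (hf x).
by case: (odd x) => /=; rewrite ?e2 /= e1.
Qed.

Lemma occ_even i : odd (occ i) = false.
Proof.
rewrite /occ -sum1_card big_mkcond big_pairs.
apply: (big_ind (fun c => odd c = false)) => [//|c c' hc hc'|b _].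
  by rewrite oddD hc hc'.
by rewrite !inE -(partner_pr b false) dI; case: ifP.
Qed.

End ReverseRank.

(** * The three annihilation conditions *)

Section Harmonic.
Variables (F : fieldType) (hF : [pchar F] =i pred0) (n r k m : nat).
Local Notation N := (2 * k)%N.
Local Notation V := 'I_(n + 2 * r).
Local Notation pV := (@pW n (2 * r)).
Local Notation seqm := {ffun 'I_N -> 'I_m}.
Implicit Types (u : seqm -> F) (I : seqm).

Definition annH u := forall I h, h \in Hk k -> u (cmp I h) = u I.
Definition annK u := forall I (J : {ffun 'I_N -> V}),
  \sum_p (csI int pV J p * omega (cmp J p))%:~R * u (cmp I p) = 0.
(** [e] is the inclusion of the last [K] positions. When the rectangle does not fit there is no such
    [e], and the condition is empty. *)
Definition annP u := forall (e : 'I_(K n r) -> 'I_N) (einj : injective e),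
  (forall y, e y = N - K n r + y :> nat)%N -> forall I,
  \sum_(s in Rt n r) \sum_(t in Ct n r) (-1) ^+ odd_perm t * u (cmp I (ext einj (s * t)%g)) = 0.
Definition ann u := [/\ annH u, annK u & annP u].

Definition raise (i j : 'I_m) u I : F := \sum_(b | I b == i) u (upd I b j).

Lemma raise_cmp i j u I p : raise i j u (cmp I p) = \sum_(z | I z == i) u (cmp (upd I z j) p).
Proof.
rewrite /raise [RHS](reindex_inj (@perm_inj _ p)) /=; apply: eq_big => [b|b _]; first by rewrite ffunE.
by congr u; apply/ffunP => y; rewrite !ffunE (inj_eq perm_inj).
Qed.

(** The conditions permute positions while the operator changes letters, so they commute. *)
Lemma raise_ann i j u : ann u -> ann (raise i j u).
Proof.
move=> [uH uK uP]; split.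
- move=> I h hH; rewrite raise_cmp; apply: eq_bigr => z _; exact: uH.
- move=> I J; under eq_bigr => p _ do rewrite raise_cmp mulr_sumr.
  by rewrite exchange_big big1 //= => z _; apply: uK.
move=> e einj eE I.
under eq_bigr => s _ do (under eq_bigr => t _ do rewrite raise_cmp mulr_sumr).
under eq_bigr => s _ do rewrite exchange_big.
by rewrite exchange_big big1 //= => z _; apply: uP.
Qed.

Definition relabel (g : 'I_m -> 'I_m) I : seqm := [ffun x => g (I x)].

Lemma relabel_ann g u : ann u -> ann (fun I => u (relabel g I)).
Proof.
have E I p : relabel g (cmp I p) = cmp (relabel g I) p by apply/ffunP => x; rewrite !ffunE.
move=> [uH uK uP]; split.
- by move=> I h hH; rewrite E uH.
- by move=> I J; under eq_bigr => p _ do rewrite E; apply: uK.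
move=> e einj eE I.
under eq_bigr => s _ do (under eq_bigr => t _ do rewrite E).
exact: uP.
Qed.

Definition height I : nat := (\sum_x I x)%N.

Lemma height_cmp I p : height (cmp I p) = height I.
Proof. by rewrite /height [RHS](reindex_inj (@perm_inj _ p)) /=; apply: eq_bigr => x _; rewrite ffunE. Qed.

Lemma height_swap I (i j : 'I_m) : (i < j)%N -> (occ I i < occ I j)%N ->
  (height (relabel (tperm i j) I) < height I)%N.
Proof.
move=> lt ltc; rewrite -(ltn_add2r (i * occ I i + j * occ I j)).
have occE l : occ I l = (\sum_x (I x == l :> nat))%N.
  rewrite /occ -sum1_card big_mkcond; apply: eq_bigr => x _; rewrite inE -val_eqE /=.
  by case: eqP.
have e : (height (relabel (tperm i j) I) + (i * occ I i + j * occ I j) =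
          height I + (j * occ I i + i * occ I j))%N.
  transitivity (\sum_x (relabel (tperm i j) I x + (i * (I x == i :> nat) + j * (I x == j :> nat))))%N.
    by rewrite !occE !big_distrr /= !big_split.
  transitivity (\sum_x (I x + (j * (I x == i :> nat) + i * (I x == j :> nat))))%N; last first.
    by rewrite !occE !big_distrr /= !big_split.
  have ij : (i == j :> nat) = false by rewrite ltn_eqF.
  apply: eq_bigr => x _; rewrite ffunE; case: (tpermP i j (I x)) => [->|->|/eqP h1 /eqP h2].
  - by rewrite eqxx ij; lia.
  - by rewrite eqxx eq_sym ij; lia.
  by move: h1 h2; rewrite -!val_eqE /= => /negbTE -> /negbTE ->; rewrite !muln0.
by rewrite e ltn_add2l; nia.
Qed.

End Harmonic.

Lemma sum_pairs_distr (R : pzRingType) (k : nat) (T : finType) (G : 'I_k -> T -> T -> R) :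
  \sum_(J : {ffun 'I_(2 * k) -> T}) \prod_(a < k) G a (J (prpos (a, false))) (J (prpos (a, true)))
  = \prod_(a < k) \sum_(q : T * T) G a q.1 q.2.
Proof.
rewrite bigA_distr_bigA /=.
pose f (J : {ffun 'I_(2 * k) -> T}) : {ffun 'I_k -> T * T} :=
  [ffun a => (J (prpos (a, false)), J (prpos (a, true)))].
pose g (q : {ffun 'I_k -> T * T}) : {ffun 'I_(2 * k) -> T} :=
  [ffun x : 'I_(2 * k) => if odd x then (q (hf x)).2 else (q (hf x)).1].
have fK : cancel f g.
  move=> J; apply/ffunP => x; rewrite !ffunE /= -[in RHS](hfK x).
  by case: (odd x).
have gK : cancel g f.
  move=> q; apply/ffunP => a; rewrite !ffunE.
  have [-> ->] := prposK (a, false); have [-> ->] := prposK (a, true).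
  by case: (q a).
rewrite [RHS](reindex f); last by exists g => J _; [exact: fK|exact: gK].
by apply: eq_bigr => J _; apply: eq_bigr => a _; rewrite ffunE.
Qed.

(** * Shapes inside the hook *)

Section HookCase.
Variables (F : fieldType) (hF : [pchar F] =i pred0) (n r k m : nat).
Local Notation N := (2 * k)%N.
Local Notation V := 'I_(n + 2 * r).
Local Notation pV := (@pW n (2 * r)).
Local Notation w := (partner k).
Variables (u : {ffun 'I_N -> 'I_m} -> F) (I0 : {ffun 'I_N -> 'I_m}).
Hypothesis uH : annH u.
Hypothesis uK : annK n r u.
Hypothesis dI0 : diag I0.
Hypothesis rI0 : forall s, raising (fun=> 0%N) u (cmp I0 s).
Hypothesis dom : forall i j : 'I_m, (i < j)%N -> (occ I0 j <= occ I0 i)%N.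
Hypothesis hook : forall j : 'I_m, (n <= j)%N -> (occ I0 j <= 2 * r)%N.
Local Notation col := (rcol I0).

(** The two columns of a pair receive odd indices with sum 2r-1, which are dual for the form. *)
Definition fermion c := if odd c then (2 * r - 1 - c./2)%N else c./2.
(** Rows [s] and n-1-[s] carry, up to sign, the sum and the difference of the same two basis
    vectors, which are orthogonal and not isotropic. In a middle row the vector is twice a basis
    vector, whence the value 4 in [gram_boson]. *)
Definition sgb (s : nat) : int := if (s <= n.-1 - s)%N then 1 else -1.

(* Bosonic rows carry the orthogonal vectors e_s +/- e_(n-1-s); fermionic cells carry
   one odd basis vector per column, paired between the two columns of a pair. *)
Definition weight x (i : V) : int :=
  if (I0 x < n)%N then (i == I0 x :> nat)%:R + sgb (I0 x) * (i == n.-1 - I0 x :> nat)%N%:R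
  else (i == n + fermion (col x) :> nat)%N%:R.

Definition gram x y : int := \sum_(q : V * V) weight x q.1 * weight y q.2 * omz q.1 q.2.

Lemma sum_delta (a : nat) (f : V -> int) (ha : (a < n + 2 * r)%N) :
  \sum_(i : V) (i == a :> nat)%:R * f i = f (Ordinal ha).
Proof.
rewrite (bigD1 (Ordinal ha)) //= eqxx mul1r big1 ?addr0 // => i.
by rewrite -val_eqE /= => /negbTE ->; rewrite mul0r.
Qed.

Lemma gramE x y : gram x y = \sum_(i : V) weight x i * \sum_(j : V) weight y j * omz i j.
Proof.
rewrite /gram -(pair_bigA _ (fun i j => weight x i * weight y j * omz i j)) /=.
by apply: eq_bigr => i _; rewrite mulr_sumr; apply: eq_bigr => j _; rewrite mulrA.
Qed.

Lemma weight_parity x i : weight x i != 0 -> pV i = (n <= I0 x)%N.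
Proof.
rewrite /weight /pW; case: ltnP => h; last first.
  by case: (nat_of_ord i =P (n + _)%N) => [-> _|_]; [lia|rewrite eqxx].
case: (nat_of_ord i =P I0 x) => [->|_]; first lia.
by case: (nat_of_ord i =P (n.-1 - I0 x)%N) => [->|_]; [lia|rewrite mulr0 addr0 eqxx].
Qed.

Lemma gram_boson x y : (I0 x < n)%N -> (I0 y < n)%N ->
  gram x y = if I0 x == I0 y then
    (if (I0 x + I0 x + 1 == n)%N then 4%:R else sgb (I0 x) *+ 2) else 0.
Proof.
move=> hx hy; rewrite gramE /weight hx hy.
have h1 : (I0 x < n + 2 * r)%N by lia.
have h2 : (n.-1 - I0 x < n + 2 * r)%N by lia.
have h3 : (I0 y < n + 2 * r)%N by lia.
have h4 : (n.-1 - I0 y < n + 2 * r)%N by lia.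
under eq_bigr => i _ do rewrite mulrDl -mulrA.
rewrite big_split /= -mulr_sumr !sum_delta.
have inner i : \sum_(j : V) ((j == I0 y :> nat)%:R + sgb (I0 y) * (j == n.-1 - I0 y :> nat)%N%:R) * omz i j
    = omz i (Ordinal h3) + sgb (I0 y) * omz i (Ordinal h4).
  by under eq_bigr => j _ do rewrite mulrDl -mulrA; rewrite big_split /= -mulr_sumr !sum_delta.
rewrite !inner /omz /pW /= !(leqNgt n) hx hy.
have -> : (n.-1 - I0 x < n)%N by lia.
have -> : (n.-1 - I0 y < n)%N by lia.
rewrite /sgb -val_eqE /=; move: (nat_of_ord (I0 x)) (nat_of_ord (I0 y)) hx hy => s t hs ht.
have -> : (s + (n.-1 - t) + 1 == n)%N = (s == t) by lia.
have -> : (n.-1 - s + t + 1 == n)%N = (s == t) by lia.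
have -> : (n.-1 - s + (n.-1 - t) + 1 == n)%N = (s + t + 1 == n)%N by lia.
case: (eqVneq s t) => [->|st].
  by case: eqP => e; case: leqP => h //; lia.
by case: eqP => e; case: (leqP s) => h; case: (leqP t) => h' //; lia.
Qed.

Lemma gram_mixed x y : ((I0 x < n) != (I0 y < n))%N -> gram x y = 0.
Proof.
move=> ne; rewrite /gram big1 // => q _.
case: (eqVneq (weight x q.1) 0) => [->|/weight_parity h1]; first by rewrite !mul0r.
case: (eqVneq (weight y q.2) 0) => [->|/weight_parity h2]; first by rewrite mulr0 mul0r.
case: (eqVneq (omz q.1 q.2) 0) => [->|/omz_parity h3]; first by rewrite mulr0.
by move: ne; rewrite !ltnNge -h1 -h2 h3 eqxx.
Qed.

Lemma col_lt x : (n <= I0 x)%N -> (col x < 2 * r)%N.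
Proof. by move=> h; apply: leq_trans (rcol_occ I0 x) (hook h). Qed.

Lemma fermion_lt c : (c < 2 * r)%N -> (n + fermion c < n + 2 * r)%N.
Proof. by rewrite /fermion; case: ifP; lia. Qed.

Lemma gram_fermion x y : (n <= I0 x)%N -> (n <= I0 y)%N -> gram x y =
  if (col y == if odd (col x) then (col x).-1 else (col x).+1) then (if odd (col x) then 1 else -1) else 0.
Proof.
move=> hx hy; have cx := col_lt hx; have cy := col_lt hy.
rewrite gramE /weight !ltnNge hx hy /= sum_delta ?fermion_lt // => h1.
rewrite sum_delta ?fermion_lt // => h2; rewrite /omz /pW /= !leq_addr /= !addKn /fermion.
move: (col x) (col y) cx cy => c d hc hd.
by case: (boolP (odd c)) => oc; case: (boolP (odd d)) => od; do 3?case: ifP; move=> *; lia.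
Qed.

Definition rowsign (x : 'I_N) : bool := (n <= I0 x)%N.

Definition hookPsi p : int :=
  \sum_(J : {ffun 'I_N -> V}) (\prod_x weight x (J x)) * (csI int pV J p * omega (cmp J p)).

Lemma prod_weight_parity (J : {ffun 'I_N -> V}) : \prod_x weight x (J x) != 0 ->
  forall x, pV (J x) = rowsign x.
Proof. by move=> /prodf_neq0 h x; apply: weight_parity; apply: h. Qed.

(** A nonzero weight forces the parity of [J x] to be that of the row of [x], so the Koszul sign is
    the same for all contributing [J]; the remaining sum factors over the pairs. *)
Lemma hookPsiE p : hookPsi p = cs int rowsign p *
  \prod_(a < k) gram (p (prpos (a, false))) (p (prpos (a, true))).
Proof.
have -> : hookPsi p = cs int rowsign p *
    \sum_(J : {ffun 'I_N -> V}) (\prod_x weight x (J x)) * omega (cmp J p).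
  rewrite mulr_sumr; apply: eq_bigr => J _.
  have [->|nz] := eqVneq (\prod_x weight x (J x)) 0; first by rewrite !mul0r mulr0.
  by rewrite mulrCA; congr (_ * (_ * _)); apply: eq_cs; apply: prod_weight_parity.
congr (_ * _); rewrite -(sum_pairs_distr (fun a i j =>
  weight (p (prpos (a, false))) i * weight (p (prpos (a, true))) j * omz i j)).
have cinj : injective (fun J : {ffun 'I_N -> V} => cmp J p^-1%g).
  by apply: (can_inj (g := fun J => cmp J p)) => J; rewrite cmpKV.
rewrite (reindex_inj cinj) /=; apply: eq_bigr => J _.
rewrite cmpKV (reindex_inj (@perm_inj _ p)) /= big_pairs -big_split /=.
by apply: eq_bigr => a _; rewrite !ffunE !permK.
Qed.

Lemma hookPsi_Hk h p : h \in Hk k -> hookPsi (h * p)%g = hookPsi p.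
Proof.
move=> hH; apply: eq_bigr => J _; congr (_ * _).
by rewrite csIM cmpM [in RHS](omega_good (cmp J p) hH) mulrCA mulrA.
Qed.

(** [hookPsi] is antisymmetric along the columns of the fermionic rows, which form one block; each
    bosonic row is a block of its own. *)
Definition blk (j : 'I_m) : nat := minn j n.

Lemma gram_blk x y : gram x y != 0 -> blk (I0 y) = blk (I0 x).
Proof.
rewrite /blk; case: (ltnP (I0 x) n) => hx; case: (ltnP (I0 y) n) => hy.
- by rewrite gram_boson //; case: (eqVneq (I0 x) (I0 y)) => [-> //|_]; rewrite eqxx.
- by rewrite gram_mixed ?eqxx // hx ltnNge hy.
- by rewrite gram_mixed ?eqxx // hy ltnNge hx.
done.
Qed.

Lemma hookPsi_nocross p : hookPsi p != 0 -> nocross blk (cmp I0 p).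
Proof.
rewrite hookPsiE mulf_eq0 negb_or => /andP[_ /prodf_neq0 h] x.
have {}h a := gram_blk (h a isT).
by rewrite -[x]hfK partner_pr !ffunE; case: (odd x) => /=; rewrite h.
Qed.

(** The weight of a fermionic cell depends on its column only, so the exchange just produces the
    Koszul sign of two odd letters. *)
Lemma hookPsi_anti z z' p : z' != z -> rowsign z -> rowsign z' -> col z' = col z ->
  hookPsi (p * tperm z z')%g = - hookPsi p.
Proof.
move=> nz oz oz' ec; rewrite /hookPsi -sumrN.
have cinj : injective (fun J : {ffun 'I_N -> V} => cmp J (tperm z z')).
  by apply: (can_inj (g := fun J => cmp J (tperm z z'))) => J; rewrite -cmpM tperm2 cmp1.
rewrite (reindex_inj cinj) /=; apply: eq_bigr => J _.
have ew : \prod_x weight x (cmp J (tperm z z') x) = \prod_x weight x (J x).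
  rewrite [LHS](reindex_inj (@perm_inj _ (tperm z z'))) /=; apply: eq_bigr => x _.
  rewrite ffunE tpermK.
  have zn (y : 'I_N) : rowsign y -> (I0 y < n)%N = false by rewrite /rowsign ltnNge => ->.
  by case: (tpermP z z' x) => [->|->|//]; rewrite /weight !zn // ec.
rewrite ew; have [->|pz] := eqVneq (\prod_x weight x (J x)) 0; first by rewrite !mul0r oppr0.
rewrite -mulrN; congr (_ * _); rewrite csIM -!cmpM -mulgA !tperm2 mulg1 cmp1 -mulNr.
congr (_ * _).
have pJ := prod_weight_parity pz.
rewrite /csI cs_tperm ?ffunE ?tpermL ?tpermR ?pJ 1?eq_sym ?oz ?oz' // expr1 mulrN1.
by [].
Qed.

Lemma hookPsi1 : hookPsi 1%g != 0.
Proof.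
rewrite hookPsiE cs1 mul1r; apply/prodf_neq0 => a _; rewrite !perm1.
have eI : I0 (prpos (a, true)) = I0 (prpos (a, false)) by rewrite -(partner_pr a false) dI0.
case: (ltnP (I0 (prpos (a, false))) n) => h.
  rewrite gram_boson ?eI // eqxx; case: ifP => // _.
  by rewrite /sgb; case: ifP.
rewrite gram_fermion ?eI // -(partner_pr a false) rcol_partner // eqxx.
by case: ifP.
Qed.

(** Bosonic Gram entries depend on rows only, so [p] may be replaced by the identity on bosonic
    cells. On fermionic cells a nonzero product forces partners to go to partners, so what remains
    of [p] lies in [Hk]. *)
Lemma hookPsi_row p : cmp I0 p = I0 -> hookPsi p != 0 -> hookPsi p = hookPsi 1%g.
Proof.
move=> eI nz; have rowp x : I0 (p x) = I0 x by rewrite -[in RHS]eI ffunE.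
pose pt x := if rowsign x then p x else x.
have rpt x : I0 (pt x) = I0 x by rewrite /pt; case: ifP.
have pt_inj : injective pt.
  move=> x y e; have := congr1 I0 e; rewrite !rpt => exy.
  by move: e; rewrite /pt /rowsign exy; case: ifP => // _; apply: perm_inj.
have gpt x y : gram (p x) (p y) = gram (perm pt_inj x) (perm pt_inj y).
  have wpt z i : weight (p z) i = weight (perm pt_inj z) i.
    rewrite permE /pt /rowsign; case: leqP => // h.
    by rewrite /weight rowp h.
  by apply: eq_bigr => q _; rewrite !wpt.
have cpt : cs int rowsign p = cs int rowsign (perm pt_inj).
  rewrite -[p](mulgKV (perm pt_inj)) csM cs_fix ?mul1r // => x.
  rewrite /= permE /rowsign rpt => ox.
  by rewrite permM; apply: (@perm_inj _ (perm pt_inj)); rewrite permKV permE /pt /rowsign ox.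
have e : hookPsi p = hookPsi (perm pt_inj).
  by rewrite !hookPsiE cpt; congr (_ * _); apply: eq_bigr => a _; exact: gpt.
rewrite e -[perm pt_inj]mulg1 hookPsi_Hk //.
move: nz; rewrite hookPsiE mulf_eq0 negb_or => /andP[_ /prodf_neq0 g0].
have pw a : rowsign (prpos (a, false)) ->
    p (prpos (a, true)) = w (p (prpos (a, false))).
  move=> oa; have := g0 a isT.
  have ob : rowsign (prpos (a, true)) by rewrite /rowsign -(partner_pr a false) dI0.
  rewrite gram_fermion ?rowp //; case: (eqVneq (col _)) => [ec _|]; last by rewrite eqxx.
  apply: (@rcol_inj k m I0); last by rewrite rcol_partner.
  by rewrite dI0 !rowp -(partner_pr a false) dI0.
have E y : perm pt_inj y = pt y by rewrite permE.
apply/HkP => x; rewrite !E /pt /rowsign dI0 -/(rowsign x); case: ifP => // ox.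
move: ox; rewrite -[x]hfK partner_pr; case: (odd x) => /= ox; last exact: pw.
have oa : rowsign (prpos (hf x, false)) by rewrite /rowsign -dI0 partner_pr.
by rewrite (pw _ oa) partnerK.
Qed.

Lemma hook_zero : u I0 = 0.
Proof.
apply: (@hw_core k F hF m blk u I0 hookPsi) => //.
- by move=> s _ a i lt _; apply: rI0.
- by move=> h p; apply: hookPsi_Hk.
- exact: hookPsi_nocross.
- move=> z i lt; rewrite /blk => eb.
  have hi : (n <= i)%N by move: lt eb; lia.
  (* By dominance row [i] is at least as long as the row of [z], so it has a cell in the same
     column. *)
  have [|z' Iz' cz'] := @rcol_surj k m I0 i (col z).
    by apply: leq_trans (rcol_occ _ _) (dom lt).
  exists z'; have nz : z' != z by apply: contraTneq lt => e; rewrite -e Iz' ltnn.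
  split => // p; apply: hookPsi_anti => //; rewrite /rowsign ?Iz' //.
  exact: leq_trans hi (ltnW lt).
- under eq_bigr => p _ do rewrite rmorph_sum mulr_suml.
  rewrite exchange_big big1 //= => J _.
  under eq_bigr => p _ do rewrite rmorphM /= -mulrA.
  by rewrite -mulr_sumr uK mulr0.
(* All nonzero contributions at [I0] are equal, so they cannot cancel. *)
exists I0; rewrite (eq_bigr (fun p => hookPsi 1%g * ((I0 == cmp I0 p) && (hookPsi p != 0))%:R)).
  rewrite -mulr_sumr mulf_neq0 ?hookPsi1 // -natr_sum pnatr_eq0 -lt0n.
  by rewrite (bigD1 1%g) //= cmp1 eqxx hookPsi1.
move=> p _; case: eqP => [e|_]; last by rewrite !mulr0.
by have [->|nz] := eqVneq (hookPsi p) 0; rewrite ?mul0r ?mulr0 //= hookPsi_row.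
Qed.

End HookCase.

(** * Shapes containing the rectangle *)

Section RectCase.
Variables (F : fieldType) (hF : [pchar F] =i pred0) (n r k m : nat).
Local Notation N := (2 * k)%N.
Local Notation w := (partner k).
Variables (u : {ffun 'I_N -> 'I_m} -> F) (I0 : {ffun 'I_N -> 'I_m}).
Variables (e : 'I_(K n r) -> 'I_N) (e_inj : injective e).
Hypothesis eE : forall y, (e y = N - K n r + y :> nat)%N.
Hypothesis KN : (K n r <= N)%N.
Hypothesis uH : annH u.
Hypothesis uP : annP n r u.
Hypothesis dI0 : diag I0.
Hypothesis rI0 : forall s, raising (fun=> 0%N) u (cmp I0 s).
Hypothesis dom : forall i j : 'I_m, (i < j)%N -> (occ I0 j <= occ I0 i)%N.
Hypothesis blockE : forall y, I0 (e y) = trow y :> nat.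
Local Notation col := (rcol I0).

Lemma block_after y (x : 'I_N) : (e y < x)%N -> exists2 y' : 'I_(K n r), x = e y' & (y < y')%N.
Proof.
rewrite eE => lt; have h : (x - (N - K n r) < K n r)%N by have := ltn_ord x; lia.
by exists (Ordinal h); [apply: ord_inj; rewrite eE|]; move: lt => /=; lia.
Qed.

(** Nothing follows the block, so the later positions with the same letter are exactly the rest of
    the row of [y]. *)
Lemma rcol_block y : col (e y) = (2 * r + 1 - tcol y)%N.
Proof.
have cv (z : 'I_(K n r)) : z = (trow z * (2 * r + 2) + tcol z)%N :> nat by exact: divn_eq.
move ed : (2 * r + 1 - tcol y)%N => d; elim: d y ed => [|d IH] y ed.
  apply: eq_card0 => x; rewrite !inE; apply/negP => /andP[/block_after[y' -> lt]].
  move=> /eqP /(congr1 (@nat_of_ord _)); rewrite !blockE => er.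
  have := cv y; have := cv y'; rewrite er; have := tcol_lt y; have := tcol_lt y'; lia.
have cy : ((tcol y).+1 < 2 * r + 2)%N by lia.
have [y' [ry' cy']] := cellP (trow_lt y) cy.
have ey' : y' = y.+1 :> nat by rewrite (cv y') (cv y) ry' cy' addnS.
have eI : I0 (e y') = I0 (e y) by apply: ord_inj; rewrite !blockE ry'.
rewrite -(IH y') ?cy'; last lia.
rewrite /rcol (cardsD1 (e y')) inE eI eqxx andbT.
have -> : (e y < e y')%N by rewrite !eE ey'; lia.
rewrite add1n; congr _.+1; apply: eq_card => x; rewrite !inE.
rewrite -val_eqE /= !eE ey'; case: (I0 x == _); rewrite ?andbF ?andbT //; lia.
Qed.

Definition top (x : 'I_N) : bool := (I0 x <= n)%N.

(** The column group of the first n+1 rows of the whole shape, including their cells beyond the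
    rectangle. *)
Definition topC : {set 'S_N} :=
  [set t : 'S_N | [forall x, (col (t x) == col x) && (top x || (t x == x))]].

Lemma topCP (t : 'S_N) : reflect (forall x, col (t x) = col x /\ (~~ top x -> t x = x)) (t \in topC).
Proof.
rewrite inE; apply: (iffP forallP) => h x.
  by have /andP[/eqP h1 /orP h2] := h x; split => // nx; case: h2 => [tx|/eqP //]; rewrite tx in nx.
have [-> h2] := h x; rewrite eqxx /=; case: (boolP (top x)) => //= nx; by rewrite h2.
Qed.

Lemma topC_top (t : 'S_N) x : t \in topC -> top (t x) = top x.
Proof.
move=> /topCP tC; apply/idP/idP => h; apply: contraT => nx.
  by move: h; rewrite (tC x).2 // (negbTE nx).
have e1 := (tC (t x)).2 nx; by move: nx; rewrite (perm_inj e1) h.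
Qed.

Lemma topCM (s t : 'S_N) : t \in topC -> ((s * t)%g \in topC) = (s \in topC).
Proof.
move=> tC; have tC' := topCP _ tC; apply/topCP/topCP => h x.
  have [h1 h2] := h x; move: h1 h2; rewrite permM => h1 h2; split.
    by rewrite -h1 (tC' _).1.
  by move=> nx; apply: (@perm_inj _ t); rewrite h2 // (tC' x).2.
have [h1 h2] := h x; rewrite permM; split; first by rewrite (tC' _).1.
by move=> nx; rewrite h2 // (tC' x).2.
Qed.

Lemma topCMl (s t : 'S_N) : t \in topC -> ((t * s)%g \in topC) = (s \in topC).
Proof.
move=> tC; apply/idP/idP => h; last by rewrite topCM.
have tV : (t^-1)%g \in topC.
  apply/topCP => x; have := topCP _ tC (t^-1%g x); rewrite permKV => -[h1 h2].
  by split=> // nx; apply: (@perm_inj _ t); rewrite permKV; have [_ ->] := topCP _ tC x.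
by rewrite -(mulKg t s) topCM.
Qed.

Lemma ext_topC t : t \in Ct n r -> ext e_inj t \in topC.
Proof.
move=> /CtP tC; apply/topCP => x; case: (block_case e x) => [[y ->]|h].
  rewrite ext_e !rcol_block tC; split=> // ny; case/negP: ny.
  by rewrite /top blockE -ltnS trow_lt.
by rewrite ext_out.
Qed.

Definition glue (J : {ffun 'I_N -> 'I_m}) (I : {ffun 'I_(K n r) -> 'I_m}) : {ffun 'I_N -> 'I_m} :=
  [ffun x => if [pick y | e y == x] is Some y then I y else J x].

Lemma glue_e J I y : glue J I (e y) = I y.
Proof. by rewrite ffunE; case: pickP => [y' /eqP /e_inj -> //|/(_ y)]; rewrite eqxx. Qed.

Lemma glue_out J I x : (forall y, e y != x) -> glue J I x = J x.
Proof. by move=> h; rewrite ffunE; case: pickP => // y; rewrite (negbTE (h y)). Qed.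

Lemma glue_cmp J I s : glue J (cmp I s) = cmp (glue J I) (ext e_inj s).
Proof.
apply/ffunP => x; rewrite [RHS]ffunE; case: (block_case e x) => [[y ->]|h].
  by rewrite ext_e !glue_e ffunE.
by rewrite ext_out // !glue_out.
Qed.

(** The block starts at an even position, so the pairing restricts to it. *)
Lemma ext_Hk (h : 'S_(2 * kk n r)) : h \in Hk (kk n r) -> ext e_inj h \in Hk k.
Proof.
move=> /HkP hH.
have we (y : 'I_(2 * kk n r)) : w (e y) = e (partner (kk n r) y).
  apply: ord_inj; rewrite partner_val !eE partner_val oddD.
  have -> : odd (N - K n r) = false by rewrite oddB // !oddM.
  by rewrite addFb; case: (boolP (odd y)); case: (nat_of_ord y) => //=; lia.
apply/HkP => x; case: (block_case e x) => [[y ->]|hx].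
  by rewrite we !ext_e hH we.
rewrite !ext_out // => y; apply/eqP => e1.
by case/eqP: (hx (partner (kk n r) y)); rewrite -we e1 partnerK.
Qed.

(* Applying [rect_row_free] to the last K positions, all other letters being frozen. *)
Lemma topC_sum0 : \sum_(t in topC) (-1) ^+ odd_perm t * u (cmp I0 t) = 0.
Proof.
pose Ir : {ffun 'I_(2 * kk n r) -> 'I_m} := [ffun y => I0 (e y)].
have IrE (y : 'I_(2 * kk n r)) : Ir y = trow (y : 'I_(K n r)) :> nat by rewrite ffunE blockE.
have base (J : {ffun 'I_N -> 'I_m}) : (forall y, J (e y) = I0 (e y)) ->
    \sum_(t in Ct n r) (-1) ^+ odd_perm t * u (cmp J (ext e_inj t)) = 0.
  move=> hJ; have gJ : glue J Ir = J.
    apply/ffunP => x; case: (block_case e x) => [[y ->]|h]; last by rewrite glue_out.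
    by rewrite glue_e ffunE hJ.
  rewrite -[RHS](@rect_row_free F hF n r m Ir IrE (fun I => u (glue J I))).
  - by apply: eq_bigr => t _; rewrite glue_cmp gJ.
  - by move=> I h hH; rewrite glue_cmp uH // ext_Hk.
  rewrite -[RHS](uP e_inj eE J); apply: eq_bigr => s _; apply: eq_bigr => t _.
  by rewrite glue_cmp gJ.
have Cn0 : #|Ct n r|%:R != 0 :> F.
  by apply: natr_neq0 => //; apply/card_gt0P; exists 1%g; apply/CtP => x; rewrite perm1.
apply: (mulfI Cn0); rewrite mulr0 mulr_natl -sumr_const.
(* Average over left translations by the column group of the rectangle; for each fixed [t] the inner
   sum will vanish by [base]. *)
rewrite (eq_bigr (fun t' => \sum_(t in topC) (-1) ^+ odd_perm (ext e_inj t' * t)%g *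
    u (cmp I0 (ext e_inj t' * t)%g))); last first.
  move=> t' tC; rewrite [LHS](reindex_inj (mulgI (ext e_inj t'))) /=.
  by apply: eq_bigl => t; rewrite topCMl // ext_topC.
rewrite exchange_big big1 //= => t tC.
(* [t] sends a cell of the block to a top cell of the same column, which is again in the block.
   Undoing this action on the block gives the word [J], which agrees with [I0] there. *)
have [f fP] : exists f : 'I_(K n r) -> 'I_(K n r), forall y, e (f y) = t (e y) /\ tcol (f y) = tcol y.
  have h y : exists y', (e y' == t (e y)) && (tcol y' == tcol y).
    have top_t : top (t (e y)) by rewrite topC_top // /top blockE -ltnS trow_lt.
    have [y' [ry' cy']] := @cellP n r (I0 (t (e y))) (tcol y) top_t (tcol_lt y).
    exists y'; rewrite cy' eqxx andbT; apply/eqP; apply: (@rcol_inj k m I0).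
      by apply: ord_inj; rewrite blockE ry'.
    by rewrite (topCP _ tC (e y)).1 !rcol_block cy'.
  have [f fP] := fin_all_exists h; exists f => y.
  by have /andP[/eqP h1 /eqP h2] := fP y.
have f_inj : injective f.
  by move=> y y' /(congr1 e); rewrite !(fP _).1 => /perm_inj /e_inj.
pose s := perm f_inj.
have sC : s \in Ct n r by apply/CtP => y; rewrite permE (fP y).2.
pose J := cmp (cmp I0 t) (ext e_inj s^-1%g).
have JE : cmp J (ext e_inj s) = cmp I0 t.
  by rewrite /J -!cmpM ?mulgA -extM mulgV ext1 mul1g.
have hJ y : J (e y) = I0 (e y).
  by rewrite /J !ffunE ext_e -(fP _).1 -(permE f_inj) permKV.
transitivity ((-1) ^+ odd_perm t * (-1) ^+ odd_perm s *
    \sum_(t' in Ct n r) (-1) ^+ odd_perm t' * u (cmp J (ext e_inj t'))); last by rewrite base ?mulr0.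
rewrite mulr_sumr [RHS](reindex_inj (mulIg s)) /=.
apply: eq_big => [t'|t' _]; first by rewrite CtM.
rewrite cmpM -JE -cmpM -extM [in RHS]mulrA; congr (_ * _).
rewrite odd_permM odd_ext (odd_permM t' s).
move: (odd_perm t) (odd_perm s) (odd_perm t') => a b c.
by rewrite -!signr_addb; case: a; case: b; case: c.
Qed.

Lemma rect_zero : u I0 = 0.
Proof.
(* The antisymmetrizer mixes only the top rows: they form one block, and every other row is a block
   by itself. *)
pose bl (j : 'I_m) : nat := if (j <= n)%N then 0%N else j.
apply: (@hw_core k F hF m bl u I0 (antisym [set 1%g] topC)) => //.
- by move=> s _ a i lt _; apply: rI0.
- by move=> h p; apply: antisym_Hk.
- move=> p nz; have [h [t [hH tC ep]]] : exists h t, [/\ h \in Hk k, t \in topC & p = (h * t)%g].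
    move: nz; rewrite /antisym => nz.
    case: (pickP (fun q : 'S_N * 'S_N => [&& q.1 \in Hk k, q.2 \in topC & (q.1 * q.2 == p)%g])) => [[h t] /and3P[h1 h2 /eqP <-]|no].
      by exists h, t.
    move: nz; rewrite big1 ?eqxx // => h hH; rewrite big_set1 big1 // => t tC.
    by have := no (h, t); rewrite /= hH tC mulg1 => /= ->; rewrite mulr0.
  move=> x; rewrite ep !cmpM !ffunE.
  have blt y : bl (I0 (t y)) = bl (I0 y).
    case: (boolP (top y)) => ty; last by rewrite (topCP _ tC y).2.
    by rewrite /bl -!/(top _) topC_top // ty.
  by rewrite !blt (HkP _ hH) dI0.
- move=> z i lt; rewrite /bl => eb.
  have hz : (I0 z <= n)%N by move: lt eb; do 2?case: ifP; lia.
  have [|z' Iz' cz'] := @rcol_surj k m I0 i (col z).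
    by apply: leq_trans (rcol_occ _ _) (dom lt).
  have nz : z' != z by apply: contraTneq lt => e1; rewrite -e1 Iz' ltnn.
  exists z'; split => // p; apply: antisym_tperm; first by rewrite eq_sym.
  move=> t; apply: topCM; apply/topCP => x; case: tpermP => [->|->|//].
    by rewrite cz'; split => //; rewrite /top hz.
  rewrite cz'; split => //; rewrite /top Iz' => /negP []; apply: leq_trans (ltnW lt) hz.
- rewrite antisym_sum_inv // big_set1.
  by under eq_bigr => t _ do rewrite mul1g; rewrite topC_sum0 mulr0.
exists I0; apply: (@antisym_pos k m I0 col topC) => //.
- exact: rcol_inj.
- by move=> x; apply: rcol_partner.
- by move=> t x tC; rewrite (topCP _ tC x).1.
by apply/topCP => x; rewrite perm1.
Qed.

End RectCase.

(** * Vanishing of annihilated functions *)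

Lemma count_div d c x : count (fun y => y %/ d.+1 == x)%N (iota 0 (c * d.+1)) = ((x < c) * d.+1)%N.
Proof.
elim: c => [|c IH]; first by rewrite mul0n.
rewrite mulSnr iotaD count_cat IH add0n.
have -> : count (fun y => y %/ d.+1 == x)%N (iota (c * d.+1) d.+1) = ((c == x) * d.+1)%N.
  rewrite (@eq_in_count _ _ (fun=> c == x)); last first.
    move=> y; rewrite mem_iota => /andP[h1 h2].
    rewrite -(subnKC h1) divnMDl // divn_small ?addn0 //; lia.
  by case: (c == x); rewrite ?count_predT ?count_pred0 ?size_iota // mul1n.
by rewrite -mulnDl; congr (_ * _)%N; lia.
Qed.

Lemma occ_count k m (I : {ffun 'I_(2 * k) -> 'I_m}) s : diag I ->
  occ I s = (2 * count_mem s [tuple I (prpos (a, false)) | a < k])%N.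
Proof.
move=> dI; rewrite /occ -sum1_card big_mkcond big_pairs /=.
rewrite -sum1_count big_map big_distrr /= [RHS]big_mkcond /=.
rewrite big_enum /=; apply: eq_bigr => a _.
by rewrite !inE -[prpos (a, true)](partner_pr a false) dI; case: eqP.
Qed.

Lemma occ_cmp k m (I : {ffun 'I_(2 * k) -> 'I_m}) p i : occ (cmp I p) i = occ I i.
Proof.
rewrite /occ -[RHS](card_preimset _ (@perm_inj _ p)); apply: eq_card => x.
by rewrite !inE ffunE.
Qed.

(** With one letter per pair, each of the first n+1 letters occurs at least r+1 times, so the list
    [rho] with r+1 copies of each is part of the word and can be moved to its end. *)
Lemma block_arrange n r k m (I : {ffun 'I_(2 * k) -> 'I_m}) : diag I -> (n < m)%N ->
  (forall i : 'I_m, (i <= n)%N -> (2 * r + 2 <= occ I i)%N) ->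
  (K n r <= 2 * k)%N /\ exists th : 'S_k, forall (e : 'I_(K n r) -> 'I_(2 * k)),
    (forall y, e y = 2 * k - K n r + y :> nat)%N ->
    forall y, cmp I (liftp th) (e y) = trow y :> nat.
Proof.
move=> dI nm big.
pose letter c : 'I_m := insubd (Ordinal nm) c.
have letE c : (c <= n)%N -> letter c = c :> nat.
  by move=> h; rewrite val_insubd (leq_ltn_trans h nm).
pose rho := [seq letter (y %/ r.+1)%N | y <- iota 0 (kk n r)].
pose tr := [tuple I (prpos (a, false)) | a < k].
have kkE : kk n r = (n.+1 * r.+1)%N by rewrite /kk !addn1.
have srho : size rho = kk n r by rewrite size_map size_iota.
have cnt x : (count_mem x rho <= count_mem x tr)%N.
  have le x' : (count_mem x' rho = (x' < n.+1)%N * r.+1)%N.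
    rewrite count_map kkE -count_div; apply: eq_in_count => y; rewrite mem_iota add0n => /= hy.
    by rewrite -val_eqE /= letE // -ltnS ltn_divLR.
  rewrite le; case: ltnP => [h|_]; last by rewrite mul0n.
  by have := big x h; rewrite (occ_count _ dI) -/tr; lia.
have /count_subseqP[s2 ss2 ps2] := cnt.
have [s3 ps3] := perm_to_subseq ss2.
have pe : perm_eq (s3 ++ rho) tr.
  by rewrite perm_sym (permPl ps3) perm_catC perm_cat2l perm_sym.
have sz : (size s3 + kk n r = k)%N.
  by have := perm_size pe; rewrite size_cat srho size_tuple.
split; first by rewrite /K leq_pmul2l // -sz leq_addl.
have /tuple_permP[th eth] := pe; exists th => e eE y.
have hy := ltn_ord y; rewrite /K in hy.
have eEy := eE y; rewrite /K in eEy.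
have dE x : I x = I (prpos (hf x, false)).
  by rewrite -[x in LHS]hfK; case: (odd x) => //; rewrite -(partner_pr _ false) dI.
rewrite ffunE -[e y]hfK liftpE dE; have [-> _] := prposK (th (hf (e y)), odd (e y)).
have -> : I (prpos (th (hf (e y)), false)) = nth (letter 0) (s3 ++ rho) (hf (e y)).
  by rewrite eth -tnth_nth !tnth_mktuple.
have hE : hf (e y) = (size s3 + y./2)%N :> nat.
  have e2 : (2 * k - 2 * kk n r + y = 2 * size s3 + y)%N by clear - sz; move: (kk n r) (size s3) sz => a b <-; lia.
  by rewrite /= eEy e2 mul2n halfD odd_double doubleK.
have hh : (y./2 < kk n r)%N by rewrite ltn_half_double -mul2n.
rewrite nth_cat hE ltnNge leq_addr /= addKn (nth_map 0%N) ?size_iota // nth_iota //.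
have tE : trow y = (y./2 %/ r.+1)%N.
  have e2 : (2 * r + 2 = 2 * r.+1)%N by rewrite mulnS addnC.
  by rewrite /trow e2 divnMA divn2.
by rewrite add0n letE -tE // -ltnS trow_lt.
Qed.

Lemma ann_eq0 (F : fieldType) (hF : [pchar F] =i pred0) n r k m (u : {ffun 'I_(2 * k) -> 'I_m} -> F) :
  ann n r u -> forall I, u I = 0.
Proof.
move=> hu I; have [d] := ubnP (height I).
elim: d u hu I => // d IH u hu I le.
have [uH uK uP] := hu.
(* The raised function is annihilated too and is evaluated at a word of smaller height, so the
   induction hypothesis makes it 0. *)
have R0 s : raising (fun=> 0%N) u (cmp I s).
  move=> a i lt _; rewrite raising_upd //; apply: (IH _ (raise_ann i (cmp I s a) hu)).
  rewrite ltnS in le; apply: leq_trans le; rewrite -(height_cmp I s) /height.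
  rewrite (bigD1 a) //= [X in (_ < X)%N](bigD1 a) //= ffunE eqxx.
  rewrite (eq_bigr (fun x => cmp I s x : nat)) ?ltn_add2r // => x xa.
  by rewrite ffunE (negbTE xa).
rewrite -(cmp1 I); apply: (@hw_unique k F hF m (fun=> 0%N) u I) => // s dI1.
set I1 := cmp I s in dI1 *.
have R1 t : raising (fun=> 0%N) u (cmp I1 t) by rewrite /I1 -cmpM; apply: R0.
have le1 : (height I1 < d.+1)%N by rewrite height_cmp.
case: (boolP [forall i : 'I_m, forall j : 'I_m, (i < j)%N ==> (occ I1 j <= occ I1 i)%N]); last first.
  rewrite negb_forall => /existsP[i]; rewrite negb_forall => /existsP[j].
  rewrite negb_imply -ltnNge => /andP[lt ltc].
  (* If a larger letter is more frequent, exchanging the two names lowers the height, and [u]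
     composed with the renaming is still annihilated. *)
  have e : relabel (tperm i j) (relabel (tperm i j) I1) = I1.
    by apply/ffunP => x; rewrite !ffunE tpermK.
  rewrite -e; apply: (IH _ (relabel_ann (tperm i j) hu)).
  by rewrite ltnS in le1; apply: leq_trans le1; apply: height_swap.
move=> /forallP dom'; have dom (i j : 'I_m) : (i < j)%N -> (occ I1 j <= occ I1 i)%N.
  by move=> lt; have /forallP/(_ j)/implyP := dom' i; apply.
case: (boolP ((n < m)%N && [forall i : 'I_m, (i <= n)%N ==> (2 * r + 2 <= occ I1 i)%N])).
  move=> /andP[nm /forallP big'].
  have big (i : 'I_m) : (i <= n)%N -> (2 * r + 2 <= occ I1 i)%N by move=> h; have /implyP := big' i; apply.
  have [KN [th thP]] := block_arrange dI1 nm big.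
  have eb (y : 'I_(K n r)) : (2 * k - K n r + y < 2 * k)%N by have := ltn_ord y; lia.
  pose e y := Ordinal (eb y).
  have e_inj : injective e by move=> y y' [] /addnI /ord_inj.
  rewrite -(uH I1 _ (liftp_Hk th)).
  apply: (@rect_zero F hF n r k m u _ e e_inj) => //.
  - have E x : cmp I1 (liftp th) x = I1 (liftp th x) by rewrite [LHS]ffunE.
    by move=> x; rewrite !E (HkP _ (liftp_Hk th)) dI1.
  - by move=> t; rewrite -cmpM; apply: R1.
  - by move=> i j ij; rewrite !(occ_cmp I1); apply: dom.
  by move=> y; apply: thP.
rewrite negb_and => nrect; apply: (@hook_zero F hF n r k m) => // j nj.
case/orP: nrect => [h|]; first by have := ltn_ord j; lia.
rewrite negb_forall => /existsP[i]; rewrite negb_imply -ltnNge => /andP[hi lt].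
have : (occ I1 j <= occ I1 i)%N.
  have : (i <= j)%N by apply: leq_trans hi nj.
  by rewrite leq_eqVlt => /orP[/eqP /ord_inj -> //|]; apply: dom.
(* The multiplicity is below 2r+2 and even, hence at most 2r. *)
have := occ_even dI1 j; lia.
Qed.

(** * Free supercommutative algebras *)

Section LinearExtension.
Variables (F : fieldType) (N : nat) (V : lmodType F) (phi : 'X_{1..N} -> V).

Definition lext (f : {mpoly F[N]}) : V := \sum_(m <- msupp f) f@_m *: phi m.

Lemma lext_seq (s : seq 'X_{1..N}) f : uniq s -> {subset msupp f <= s} ->
  lext f = \sum_(m <- s) f@_m *: phi m.
Proof.
move=> us sub; rewrite [RHS](bigID (mem (msupp f))) /= [X in _ + X]big1 ?addr0; last first.
  by move=> m nm; rewrite memN_msupp_eq0 // scale0r.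
rewrite -big_filter; apply: perm_big; apply: uniq_perm; rewrite ?msupp_uniq ?filter_uniq //.
by move=> m; rewrite mem_filter /=; case: (boolP (m \in msupp f)) => // /sub ->.
Qed.

Lemma lext_is_linear : linear lext.
Proof.
move=> a f g; pose s := undup (msupp f ++ msupp g).
have us : uniq s by apply: undup_uniq.
rewrite (lext_seq (f := f) us) ?(lext_seq (f := g) us) ?(lext_seq (f := a *: f + g) us).
- rewrite scaler_sumr -big_split /=; apply: eq_bigr => m _.
  by rewrite mcoeffD mcoeffZ scalerDl scalerA.
- move=> m h; rewrite mem_undup mem_cat; apply: contraTT h; rewrite negb_or => /andP[h1 h2].
  by rewrite mcoeff_msupp mcoeffD mcoeffZ !memN_msupp_eq0 // mulr0 addr0 negbK.
- by move=> m h; rewrite mem_undup mem_cat h orbT.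
by move=> m h; rewrite mem_undup mem_cat h.
Qed.

HB.instance Definition _ := GRing.isLinear.Build F {mpoly F[N]} V _ lext lext_is_linear.

Lemma lextX m : lext 'X_[m] = phi m.
Proof. by rewrite /lext msuppX big_seq1 mcoeffX eqxx scale1r. Qed.

End LinearExtension.

Section SuperRing.
Variables (F : fieldType) (G : finType) (p : G -> bool).
Local Notation N := #|G|.
Local Notation SC := (SC F G).
Local Notation spar := (@spar G p).
Implicit Types (f g h : SC) (m : 'X_{1..N}).

Lemma smulE f g : smul p f g = lext (fun m1 => lext (fun m2 => mmul F p m1 m2) g) f.
Proof.
apply: eq_bigr => m1 _; rewrite scaler_sumr; apply: eq_bigr => m2 _.
by rewrite scalerA.
Qed.

Lemma smul_linl g : linear (fun f => smul p f g).
Proof. by move=> a f h; rewrite !smulE; exact: lext_is_linear. Qed.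

Lemma smul_linr f : linear (smul p f).
Proof.
move=> a g h.
have E g' : smul p f g' = \sum_(m <- msupp f) f@_m *: lext (mmul F p m) g' by rewrite smulE.
rewrite !E scaler_sumr -big_split; apply: eq_bigr => m _ /=.
have -> : lext (mmul F p m) (a *: g + h) = a *: lext (mmul F p m) g + lext (mmul F p m) h.
  exact: lext_is_linear.
by rewrite scalerDr !scalerA mulrC.
Qed.

HB.instance Definition _ f := GRing.isLinear.Build F SC SC _ (smul p f) (smul_linr f).
Definition smulr g f := smul p f g.
HB.instance Definition _ g := GRing.isLinear.Build F SC SC _ (smulr g) (smul_linl g).

Lemma smulXX m1 m2 : smul p 'X_[m1] 'X_[m2] = mmul F p m1 m2.
Proof. by rewrite smulE !lextX. Qed.

Definition sfree m : bool := [forall i, spar i ==> (m i <= 1)%N].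

Definition svalidb f : bool := all sfree (msupp f).

Lemma svalidP f : reflect (svalid p f) (svalidb f).
Proof.
apply: (iffP allP) => h m hm; last by apply/forallP => i; apply/implyP; exact: h.
by move=> i; have /forallP/(_ i)/implyP := h m hm.
Qed.

Lemma msignDl m1 m2 m3 : msign F p (m1 + m2)%MM m3 = msign F p m1 m3 * msign F p m2 m3.
Proof.
rewrite /msign -exprD -big_split /=; congr (_ ^+ _); apply: eq_bigr => i _.
by rewrite -big_split; apply: eq_bigr => j _; rewrite mnmDE mulnDl.
Qed.

Lemma msignDr m1 m2 m3 : msign F p m1 (m2 + m3)%MM = msign F p m1 m2 * msign F p m1 m3.
Proof.
rewrite /msign -exprD -big_split /=; congr (_ ^+ _); apply: eq_bigr => i _.
by rewrite -big_split; apply: eq_bigr => j _; rewrite mnmDE mulnDr.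
Qed.

Lemma mmulE m1 m2 : mmul F p m1 m2 = if sfree (m1 + m2)%MM then msign F p m1 m2 *: 'X_[(m1 + m2)%MM] else 0.
Proof.
rewrite /mmul; case: ifP => [/existsP[i /andP[h1 h2]]|/negbT].
  case: ifP => // /forallP /(_ i); rewrite h1 /= mnmDE leqNgt h2 //.
rewrite negb_exists => /forallP h; rewrite ifT //; apply/forallP => i.
by have := h i; rewrite negb_and -leqNgt -mnmDE; case: (spar i).
Qed.

Lemma sfreeD m1 m2 : sfree (m1 + m2)%MM -> sfree m1 && sfree m2.
Proof.
move=> /forallP h; apply/andP; split; apply/forallP => i; apply/implyP => oi;
  have := implyP (h i) oi; rewrite mnmDE; lia.
Qed.

(** On monomials both sides vanish unless the triple product repeats no odd variable; then the signs
    agree because [msign] is bimultiplicative. *)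
Lemma smulA : associative (@smul F G p).
Proof.
move=> f g h.
have mono m1 m2 m3 : (@smul F G p) 'X_[m1] ((@smul F G p) 'X_[m2] 'X_[m3]) = (@smul F G p) ((@smul F G p) 'X_[m1] 'X_[m2]) 'X_[m3].
  rewrite !smulXX !mmulE.
  case: (boolP (sfree (m1 + m2 + m3)%MM)) => [h123|h123].
    have /andP[h12 _] := sfreeD h123; have /andP[_ h23] : sfree m1 && sfree (m2 + m3)%MM.
      by apply: sfreeD; rewrite addmA.
    rewrite h12 h23 linearZ -[(@smul F G p) (_ *: _) _]/(smulr _ _) linearZ /= /smulr !smulXX !mmulE addmA h123.
    by rewrite !scalerA msignDl msignDr; congr (_ *: _); ring.
  have z1 : (@smul F G p) 'X_[m1] (if sfree (m2 + m3)%MM then msign F p m2 m3 *: 'X_[(m2 + m3)%MM] else 0) = 0.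
    case: ifP => _; last by rewrite linear0.
    by rewrite linearZ /= smulXX mmulE addmA (negbTE h123) scaler0.
  rewrite z1; case: ifP => _; rewrite -[(@smul F G p) _ 'X_[m3]]/(smulr _ _) ?linear0 //.
  by rewrite linearZ /= /smulr smulXX mmulE (negbTE h123) scaler0.
have L1 f' g' : (@smul F G p) f' g' = \sum_(m <- msupp f') f'@_m *: (@smul F G p) 'X_[m] g'.
  by rewrite {1}smulE /lext; apply: eq_bigr => m _; rewrite smulE lextX.
have L2 f' g' : (@smul F G p) f' g' = \sum_(m <- msupp g') g'@_m *: (@smul F G p) f' 'X_[m].
  by rewrite [in LHS](mpolyE g') linear_sum; apply: eq_bigr => m _; rewrite linearZ.
have S2 f' (s : seq 'X_{1..N}) (c : 'X_{1..N} -> SC) : (@smul F G p) f' (\sum_(m <- s) c m) = \sum_(m <- s) (@smul F G p) f' (c m).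
  by rewrite linear_sum.
have S1 f' (s : seq 'X_{1..N}) (c : 'X_{1..N} -> SC) : (@smul F G p) (\sum_(m <- s) c m) f' = \sum_(m <- s) (@smul F G p) (c m) f'.
  by rewrite -[LHS]/(smulr _ _) linear_sum.
have Z1 c f' g' : (@smul F G p) (c *: f') g' = c *: (@smul F G p) f' g'.
  by rewrite -[LHS]/(smulr _ _) linearZ.
have Z2 c f' g' : (@smul F G p) f' (c *: g') = c *: (@smul F G p) f' g'.
  by rewrite linearZ.
have step1 m1 m2 : (@smul F G p) 'X_[m1] ((@smul F G p) 'X_[m2] h) = (@smul F G p) ((@smul F G p) 'X_[m1] 'X_[m2]) h.
  rewrite (L2 'X_[m2] h) (L2 _ h) S2; apply: eq_bigr => m3 _.
  by rewrite Z2 mono.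
have step2 m1 : (@smul F G p) 'X_[m1] ((@smul F G p) g h) = (@smul F G p) ((@smul F G p) 'X_[m1] g) h.
  rewrite (L1 g h) (L2 _ g) S2 S1; apply: eq_bigr => m2 _.
  by rewrite Z1 Z2 step1.
rewrite (L1 f) (L1 f g) S1; apply: eq_bigr => m1 _.
by rewrite Z1 step2.
Qed.

Lemma svalidb_coef f : svalidb f <-> forall m, f@_m != 0 -> sfree m.
Proof.
split=> [/allP h m hm|h]; first by apply: h; rewrite mcoeff_msupp.
by apply/allP => m; rewrite mcoeff_msupp; exact: h.
Qed.

Definition svq : {pred {mpoly F[N]}} := fun f => svalidb f.

Lemma svq_closed : submod_closed svq.
Proof.
split=> [|a f g /svalidb_coef hf /svalidb_coef hg].
  by apply/svalidb_coef => m; rewrite mcoeff0 eqxx.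
apply/svalidb_coef => m; rewrite mcoeffD mcoeffZ => nz.
have [z|/hf //] := eqVneq f@_m 0; apply: hg; apply: contraNneq nz => ->.
by rewrite z mulr0 addr0.
Qed.

HB.instance Definition _ := GRing.isSubmodClosed.Build F {mpoly F[N]} svq svq_closed.

(** The ring structure is put on valid polynomials because 1 is a unit for [smul] only there: it
    annihilates monomials with a repeated odd variable. *)
Record SR := MkSR { srval :> {mpoly F[N]}; _ : srval \in svq }.
HB.instance Definition _ := [isSub for srval].
HB.instance Definition _ := [Choice of SR by <:].
HB.instance Definition _ := [SubChoice_isSubLmodule of SR by <:].

Lemma svX m : sfree m -> 'X_[m] \in svq.
Proof.
move=> h; apply/svalidb_coef => m'; rewrite mcoeffX; case: (m =P m') => [<- //|_].
by rewrite eqxx.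
Qed.

Lemma sv_mmul m1 m2 : mmul F p m1 m2 \in svq.
Proof.
rewrite mmulE; case: ifP => [h|_]; last exact: (@rpred0 _ svq).
by rewrite rpredZ // svX.
Qed.

Lemma smul_sv f g : (smul p f g : {mpoly F[N]}) \in svq.
Proof.
rewrite smulE rpred_sum // => m1 _; rewrite rpredZ // rpred_sum // => m2 _.
by rewrite rpredZ // sv_mmul.
Qed.

Lemma sfree0 : sfree 0%MM.
Proof. by apply/forallP => i; rewrite mnm0E implybT. Qed.

Lemma msign0l m : msign F p 0%MM m = 1.
Proof. by rewrite /msign big1 // => i _; rewrite big1 // => j _; rewrite mnm0E. Qed.
Lemma msign0r m : msign F p m 0%MM = 1.
Proof. by rewrite /msign big1 // => i _; rewrite big1 // => j _; rewrite mnm0E muln0. Qed.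

Definition srmul (f g : SR) : SR := MkSR (smul_sv f g).

Lemma sv1 : (1 : {mpoly F[N]}) \in svq.
Proof. by rewrite -mpolyX0 svX // sfree0. Qed.
Definition sr1 : SR := MkSR sv1.

Lemma srmulA : associative srmul.
Proof. by move=> f g h; apply: val_inj; rewrite /= smulA. Qed.

Lemma smul1l f : f \in svq -> smul p 1 f = f.
Proof.
move=> /svalidb_coef hf; rewrite smulE -mpolyX0 lextX {2}[f]mpolyE /lext.
apply: eq_big_seq => m; rewrite mcoeff_msupp => /hf fm.
by rewrite mmulE add0m fm msign0l scale1r.
Qed.

Lemma smul1r f : f \in svq -> smul p f 1 = f.
Proof.
move=> /svalidb_coef hf; rewrite smulE {2}[f]mpolyE {1}/lext.
apply: eq_big_seq => m; rewrite mcoeff_msupp => /hf fm.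
by rewrite -mpolyX0 lextX mmulE addm0 fm msign0r scale1r.
Qed.

Lemma srmul1l : left_id sr1 srmul.
Proof. by move=> [f hf]; apply: val_inj; rewrite /= smul1l. Qed.
Lemma srmul1r : right_id sr1 srmul.
Proof. by move=> [f hf]; apply: val_inj; rewrite /= smul1r. Qed.
Lemma srmulDl : left_distributive srmul +%R.
Proof. by move=> f g h; apply: val_inj; rewrite /= -![smul _ _ h]/(smulr _ _) linearD. Qed.
Lemma srmulDr : right_distributive srmul +%R.
Proof. by move=> f g h; apply: val_inj; rewrite /= linearD. Qed.

HB.instance Definition _ := GRing.Zmodule_isPzRing.Build SR srmulA srmul1l srmul1r srmulDl srmulDr.

Lemma srZAl (a : F) (f g : SR) : a *: (f * g) = (a *: f) * g.
Proof. by apply: val_inj; rewrite /= -![smul _ _ (val g)]/(smulr _ _) linearZ. Qed.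
Lemma srZAr (a : F) (f g : SR) : a *: (f * g) = f * (a *: g).
Proof. by apply: val_inj; rewrite /= linearZ. Qed.

Lemma srval_mul (f g : SR) : val (f * g) = smul p (val f) (val g).
Proof. by []. Qed.
Lemma srval_prod (I : Type) (s : seq I) (P : pred I) (f : I -> SR) :
  val (\prod_(i <- s | P i) f i) = \big[@smul F G p/1]_(i <- s | P i) val (f i).
Proof. by apply: (big_morph val) => //. Qed.

End SuperRing.

Section SuperCommuting.
Variables (F : fieldType) (H : finType) (q : H -> bool).
Local Notation R := (SR F q).

Definition scomm (b c : bool) (x y : R) := x * y = (-1) ^+ (b && c) *: (y * x).

Lemma scommX b c (x y : R) e : scomm b c x y ->
  x ^+ e * y = (-1) ^+ ((b && c) * e) *: (y * x ^+ e).
Proof.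
move=> h; elim: e => [|e IH]; first by rewrite muln0 expr0 scale1r mul1r mulr1.
rewrite exprS -mulrA IH -srZAr mulrA h -srZAl scalerA -mulrA -exprD mulnS addnC.
by [].
Qed.

Lemma prod_scomm c (y : R) (x : nat -> R) (b : nat -> bool) (e : nat -> nat) lo hi :
  (forall i, (lo <= i < hi)%N -> scomm (b i) c (x i) y) ->
  (\prod_(lo <= i < hi) x i ^+ e i) * y =
  (-1) ^+ (\sum_(lo <= i < hi) (b i && c) * e i)%N *: (y * \prod_(lo <= i < hi) x i ^+ e i).
Proof.
case: (leqP lo hi) => [le|lt]; last by rewrite !big_geq ?(ltnW lt) // scale1r mul1r mulr1.
elim: hi le => [|hi IH] le h.
  by rewrite !big_geq // scale1r mul1r mulr1.
move: le; rewrite leq_eqVlt => /orP[/eqP ->|le]; first by rewrite !big_geq // scale1r mul1r mulr1.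
rewrite ltnS in le; rewrite !big_nat_recr //= -mulrA (scommX _ (h hi _)) ?le ?ltnSn //.
rewrite -srZAr mulrA IH //; last by move=> i /andP[h1 h2]; apply: h; rewrite h1 ltnS ltnW.
by rewrite -srZAl scalerA -mulrA -exprD addnC.
Qed.

Lemma prod_adj M (z : 'I_M -> R) (P : 'I_M -> bool) (i j : 'I_M) : j = i.+1 :> nat ->
  scomm (P j) (P i) (z j) (z i) ->
  \prod_(a < M) z (tperm i j a) = (-1) ^+ (P i && P j) *: \prod_(a < M) z a.
Proof.
move=> eij h.
pose Z (f : 'I_M -> R) n := if insub n is Some a then f a else 1.
have ZE (f : 'I_M -> R) (a : 'I_M) : Z f a = f a by rewrite /Z valK.
have PE (f : 'I_M -> R) : \prod_(a < M) f a =
   (\prod_(0 <= n < i) Z f n) * (f i * f j) * \prod_(j.+1 <= n < M) Z f n.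
  rewrite (eq_bigr (fun a : 'I_M => Z f a)); last by move=> a _; rewrite ZE.
  rewrite -(big_mkord predT (Z f)) (@big_cat_nat _ _ _ i) //=; last exact/ltnW.
  rewrite (@big_cat_nat _ _ _ j.+1 i) //=; last by rewrite eij; lia.
  rewrite [\prod_(i <= n < j.+1) _]big_nat_recr ?eij //= big_nat1 -eij !ZE.
  by rewrite mulrA.
rewrite !PE tpermL tpermR.
have e1 : \prod_(0 <= n < i) Z (fun a => z (tperm i j a)) n = \prod_(0 <= n < i) Z z n.
  apply: eq_big_nat => n /andP[_ lt]; rewrite /Z; case: insubP => // a _ ea.
  by rewrite tpermD //; apply/eqP => e3; move: lt; rewrite -ea -e3 /= ?eij; lia.
have e2 : \prod_(j.+1 <= n < M) Z (fun a => z (tperm i j a)) n = \prod_(j.+1 <= n < M) Z z n.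
  apply: eq_big_nat => n /andP[lt _]; rewrite /Z; case: insubP => // a _ ea.
  by rewrite tpermD //; apply/eqP => e3; move: lt; rewrite -ea -e3 /= ?eij; lia.
by rewrite e1 e2 h andbC -srZAr -srZAl.
Qed.

(** This ties the combinatorial sign [cs] to reordering in the algebra. *)
Lemma prod_perm M (z : 'I_M -> R) (P : 'I_M -> bool) (s : 'S_M) :
  (forall a b, scomm (P a) (P b) (z a) (z b)) ->
  \prod_(a < M) z (s a) = cs F P s *: \prod_(a < M) z a.
Proof.
move=> h; move: s; apply: perm_adj_ind => [|s i j eij IH].
  by rewrite cs1 scale1r; apply: eq_bigr => a _; rewrite perm1.
rewrite csM cs_adj // -scalerA -IH.
rewrite (eq_bigr (fun a => (z \o s) (tperm i j a))); last by move=> a _; rewrite permM.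
by rewrite (prod_adj (P := P \o s) eij) //; apply: h.
Qed.
End SuperCommuting.

Section Gen.
Variables (F : fieldType) (G : finType) (p : G -> bool).
Local Notation N := #|G|.
Local Notation R := (SR F p).

Lemma sfreeU (i : 'I_N) : sfree p U_(i)%MM.
Proof. by apply/forallP => j; rewrite mnm1E; case: (i == j); rewrite implybT. Qed.

Definition gen (g : G) : R := MkSR (svX F (sfreeU (enum_rank g))).

Lemma msign_U (m : 'X_{1..N}) (b : 'I_N) : msign F p m U_(b)%MM =
  (-1) ^+ (\sum_(i < N | (b < i)%N) (spar p i && spar p b) * m i)%N.
Proof.
rewrite /msign; congr (_ ^+ _); rewrite [RHS]big_mkcond /=; apply: eq_bigr => i _.
rewrite big_mkcond (bigD1 b) //= big1 ?addn0; last first.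
  by move=> j jb; case: ifP => // _; rewrite mnm1E eq_sym (negbTE jb) muln0.
rewrite mnm1E eqxx muln1; case: (b < i)%N => //=.
by case: (spar p i && spar p b); rewrite ?mul1n ?mul0n.
Qed.

Lemma gen_scomm g h : scomm (p g) (p h) (gen g) (gen h).
Proof.
apply: val_inj; rewrite /= !smulXX !mmulE [(U_(enum_rank h) + _)%MM]addmC.
case: ifP => [hf|_]; last by rewrite scaler0.
rewrite scalerA; congr (_ *: _); rewrite !msign_U.
have S (a b : 'I_N) : (\sum_(i < N | (b < i)%N) (spar p i && spar p b) * U_(a)%MM i =
   ((b < a)%N && (spar p a && spar p b)))%N.
  rewrite big_mkcond (bigD1 a) //= big1 ?addn0 => [|i ia]; last first.
    by case: ifP => // _; rewrite mnm1E eq_sym (negbTE ia) muln0.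
  by rewrite mnm1E eqxx muln1; case: ifP.
rewrite !S /spar !enum_rankK -!signr_addb; congr (_ ^+ nat_of_bool _).
case: (ltngtP (enum_rank g) (enum_rank h)) => [_|_|e]; rewrite ?andbF /=.
- by case: (p g); case: (p h).
- by case: (p g); case: (p h).
have egh : g = h by apply: enum_rank_inj; apply: ord_inj.
rewrite egh; case ph: (p h) => //; move: hf; rewrite egh => /forallP /(_ (enum_rank h)).
by rewrite /spar enum_rankK ph mnmDE mnm1E eqxx.
Qed.

Lemma gen_odd g : p g -> gen g * gen g = 0.
Proof.
move=> pg; apply: val_inj; rewrite /= smulXX mmulE ifF //; apply/negP => /forallP/(_ (enum_rank g)).
by rewrite /spar enum_rankK pg mnmDE mnm1E eqxx.
Qed.

End Gen.

Section SuperHom.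
Variables (F : fieldType) (G H : finType) (p : G -> bool) (q : H -> bool).
Local Notation N := #|G|.
Local Notation R := (SR F q).
Variable img : G -> R.
Hypothesis img_comm : forall g h, scomm (p g) (p h) (img g) (img h).
Hypothesis img_odd : forall g, p g -> img g * img g = 0.

Definition emon (m : 'X_{1..N}) : R := \prod_(i < N) img (enum_val i) ^+ m i.

(** Moving [img g] to the left into its place produces [msign]. If it meets an equal odd factor, the
    product is 0 because odd images square to 0. *)
Lemma emon_step (m : 'X_{1..N}) g : sfree p m ->
  emon m * img g = if sfree p (m + U_(enum_rank g))%MM
    then msign F p m U_(enum_rank g) *: emon (m + U_(enum_rank g))%MM else 0.
Proof.
set b := enum_rank g => fm.
pose X n : R := if insub n is Some i then img (enum_val (i : 'I_N)) else 1.
pose P n : bool := if insub n is Some i then spar p (i : 'I_N) else false.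
pose e (m' : 'X_{1..N}) n := if insub n is Some i then m' (i : 'I_N) else 0%N.
have XE (i : 'I_N) : X i = img (enum_val i) by rewrite /X valK.
have PE (i : 'I_N) : P i = spar p i by rewrite /P valK.
have eE m' (i : 'I_N) : e m' i = m' i by rewrite /e valK.
have Xb : X b = img g by rewrite XE enum_rankK.
have split m' : emon m' = (\prod_(0 <= n < b) X n ^+ e m' n) * img g ^+ m' b *
    \prod_(b.+1 <= n < N) X n ^+ e m' n.
  rewrite /emon (eq_bigr (fun i : 'I_N => X i ^+ e m' i)); last by move=> i _; rewrite XE eE.
  rewrite -(big_mkord predT (fun n => X n ^+ e m' n)) (@big_cat_nat _ _ _ b) //=; last exact/ltnW.
  by rewrite [X in _ * X]big_ltn // Xb eE mulrA.
have comm : (\prod_(b.+1 <= n < N) X n ^+ e m n) * img g =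
   msign F p m U_(b)%MM *: (img g * \prod_(b.+1 <= n < N) X n ^+ e m n).
  rewrite (@prod_scomm _ _ _ (p g) _ _ P); last first.
    move=> n /andP[_ lt]; rewrite /X /P insubT /=; exact: img_comm.
  congr (_ *: _); rewrite msign_U; congr (_ ^+ _).
  rewrite [RHS](eq_bigr (fun i : 'I_N => (P i && p g) * e m i))%N; last first.
    by move=> i _; rewrite PE eE /spar enum_rankK.
  rewrite -(big_mkord (fun i => b < i)%N (fun n => (P n && p g) * e m n)%N).
  by rewrite [LHS](@big_nat_widenl _ _ _ _ 0%N).
have e1 (n : nat) : n != b :> nat -> e (m + U_(b))%MM n = e m n.
  move=> nb; rewrite /e; case: insubP => // i _ ei; rewrite mnmDE mnm1E.
  by case: eqP => [eb|]; rewrite ?addn0 //; rewrite -ei eb eqxx in nb.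
rewrite !split -!mulrA comm -srZAr -srZAr.
case: ifP => [fmU|nfmU].
  congr (_ *: _); rewrite mnmDE mnm1E eqxx addn1 exprSr -!mulrA.
  congr (_ * _).
    by apply: eq_big_nat => n /andP[_ lt]; rewrite e1 // ltn_eqF.
  congr (_ * (_ * _)).
  by apply: eq_big_nat => n /andP[lt _]; rewrite e1 // gtn_eqF.
have [pb mb] : p g /\ m b = 1%N.
  have : ~~ [forall i, spar p i ==> (m i <= 1)%N ==> ((m + U_(b))%MM i <= 1)%N].
    apply: contraFN nfmU => /forallP h; apply/forallP => i; apply/implyP => oi.
    have := h i; rewrite oi /=; have /forallP/(_ i) := fm; rewrite oi /= => ->.
    by [].
  rewrite negb_forall => /existsP[i]; rewrite !negb_imply mnmDE mnm1E.
  case: (eqVneq b i) => [<-|_] /and3P[oi h1 h2]; last by rewrite addn0 h1 in h2.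
  by split; [move: oi; rewrite /spar enum_rankK|lia].
by rewrite mb expr1 (mulrA (img g) (img g)) img_odd // mul0r mulr0 scaler0.
Qed.

Lemma emon0 : emon 0%MM = 1.
Proof. by rewrite /emon big1 // => i _; rewrite mnm0E expr0. Qed.

(** The map given by the universal property of the free supercommutative algebra; [shomrM] proves it
    multiplicative. *)
Definition shomr (f : SR F p) : R := lext emon (val f).

Lemma shomr_is_linear : linear shomr.
Proof. by move=> a f g; rewrite /shomr; exact: lext_is_linear. Qed.
HB.instance Definition _ := GRing.isLinear.Build F (SR F p) R _ shomr shomr_is_linear.

Lemma shomr_val f : val (shomr f) = shom p q (fun g => val (img g)) (val f).
Proof.
rewrite /shomr /lext /shom raddf_sum; apply: eq_bigr => m _.
rewrite -[LHS]/((val f)@_m *: val (emon m)).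
congr (_ *: _); rewrite /emon srval_prod; apply: eq_bigr => i _.
by elim: (m i) => // e IH; rewrite exprS /spow iterS -/(spow _ _ _) -IH.
Qed.

Lemma SR_ind (Q : SR F p -> Prop) :
  (forall a f g, Q f -> Q g -> Q (a *: f + g)) -> Q 0 ->
  (forall m (fm : sfree p m), Q (MkSR (svX F fm))) -> forall f, Q f.
Proof.
move=> QL Q0 QX f; have Qs (s : seq 'X_{1..N}) : {subset s <= msupp (val f)} ->
    exists2 g : SR F p, val g = \sum_(m <- s) (val f)@_m *: 'X_[m] & Q g.
  elim: s => [_|m s IH sub]; first by exists 0; rewrite ?big_nil.
  have sub' : {subset s <= msupp (val f)} by move=> x xs; apply: sub; rewrite in_cons xs orbT.
  have [g eg Qg] := IH sub'.
  have fm : sfree p m.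
    have /svalidb_coef h : svalidb p (val f) by case: (f).
    by apply: h; rewrite -mcoeff_msupp sub // mem_head.
  exists ((val f)@_m *: MkSR (svX F fm) + g); last exact: QL.
  by rewrite big_cons -eg.
have [g eg Qg] := Qs _ (fun x xs => xs).
by rewrite (_ : f = g) //; apply: val_inj; rewrite eg -mpolyE.
Qed.

Lemma shomr_genr f g : shomr (f * gen F p g) = shomr f * img g.
Proof.
move: f; apply: SR_ind => [a f h ef eh||m fm].
- have L b f1 f2 : shomr (b *: f1 + f2) = b *: shomr f1 + shomr f2 by exact: shomr_is_linear.
  by rewrite mulrDl -srZAl !L ef eh mulrDl srZAl.
- by rewrite mul0r linear0 mul0r.
rewrite {2}/shomr /= lextX emon_step // /shomr /= smulXX mmulE.
by case: ifP => _; [rewrite linearZ /= lextX|rewrite linear0].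
Qed.

End SuperHom.

Section SuperHomMul.
Variables (F : fieldType) (G H : finType) (p : G -> bool) (q : H -> bool).
Local Notation R := (SR F q).
Variable img : G -> R.
Hypothesis img_comm : forall g h, scomm (p g) (p h) (img g) (img h).
Hypothesis img_odd : forall g, p g -> img g * img g = 0.
Local Notation Phi := (shomr (p := p) img).

Lemma shomr1 : Phi 1 = 1.
Proof.
rewrite /shomr; have -> : val (1 : SR F p) = 'X_[0%MM] by rewrite mpolyX0.
by rewrite lextX emon0.
Qed.

Lemma shomr_gen g : Phi (gen F p g) = img g.
Proof. by rewrite -[gen F p g]mul1r shomr_genr // shomr1 mul1r. Qed.

Lemma mono_prod (m : 'X_{1..#|G|}) (fm : sfree p m) :
  MkSR (svX F fm) = \prod_(i < #|G|) gen F p (enum_val i) ^+ m i.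
Proof.
rewrite -[RHS]/(emon (gen F p) m); move: fm; have [d] := ubnP (mdeg m).
elim: d m => // d IH m le fm.
case: (pickP (fun i => m i != 0%N)) => [b mb|z]; last first.
  have m0 : m = 0%MM by apply/mnmP => i; rewrite mnm0E; apply/eqP; move: (z i) => /negbFE.
  by apply: val_inj; rewrite /= m0 emon0 mpolyX0.
pose m' := (m - U_(b))%MM.
have em : m = (m' + U_(b))%MM by rewrite submK // lep1mP.
have fm' : sfree p m' by have := fm; rewrite em => /sfreeD /andP[].
have st := emon_step (@gen_scomm F G p) (@gen_odd F G p) (enum_val b) fm'.
rewrite enum_valK -em fm -IH // in st; last first.
  by rewrite ltnS in le; apply: leq_trans le; rewrite em mdegD mdeg1 addn1.
have sg : msign F p m' U_(b)%MM * msign F p m' U_(b)%MM = 1.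
  by rewrite /msign -expr2 -exprM mulnC exprM sqrrN expr1n expr1n.
rewrite -[RHS]scale1r -sg -scalerA -st; apply: val_inj.
rewrite /= smulXX mmulE. rewrite enum_valK -em fm scalerA sg scale1r.
by [].
Qed.

Lemma shomrM f g : Phi (f * g) = Phi f * Phi g.
Proof.
have L b f1 f2 : Phi (b *: f1 + f2) = b *: Phi f1 + Phi f2 by exact: shomr_is_linear.
move: g; apply: SR_ind => [a g h eg eh||m fm].
- by rewrite mulrDr -srZAr !L eg eh mulrDr srZAr.
- by rewrite mulr0 linear0 mulr0.
rewrite mono_prod; move: f.
apply: (big_ind (fun g => forall f, Phi (f * g) = Phi f * Phi g)) => [f|g h hg hh f|i _].
- by rewrite mulr1 shomr1 mulr1.
- by rewrite mulrA hh hg hh mulrA.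
elim: (m i) => [|e IH] f; first by rewrite expr0 mulr1 shomr1 mulr1.
by rewrite exprSr mulrA shomr_genr // IH shomr_genr // mulrA.
Qed.

Lemma shomr_prod (I : Type) (s : seq I) (P : pred I) (f : I -> SR F p) :
  Phi (\prod_(i <- s | P i) f i) = \prod_(i <- s | P i) Phi (f i).
Proof. exact: (big_morph _ shomrM shomr1). Qed.

End SuperHomMul.

Section ScommClosure.
Variables (F : fieldType) (H : finType) (q : H -> bool).
Local Notation R := (SR F q).

Lemma scomm_sym b c (x y : R) : scomm b c x y -> scomm c b y x.
Proof. by rewrite /scomm => ->; rewrite scalerA andbC signb2 scale1r. Qed.

Lemma scommM b b' c (x x' y : R) : scomm b c x y -> scomm b' c x' y ->
  scomm (b (+) b') c (x * x') y.
Proof.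
rewrite /scomm => h h'; rewrite -mulrA h' -srZAr mulrA h -srZAl scalerA mulrA -signr_addb.
by congr (_ ^+ nat_of_bool _ *: _); case: b {h}; case: b' {h'}; case: c.
Qed.

Lemma prod_scale (I : Type) (s : seq I) (c : I -> F) (x : I -> R) :
  \prod_(i <- s) (c i *: x i) = (\prod_(i <- s) c i) *: \prod_(i <- s) x i.
Proof.
elim: s => [|i s IH]; first by rewrite !big_nil scale1r.
by rewrite !big_cons IH -srZAl -srZAr scalerA.
Qed.

Lemma scommZ b c a (x y : R) : scomm b c x y -> scomm b c (a *: x) y.
Proof. by rewrite /scomm => h; rewrite -srZAl h -srZAr !scalerA mulrC. Qed.

Lemma scomm_sum b c (T : finType) (P : pred T) (x : T -> R) y :
  (forall i, P i -> scomm b c (x i) y) -> scomm b c (\sum_(i | P i) x i) y.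
Proof.
rewrite /scomm => h; rewrite mulr_suml mulr_sumr scaler_sumr; exact: eq_bigr.
Qed.

Lemma scomm0 b c (y : R) : scomm b c 0 y.
Proof. by rewrite /scomm mul0r mulr0 scaler0. Qed.

Lemma scomm_odd_sqr (hF : [pchar F] =i pred0) (x : R) : scomm true true x x -> x * x = 0.
Proof. by rewrite /scomm expr1 scaleN1r => /(eqN_eq0 hF). Qed.

End ScommClosure.

Lemma sum_upper_half (E : nmodType) (h : nat -> E) r :
  \sum_(r <= i < 2 * r) h i = \sum_(0 <= i < r) h (2 * r - i.+1)%N.
Proof.
rewrite -{1}[r]add0n big_addn (_ : 2 * r - r = r)%N; last lia.
rewrite big_nat_rev; apply: eq_big_nat => i hi; congr h; lia.
Qed.

(** * Scalar products and the relations Pf *)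

Section Concrete.
Variables (F : fieldType) (hF : [pchar F] =i pred0) (n r m0 m1 : nat).
Local Notation V := 'I_(n + 2 * r).
Local Notation W := 'I_(m0 + m1).
Local Notation pV := (@pW n (2 * r)).
Local Notation pW := (@pW m0 m1).
Local Notation pB := (@pB n r m0 m1).
Local Notation pA := (@pA m0 m1).
Local Notation RB := (SR F pB).
Local Notation RA := (SR F pA).
Implicit Types (s t : W) (i j : V).

Definition xr i s : RB := gen F pB (i, s).

Lemma xr_scomm i s j t : scomm (pV i (+) pW s) (pV j (+) pW t) (xr i s) (xr j t).
Proof. exact: gen_scomm. Qed.

Definition omF i j : F := (omz i j)%:~R.

(** The scalar product as one sum over the Gram matrix. The Koszul sign of moving the second basis
    vector of [V] past [w_s] is 1 on the even part and gives the prefactor of the definition on the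
    odd part. *)
Definition vprodr s t : RB :=
  \sum_(ij : V * V) (omF ij.1 ij.2 * (-1) ^+ (pV ij.2 && pW s)) *: (xr ij.1 s * xr ij.2 t).

Lemma xB_val (i : nat) (s : W) (hi : (i < n + 2 * r)%N) : xB F n r i s = val (xr (Ordinal hi) s).
Proof.
rewrite /xB; have -> : insub i = Some (Ordinal hi) :> option V by rewrite insubT.
by [].
Qed.

Lemma vprodr_val s t : val (vprodr s t) = vprod F n r s t.
Proof.
pose f (i j : V) : {mpoly F[_]} := (omF i j * (-1) ^+ (pV j && pW s)) *: smul pB (val (xr i s)) (val (xr j t)).
have -> : val (vprodr s t) = \sum_i \sum_j f i j.
  by rewrite raddf_sum -(pair_bigA _ f) /=; apply: eq_bigr.
pose g (i : V) : {mpoly F[_]} := \sum_j f i j.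
have -> : \sum_i \sum_j f i j = \sum_i g i by [].
rewrite big_split_ord /= /vprod; congr (_ + _).
  apply: eq_bigr => i _.
  have hj : (n - i.+1 < n + 2 * r)%N by have := ltn_ord i; lia.
  rewrite /g (bigD1 (Ordinal hj)) //= big1 ?addr0 => [|j jn]; last first.
    rewrite /f /omF /omz /Defs.pW /= leqNgt ltn_ord /=.
    case: leqP => hn /=; first by rewrite mul0r scale0r.
    case: eqP => [e|_]; last by rewrite mul0r scale0r.
    by move: jn; rewrite -val_eqE /=; have := ltn_ord i; lia.
  have hi : (i < n + 2 * r)%N by have := ltn_ord i; lia.
  rewrite (xB_val _ hi) (xB_val _ hj) /f /omF /omz /Defs.pW /= leqNgt ltn_ord /=.
  have -> : (n <= n - i.+1)%N = false by have := ltn_ord i; lia.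
  have -> : (i + (n - i.+1) + 1 == n)%N by have := ltn_ord i; lia.
  rewrite /= mulr1 scale1r; congr (smul _ _ _); congr ('X_ _).
  by congr (enum_rank (_, _)); apply: ord_inj.
pose h (i : nat) : {mpoly F[_]} := (-1) ^+ pW s *: ((if (i < r)%N then -1 else 1) *:
    smul pB (xB F n r (n + i) s) (xB F n r (n + 2 * r - i.+1) t)).
have gh (i : 'I_(2 * r)) : g (rshift n i) = h i.
  have hi := ltn_ord i.
  have hj : (n + 2 * r - i.+1 < n + 2 * r)%N by lia.
  have hi' : (n + i < n + 2 * r)%N by lia.
  have nj : (n <= n + 2 * r - i.+1)%N by lia.
  rewrite /g (bigD1 (Ordinal hj)) //= big1 ?addr0 => [|j jn]; last first.
    rewrite /f /omF /omz /Defs.pW /= leq_addr /= addKn; case: (leqP n j) => hn /=; last by rewrite mul0r scale0r.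
    case: ifP => [/eqP e|_]; last by rewrite mul0r scale0r.
    by move: jn; rewrite -val_eqE /=; lia.
  rewrite /h (xB_val _ hi') (xB_val _ hj) /f /omF /omz /Defs.pW /= leq_addr nj /= addKn.
  have -> : (i + (n + 2 * r - i.+1 - n) + 1 == 2 * r)%N by lia.
  rewrite scalerA mulrC; congr (_ * _ *: smul _ _ _).
    by case: ifP; rewrite ?rmorphN1.
  by congr ('X_ _); congr (enum_rank (_, _)); apply: ord_inj.
under eq_bigr => i _ do rewrite gh.
rewrite -(big_mkord predT h) (@big_cat_nat _ _ _ r) //=; last lia.
rewrite sum_upper_half -big_split /= big_mkord scaler_sumr; apply: eq_bigr => j _.
have hj := ltn_ord j; rewrite /h hj (_ : (2 * r - j.+1 < r)%N = false); last lia.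
rewrite -scalerDr scaleN1r scale1r addrC.
have -> : (n + (2 * r - j.+1) = n + 2 * r - j.+1)%N by lia.
by have -> : (n + 2 * r - (2 * r - j.+1).+1 = n + j)%N by lia.
Qed.

Lemma vprodr_sym s t : vprodr s t = (-1) ^+ (pW s && pW t) *: vprodr t s.
Proof.
have swinj : injective (fun q : V * V => (q.2, q.1)) by move=> [a b] [c d] [] -> ->.
rewrite /vprodr [in RHS](reindex_inj swinj) scaler_sumr; apply: eq_bigr => -[i j] _ /=.
have [z|nz] := eqVneq (omz i j) 0.
  have z' : omz j i = 0 by rewrite omzC z mulr0.
  by rewrite /omF z z' !mul0r !scale0r scaler0.
rewrite (xr_scomm i s j t) !scalerA; congr (_ *: _).
have -> : omF i j = (-1) ^+ (pV i && pV j) * omF j i.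
  by rewrite /omF omzC rmorphM /= rmorphXn /= rmorphN1.
rewrite (omz_parity nz); move: (omF j i) (pV j) (pW s) (pW t) => x b c d.
by case: b; case: c; case: d; rewrite /= ?expr1 ?expr0; ring.
Qed.

Lemma vprodr_scomm s t s' t' :
  scomm (pW s (+) pW t) (pW s' (+) pW t') (vprodr s t) (vprodr s' t').
Proof.
have term (i j : V) : omz i j != 0 -> (pV i (+) pW s) (+) (pV j (+) pW t) = pW s (+) pW t.
  by move=> /omz_parity ->; case: (pV j); case: (pW s); case: (pW t).
have term' (i j : V) : omz i j != 0 -> (pV i (+) pW s') (+) (pV j (+) pW t') = pW s' (+) pW t'.
  by move=> /omz_parity ->; case: (pV j); case: (pW s'); case: (pW t').
apply: scomm_sum => -[i j] _ /=.
have [z|nz] := eqVneq (omz i j) 0; first by rewrite /omF z mul0r scale0r; apply: scomm0.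
apply: scommZ; apply: scomm_sym; apply: scomm_sum => -[i' j'] _ /=.
have [z|nz'] := eqVneq (omz i' j') 0; first by rewrite /omF z mul0r scale0r; apply: scomm0.
apply: scommZ; apply: scomm_sym; rewrite -(term i j nz) -(term' i' j' nz').
have aux c x : scomm c (pV i' (+) pW s') x (xr i' s') -> scomm c (pV j' (+) pW t') x (xr j' t') ->
    scomm c ((pV i' (+) pW s') (+) (pV j' (+) pW t')) x (xr i' s' * xr j' t').
  by move=> h1 h2; apply: scomm_sym; apply: scommM; apply: scomm_sym.
by apply: scommM; apply: aux; apply: xr_scomm.
Qed.

Lemma vprodr_odd s t : pW s (+) pW t -> vprodr s t * vprodr s t = 0.
Proof. by move=> o; apply: scomm_odd_sqr => //; have := vprodr_scomm s t s t; rewrite o. Qed.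

Definition imgA (g : GA m0 m1) : RB := vprodr (val g).1 (val g).2.

Lemma imgA_comm g h : scomm (pA g) (pA h) (imgA g) (imgA h).
Proof. exact: vprodr_scomm. Qed.
Lemma imgA_odd g : pA g -> imgA g * imgA g = 0.
Proof. exact: vprodr_odd. Qed.

Definition phir : RA -> RB := shomr (p := pA) imgA.

Lemma phir_sum (T : finType) (P : pred T) (x : T -> RA) :
  phir (\sum_(i | P i) x i) = \sum_(i | P i) phir (x i).
Proof. exact: linear_sum. Qed.

Lemma phirZ a (x : RA) : phir (a *: x) = a *: phir x.
Proof. exact: linearZ. Qed.

Lemma phir_val f : val (phir f) = phi n r (val f).
Proof.
rewrite /phir shomr_val /phi /shom; apply: eq_bigr => m _; congr (_ *: _).
apply: eq_bigr => i _; congr spow; exact: vprodr_val.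
Qed.

Definition xAr s t : RA :=
  match (insub (s, t) : option (GA m0 m1)) with
  | Some g => gen F pA g
  | None => match (insub (t, s) : option (GA m0 m1)) with
            | Some g => (-1) ^+ (pW s && pW t) *: gen F pA g
            | None => 0
            end
  end.

Lemma xAr_val s t : val (xAr s t) = xA F s t.
Proof. by rewrite /xAr /xA; case: insub => // ; case: insub. Qed.

Variant xAr_spec s t : RA -> Prop :=
  | XAgen g of val g = (s, t) : xAr_spec s t (gen F pA g)
  | XAswap g of val g = (t, s) : xAr_spec s t ((-1) ^+ (pW s && pW t) *: gen F pA g)
  | XAzero of s = t & pW s : xAr_spec s t 0.

Lemma xArP s t : xAr_spec s t (xAr s t).
Proof.
rewrite /xAr; case: insubP => [g _ eg|n1]; first exact: XAgen.
case: insubP => [g _ eg|n2]; first exact: XAswap.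
move: n1 n2; rewrite /okpair /=.
case: (ltngtP s t) => [lt|lt|/ord_inj ->] /=.
- by rewrite -val_eqE /= (ltn_eqF lt).
- by rewrite -!val_eqE /= (ltn_eqF lt).
by rewrite eqxx /= negbK => h _; apply: XAzero.
Qed.

Lemma phir_xAr s t : phir (xAr s t) = vprodr s t.
Proof.
have gE g : phir (gen F pA g) = imgA g by apply: shomr_gen; [exact: imgA_comm|exact: imgA_odd].
case: xArP => [g eg|g eg|-> o].
- by rewrite gE /imgA eg.
- by rewrite /phir linearZ /= -/(phir _) gE /imgA eg /= [in RHS]vprodr_sym andbC.
rewrite /phir linear0; apply/esym; apply: (eqN_eq0 hF).
by rewrite {1}vprodr_sym o expr1 scaleN1r.
Qed.

Lemma xAr_scomm s t s' t' : scomm (pW s (+) pW t) (pW s' (+) pW t') (xAr s t) (xAr s' t').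
Proof.
have aux s1 t1 c y : (forall g : GA m0 m1, scomm (pA g) c (gen F pA g) y) ->
    scomm (pW s1 (+) pW t1) c (xAr s1 t1) y.
  move=> h; case: xArP => [g eg|g eg|_ _]; last exact: scomm0.
    by have := h g; rewrite /Defs.pA eg.
  by apply: scommZ; have := h g; rewrite /Defs.pA eg addbC.
apply: (aux) => g; apply: scomm_sym; apply: (aux) => g'; exact: gen_scomm.
Qed.

Lemma xAr_sym s t : xAr s t = (-1) ^+ (pW s && pW t) *: xAr t s.
Proof.
rewrite {2}/xAr /xAr; case: insubP => [g okg eg|n1]; case: insubP => [g' okg' eg'|n2] //.
- have est : s = t.
    apply: ord_inj; apply/eqP; rewrite eqn_leq.
    by move: okg okg' => /andP[/= -> _] /andP[/= -> _].
  move: okg; rewrite /okpair /= est eqxx leqnn /= => /negbTE ->; rewrite scale1r.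
  by congr gen; apply: val_inj; rewrite eg eg' est.
- by rewrite scalerA [pW t && _]andbC signb2 scale1r.
by rewrite scaler0.
Qed.

Section Words.
Variable k : nat.
Local Notation N := (2 * k)%N.
Implicit Types (I : {ffun 'I_N -> W}) (J : {ffun 'I_N -> V}).
Local Notation lo a := (prpos (a, false)).
Local Notation hi a := (prpos (a, true)).

Definition Xk I : RA := \prod_(a < k) xAr (I (lo a)) (I (hi a)).

Lemma Xk_good I h : h \in Hk k -> Xk I = csI F pW I h *: Xk (cmp I h).
Proof.
move: I h; apply: good_functional => [a I|i j I eij].
  rewrite /csI cs_adj /=; last lia.
  have E : Xk I = \prod_(b < k) ((if b == a then (-1) ^+ (pW (I (lo a)) && pW (I (hi a))) else 1) *:
      xAr (cmp I (tperm (lo a) (hi a)) (lo b)) (cmp I (tperm (lo a) (hi a)) (hi b))).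
    apply: eq_bigr => b _; rewrite !ffunE; have [->|ba] := eqVneq b a.
      by rewrite tpermL tpermR xAr_sym.
    have ne c c' : prpos (a, c) != prpos (b, c') :> 'I_N.
      by apply: contraNneq ba => /(can_inj (@prposK k)) [->].
    by rewrite !tpermD // scale1r.
  rewrite E /Xk.
  rewrite prod_scale; congr (_ *: _).
  by rewrite (bigD1 a) //= eqxx big1 ?mulr1 // => b /negbTE ->.
pose P a := pW (I (lo a)) (+) pW (I (hi a)).
have -> : Xk (cmp I (liftp (tperm i j))) = (-1) ^+ (P i && P j) *: Xk I.
  rewrite -(@prod_adj _ _ _ _ _ P _ _ eij); last exact: xAr_scomm.
  by apply: eq_bigr => a _; rewrite !ffunE !liftpE.
rewrite scalerA.
by rewrite /csI cs_liftp_adj // signb2 scale1r.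
Qed.

(** The Koszul sign of sorting an alternating product of letters of [J] and [I] into the word [J]
    followed by [I]. With it [monJI] transforms under position permutations by the product of the
    signs of the two words. *)
Definition tsign J I : F := \prod_(x < N) \prod_(y < N | (x < y)%N) (-1) ^+ (pW (I x) && pV (J y)).

Definition monJI J I : RB := tsign J I *: \prod_(x < N) xr (J x) (I x).

Lemma tsign2 J I : tsign J I * tsign J I = 1.
Proof.
rewrite /tsign -big_split big1 // => x _; rewrite -big_split big1 // => y _ /=.
exact: signb2.
Qed.

Lemma monJI_cmp J I (s : 'S_N) : monJI (cmp J s) (cmp I s) = (csI F pV J s * csI F pW I s) *: monJI J I.
Proof.
rewrite /monJI (eq_bigr (fun x => (fun x => xr (J x) (I x)) (s x))); last by move=> x _; rewrite !ffunE.
rewrite (@prod_perm _ _ _ _ (fun x => xr (J x) (I x)) (fun x => pV (J x) (+) pW (I x))); last by move=> a b; apply: xr_scomm.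
rewrite !scalerA; congr (_ *: _).
pose g (x y : 'I_N) : F := (-1) ^+ (pW (I x) && pV (J y)).
have g2 x y : g x y * g x y = 1 by apply: signb2.
have -> : tsign (cmp J s) (cmp I s) = \prod_(x < N) \prod_(y < N | (x < y)%N) g (s x) (s y).
  by apply: eq_bigr => x _; apply: eq_bigr => y _; rewrite !ffunE.
rewrite (prod_pairs s g2) [RHS]mulrC -mulrA; congr (_ * _).
rewrite /csI /cs -!big_split; apply: eq_bigr => x _; rewrite -!big_split; apply: eq_bigr => y _ /=.
rewrite /g -!signr_addb; congr (_ ^+ nat_of_bool _).
by case: (pV (J (s x))); case: (pV (J (s y))); case: (pW (I (s x))); case: (pW (I (s y))).
Qed.

(** The two members of a later pair have equal parity in [V] and cancel; only the contributions
    inside each pair survive. *)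
Lemma tsign_pairs J I : (forall a, pV (J (lo a)) = pV (J (hi a))) ->
  tsign J I = \prod_(a < k) (-1) ^+ (pV (J (hi a)) && pW (I (lo a))).
Proof.
move=> eJ.
have inner (x : 'I_N) : \prod_(y < N | (x < y)%N) (-1) ^+ (pW (I x) && pV (J y)) =
   if odd x then 1 else (-1) ^+ (pW (I x) && pV (J (hi (hf x)))) :> F.
  have l1 : (x < lo (hf x))%N = false by rewrite /=; lia.
  have l2 : (x < hi (hf x))%N = ~~ odd x by rewrite /=; lia.
  rewrite big_mkcond big_pairs (@big_only1 _ _ _ _ (hf x)) //.
    by rewrite l1 l2; case: (odd x); rewrite /= ?mul1r.
  move=> b bx _; rewrite -eJ.
  have bx' : (b : nat) != x./2 by [].
  have -> : (x < lo b)%N = (x < hi b)%N by rewrite /=; lia.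
  by case: ifP => _ /=; rewrite ?signb2 ?mulr1.
rewrite /tsign (eq_bigr _ (fun x _ => inner x)) big_pairs; apply: eq_bigr => a _ /=.
have [-> _] := prposK (a, false).
have -> : odd (2 * a + 0) = false by lia.
have -> : odd (2 * a + 1) = true by lia.
by rewrite mulr1 andbC.
Qed.

Lemma prod_pairsN (x : 'I_N -> RB) : \prod_(b < N) x b = \prod_(a < k) (x (lo a) * x (hi a)).
Proof.
pose Z (c : nat) : RB := if insub c is Some a then x a else 1.
have ZE (a : 'I_N) : Z a = x a by rewrite /Z valK.
rewrite (eq_bigr (fun b : 'I_N => Z b)); last by move=> b _; rewrite ZE.
rewrite (eq_bigr (fun a : 'I_k => Z (2 * a + 0)%N * Z (2 * a + 1)%N)); last first.
  by move=> a _; rewrite -!ZE.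
rewrite -(big_mkord predT Z) -(big_mkord predT (fun a => Z (2 * a + 0)%N * Z (2 * a + 1)%N)).
elim: k => [|d IH]; first by rewrite muln0 !big_geq.
by rewrite mulnS add2n !big_nat_recr //= IH mulrA addn0 addn1.
Qed.

Lemma phir_Xk I : phir (Xk I) = \sum_(J : {ffun 'I_N -> V}) (omega J)%:~R *: monJI J I.
Proof.
rewrite /phir /Xk shomr_prod; [|exact: imgA_comm|exact: imgA_odd].
rewrite (eq_bigr (fun a => vprodr (I (lo a)) (I (hi a)))); last by move=> a _; exact: phir_xAr.
rewrite -(sum_pairs_distr (fun a i j => (omF i j * (-1) ^+ (pV j && pW (I (lo a)))) *:
   (xr i (I (lo a)) * xr j (I (hi a))))).
apply: eq_bigr => J _.
rewrite prod_scale big_split /= -scalerA.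
have -> : \prod_(a < k) omF (J (lo a)) (J (hi a)) = (omega J)%:~R.
  by rewrite /omega rmorph_prod.
have [->|nz] := eqVneq (omega J) 0; first by rewrite !scale0r.
rewrite /monJI -tsign_pairs; last by move=> a; apply: omega_parity.
by congr (_ *: (_ *: _)); rewrite prod_pairsN.
Qed.

End Words.
End Concrete.

Lemma cmp_inj N T (s : 'S_N) : injective (fun I : {ffun 'I_N -> T} => cmp I s).
Proof. by move=> I J e; rewrite -(cmpK I s) e cmpK. Qed.

Section PfRelations.
Variables (F : fieldType) (hF : [pchar F] =i pred0) (n r m0 m1 : nat).
Local Notation W := 'I_(m0 + m1).
Local Notation RA := (SR F (@pA m0 m1)).
Implicit Types (I : {ffun 'I_(K n r) -> W}).

Definition PfA I : RA := PfY (@Xk F m0 m1 (kk n r)) I.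

Lemma RtV s : (s^-1%g \in Rt n r) = (s \in Rt n r).
Proof.
have h t : t \in Rt n r -> t^-1%g \in Rt n r.
  by move=> tR; apply/RtP => a; rewrite -[in RHS](permKV t a) (RtP _ tR).
by apply/idP/idP => /h //; rewrite invgK.
Qed.

Lemma CtV s : (s^-1%g \in Ct n r) = (s \in Ct n r).
Proof.
have h t : t \in Ct n r -> t^-1%g \in Ct n r.
  by move=> tR; apply/CtP => a; rewrite -[in RHS](permKV t a) (CtP _ tR).
by apply/idP/idP => /h //; rewrite invgK.
Qed.

Lemma Pf_val I : Pf F (fun x => I x) = val (PfA I).
Proof.
have vS (T : finType) (P : pred T) (x : T -> RA) : val (\sum_(i | P i) x i) = \sum_(i | P i) val (x i).
  exact: raddf_sum.
have vZ (a : F) (x : RA) : val (a *: x) = a *: val x by exact: linearZ.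
rewrite /Pf /PfA /PfY (reindex_inj invg_inj) vS.
apply: eq_big => [s|s _]; first exact: CtV.
rewrite (reindex_inj invg_inj) vS.
apply: eq_big => [t|t _]; first exact: RtV.
rewrite vZ odd_permV -invMg invgK; congr (_ *: _).
rewrite /XI /Xk srval_prod; apply: eq_bigr => a _.
rewrite xAr_val /pact invgK !ffunE.
have -> : pos1 a = prpos (a, false) :> 'I_(2 * kk n r) by apply: ord_inj; rewrite /= addn0.
by have -> : pos2 a = prpos (a, true) :> 'I_(2 * kk n r) by apply: ord_inj.
Qed.

Lemma phir_PfA I : phir n r (PfA I) = 0.
Proof.
pose Om (J : {ffun 'I_(K n r) -> 'I_(n + 2 * r)}) : F^o := (@omega n r (kk n r) J)%:~R.
transitivity (\sum_J (PfY Om J : F) *: monJI F J I); last first.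
  by rewrite big1 // => J _; rewrite (PfY_small hF) scale0r.
under [RHS]eq_bigr => J _ do rewrite /PfY scaler_suml.
rewrite exchange_big /PfA /PfY phir_sum; apply: eq_bigr => s _.
under [RHS]eq_bigr => J _ do rewrite scaler_suml.
rewrite exchange_big phir_sum; apply: eq_bigr => t _.
(* Permuting [J] along with [I] brings back the monomial of [(J, I)]: the sign of [I] occurs twice
   and the sign of [J] remains. *)
rewrite phirZ (phir_Xk hF) (reindex_inj (@cmp_inj _ _ (t * s)%g)) scaler_sumr /=.
apply: eq_bigr => J _; rewrite monJI_cmp [LHS]scalerA [LHS]scalerA.
have key (a x y o : F) : y * y = 1 -> a * y * (o * (x * y)) = a * x * o.
  by move=> y2; rewrite -[RHS]mulr1 -y2; ring.
by rewrite -mulrA key ?csI2.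
Qed.

End PfRelations.

(** * Orthogonal decomposition with respect to integral vectors *)

Lemma row_gram_eq0 b (M : 'rV[rat]_b) : M *m M^T = 0 -> M = 0.
Proof.
move=> z; apply/rowP => j; rewrite [RHS]mxE; apply/eqP.
have := congr1 (fun M : 'M_1 => M 0 0) z; rewrite !mxE => /eqP.
rewrite psumr_eq0 => [/allP/(_ j)|i _]; last by rewrite !mxE -expr2 sqr_ge0.
by rewrite mem_index_enum !mxE mulf_eq0 orbb => /(_ isT).
Qed.

(** Over the rationals [A] and its Gram matrix have the same left kernel, hence the same rank. *)
Lemma gram_rank a b (A : 'M[rat]_(a, b)) : (A^T <= A *m A^T)%MS.
Proof.
have kerE : (kermx (A *m A^T) <= kermx A)%MS.
  apply/rV_subP => x /sub_kermxP xA; apply/sub_kermxP; apply: row_gram_eq0.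
  by rewrite trmx_mul mulmxA -(mulmxA x) xA mul0mx.
rewrite -(geq_leqif (mxrank_leqif_sup (submxMl A A^T))).
have := mxrankS kerE; rewrite !mxrank_ker mxrank_tr.
move: (rank_leq_row A) (rank_leq_row (A *m A^T)); move: (\rank A) (\rank (A *m A^T)) => x y; lia.
Qed.

Lemma common_denominator a b (X : 'M[rat]_(a, b)) :
  exists (d : int) (Z : 'M[int]_(a, b)), d != 0 /\ map_mx intr Z = d%:~R *: X.
Proof.
pose d := \prod_(p : 'I_a * 'I_b) denq (X p.1 p.2).
exists d, (\matrix_(i, j) (numq (X i j) * \prod_(p : 'I_a * 'I_b | p != (i, j)) denq (X p.1 p.2))).
split; first by apply/prodf_neq0 => p _; apply: denq_neq0.
apply/matrixP => i j; rewrite !mxE /d [in RHS](bigD1 (i, j)) //= !intrM.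
rewrite mulrAC; congr (_ * _); rewrite -[X in _ * X]divq_num_den mulrC divfK //.
by rewrite intr_eq0 denq_neq0.
Qed.

(** The field may have isotropic vectors, so the projection is found over the rationals. Clearing
    denominators gives an integral identity, which holds over the field, where the common
    denominator is invertible. *)
Lemma orth_decomp (F : fieldType) (hF : [pchar F] =i pred0) (T Idx : finType)
    (v : Idx -> T -> int) (g : T -> F) :
  exists (c : Idx -> F) (u : T -> F),
    (forall x, g x = \sum_i c i * (v i x)%:~R + u x) /\
    (forall i, \sum_x (v i x)%:~R * u x = 0).
Proof.
pose A : 'M[int]_(#|Idx|, #|T|) := \matrix_(i, j) v (enum_val i) (enum_val j).
have [X eX] := submxP (gram_rank (map_mx (intr : int -> rat) A)).
have [d [Z [d0 eZ]]] := common_denominator X.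
have ZA : Z *m (A *m A^T) = d *: A^T.
  suff /matrixP e : map_mx (intr : int -> rat) (Z *m (A *m A^T)) = map_mx intr (d *: A^T).
    by apply/matrixP => i j; apply: (@intr_inj rat); have := e i j; rewrite !mxE.
  by rewrite !map_mxM /= eZ -scalemxAl -map_trmx -eX map_mxZ -map_trmx.
pose AF : 'M[F]_(_, _) := map_mx intr A.
pose gm : 'rV[F]_#|T| := \row_j g (enum_val j).
pose cm := (d%:~R)^-1 *: (gm *m map_mx intr Z).
have dF : d%:~R != 0 :> F by rewrite (intr_eq0P hF).
have orth : (gm - cm *m AF) *m AF^T = 0.
  have : map_mx intr (Z *m (A *m A^T)) = map_mx intr (d *: A^T) :> 'M[F]_(_, _) by rewrite ZA.
  rewrite !map_mxM map_mxZ -map_trmx => eF.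
  rewrite mulmxBl /cm -!scalemxAl -!mulmxA eF -scalemxAr scalerA mulVf // scale1r.
  by rewrite subrr.
exists (fun i => cm 0 (enum_rank i)), (fun x => (gm - cm *m AF) 0 (enum_rank x)); split=> [x|i].
  have -> : (gm - cm *m AF) 0 (enum_rank x) = g x - \sum_i cm 0 i * AF i (enum_rank x).
    by rewrite mxE [gm _ _]mxE enum_rankK !mxE.
  rewrite [\sum_(i : Idx) _](reindex _ (onW_bij _ (@enum_val_bij Idx))) /= addrC -[LHS]addr0 -addrA; congr (_ + _).
  apply/esym/eqP; rewrite addrC subr_eq0; apply/eqP/eq_bigr => i _.
  by rewrite enum_valK [AF _ _]mxE [A _ _]mxE enum_rankK.
have := congr1 (fun M : 'rV_#|Idx| => M 0 (enum_rank i)) orth; rewrite !mxE => e.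
rewrite (reindex _ (onW_bij _ (@enum_val_bij T))) /= -[RHS]e; apply: eq_bigr => j _.
by rewrite enum_valK [AF^T _ _]mxE [AF _ _]mxE [A _ _]mxE enum_rankK mulrC.
Qed.

(** * Coefficients of monomials and words *)

Section WordMonomials.
Variables (F : fieldType) (G : finType) (p : G -> bool).
Local Notation R := (SR F p).

Definition content (s : seq G) : 'X_{1..#|G|} := [multinom count_mem (enum_val i) s | i < #|G|].

Lemma content_cons g s : content (g :: s) = (U_(enum_rank g) + content s)%MM.
Proof.
apply/mnmP => i; rewrite mnmDE !mnmE /= -(inj_eq (@enum_val_inj _ _)) enum_rankK.
by rewrite eq_sym.
Qed.

Lemma content_perm s s' : content s = content s' -> perm_eq s s'.
Proof.
move=> e; apply/allP => g _ /=; apply/eqP; have := congr1 (fun m : 'X_{1.._} => m (enum_rank g)) e.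
by rewrite !mnmE enum_rankK.
Qed.

Lemma mdeg_content s : mdeg (content s) = size s.
Proof.
elim: s => [|g s IH]; last by rewrite content_cons mdegD mdeg1 IH.
by rewrite mdegE big1 // => i _; rewrite mnmE.
Qed.

Lemma gen_word s : exists c : F,
  (val (\prod_(g <- s) gen F p g) = c *: 'X_[content s]) /\ (c != 0) = sfree p (content s).
Proof.
have c0 : content [::] = 0%MM by apply/mnmP => i; rewrite !mnmE.
elim: s => [|g s [c [e h]]].
  by exists 1; rewrite big_nil c0 mpolyX0 scale1r oner_neq0 sfree0.
exists (if sfree p (content (g :: s)) then c * msign F p U_(enum_rank g)%MM (content s) else 0).
split.
  rewrite big_cons srval_mul e linearZ /= smulXX mmulE -content_cons.
  by case: ifP => _; rewrite ?scalerA ?scale0r ?scaler0.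
case: ifP => f; last by rewrite eqxx.
have fs : sfree p (content s) by move: f; rewrite content_cons => /sfreeD/andP[].
by rewrite mulf_neq0 ?h // /msign expf_neq0 // oppr_eq0 oner_eq0.
Qed.

Lemma not_sfree_word N (z : 'I_N -> G) : ~~ sfree p (content [seq z x | x <- index_enum 'I_N]) ->
  exists x y, [/\ x != y, z x = z y & p (z x)].
Proof.
rewrite negb_forall => /existsP[i]; rewrite negb_imply /spar => /andP[pg].
set g := enum_val i in pg *; rewrite mnmE -/g count_map -ltnNge.
rewrite (_ : count _ _ = #|[set x | z x == g]|); last first.
  by rewrite -sum1_card -sum1_count; apply: eq_bigl => x; rewrite inE.
move=> /card_gt1P[x [y [+ + xy]]]; rewrite !inE => /eqP zx /eqP zy.
by exists x, y; rewrite zx zy.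
Qed.

End WordMonomials.

Section Coefficients.
Variables (F : fieldType) (hF : [pchar F] =i pred0) (n r m0 m1 : nat).
Local Notation V := 'I_(n + 2 * r).
Local Notation W := 'I_(m0 + m1).
Local Notation pV := (@pW n (2 * r)).
Local Notation pW := (@pW m0 m1).
Local Notation RB := (SR F (@pB n r m0 m1)).
Local Notation RA := (SR F (@pA m0 m1)).

Definition wordJI N (J : {ffun 'I_N -> V}) (I : {ffun 'I_N -> W}) : seq (GB n r m0 m1) :=
  [seq (J x, I x) | x <- index_enum 'I_N].

Lemma monJI_val k J I : exists c : F, (val (@monJI F n r m0 m1 k J I) = c *: 'X_[content (wordJI J I)])
  /\ (c != 0) = sfree (@pB n r m0 m1) (content (wordJI J I)).
Proof.
have [c [e h]] := gen_word F (@pB n r m0 m1) (wordJI J I).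
exists (tsign F J I * c); split.
  by rewrite /monJI -[val _]/(_ *: val _) -scalerA -e /wordJI big_map.
rewrite -h mulf_eq0 negb_or; have -> // : tsign F J I != 0.
by apply: contraTneq (oner_neq0 F) => z; rewrite -(tsign2 F J I) z mul0r eqxx.
Qed.

Lemma size_wordJI N J I : size (@wordJI N J I) = N.
Proof. by rewrite size_map [index_enum _]unlock -enumT size_enum_ord. Qed.

Lemma wordJI_orbit N (J J1 : {ffun 'I_N -> V}) (I I1 : {ffun 'I_N -> W}) :
  content (wordJI J I) = content (wordJI J1 I1) -> exists s : 'S_N, J = cmp J1 s /\ I = cmp I1 s.
Proof.
move=> /content_perm pe.
pose t J I := [tuple (J x, I x) | x < N] : N.-tuple (V * W).
have tE (J' : {ffun 'I_N -> V}) (I' : {ffun 'I_N -> W}) : wordJI J' I' = t J' I'.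
  by rewrite /wordJI /= [index_enum _]unlock -enumT.
move: pe; rewrite !tE => /tuple_permP[s es].
have {es}: t J I = [tuple tnth (t J1 I1) (s i) | i < N] by exact: val_inj.
move=> es; exists s; split; apply/ffunP => x; rewrite ffunE;
  by have := congr1 (fun u => tnth u x) es; rewrite !tnth_mktuple => -[].
Qed.

(** The coefficient of one monomial collects the pairs of words in one orbit of the symmetric group
    on positions. The sum over the group is this coefficient times the order of a stabilizer, up to
    a nonzero scalar. *)
Lemma coef_relation (B : nat) (w : forall k, {ffun 'I_(2 * k) -> W} -> F) k
    (J1 : {ffun 'I_(2 * k) -> V}) (I1 : {ffun 'I_(2 * k) -> W}) :
  (k < B)%N ->
  phir n r (\sum_(k < B) \sum_I w k I *: Xk F I) = 0 ->
  \sum_s csI F pV J1 s * csI F pW I1 s * (omega (cmp J1 s))%:~R * w k (cmp I1 s) = 0.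
Proof.
move=> kB f0; pose mu := content (wordJI J1 I1).
pose h s : F := csI F pV J1 s * csI F pW I1 s * (omega (cmp J1 s))%:~R * w k (cmp I1 s).
rewrite -[LHS]/(\sum_s h s).
case: (boolP (sfree (@pB n r m0 m1) mu)) => [fmu|/not_sfree_word[x [y [xy]]]]; last first.
  (* An odd generator occurs at both [x] and [y], so the monomial is 0 and says nothing; but then
     exchanging the two positions negates the sum. *)
  move=> [eJ eI] o; apply: (@eqN_eq0 _ hF F^o).
  rewrite {1}(reindex_inj (mulIg (tperm x y))) -sumrN; apply: eq_bigr => s _.
  have inv T (K : {ffun 'I_(2 * k) -> T}) : K x = K y -> cmp K (tperm x y) = K.
    by move=> e; apply/ffunP => a; rewrite ffunE; case: tpermP => // ->.
  rewrite /h !cmpM !csIM !inv // /csI !cs_tperm ?eJ ?eI //.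
  move: o; rewrite /pB /= eJ eI /Defs.pV -[(n <= J1 y)%N]/(pV (J1 y)).
  by case: (pV (J1 y)); case: (pW (I1 y)) => // _; rewrite ?expr0 ?expr1; ring.
have [c [eM cn]] := monJI_val J1 I1.
rewrite fmu in cn.
pose C (x : RB) : F := (val x)@_mu.
have CS (T : finType) (P : pred T) (x : T -> RB) : C (\sum_(i | P i) x i) = \sum_(i | P i) C (x i).
  rewrite /C (_ : val _ = \sum_(i | P i) val (x i)); last exact: raddf_sum.
  by rewrite raddf_sum.
have CZ (a : F) (x : RB) : C (a *: x) = a * C x.
  by rewrite /C (_ : val _ = a *: val x) // mcoeffZ.
have C1 : C (monJI F J1 I1) = c by rewrite /C eM mcoeffZ mcoeffX eqxx mulr1.
have CN k' (J : {ffun 'I_(2 * k') -> V}) I : content (wordJI J I) != mu -> C (monJI F J I) = 0.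
  have [c' [e' _]] := monJI_val J I; rewrite /C e' mcoeffZ mcoeffX => /negbTE ->.
  by rewrite mulr0.
pose t (y : {ffun 'I_(2 * k) -> V} * {ffun 'I_(2 * k) -> W}) : F :=
  (omega y.1)%:~R * w k y.2 * C (monJI F y.1 y.2).
have tot : \sum_y t y = 0.
  have : C (phir n r (\sum_(k < B) \sum_I w k I *: Xk F I)) = 0.
    by rewrite f0 /C; exact: mcoeff0.
  rewrite phir_sum CS (bigD1 (Ordinal kB)) //= [X in _ + X]big1 ?addr0 => [|k' nk'].
    move=> e0; rewrite -[RHS]e0 phir_sum CS.
    have -> : \sum_y t y = \sum_J \sum_I t (J, I) by rewrite pair_bigA; apply: eq_bigr => -[].
    rewrite exchange_big /=.
    apply: eq_bigr => I _; rewrite phirZ CZ (phir_Xk hF) CS mulr_sumr; apply: eq_bigr => J _.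
    by rewrite CZ /t /= mulrA [w _ _ * _]mulrC.
  rewrite phir_sum CS big1 // => I _; rewrite phirZ CZ (phir_Xk hF) CS big1 ?mulr0 // => J _.
  rewrite CZ CN ?mulr0 //; apply: contraNneq nk' => /(congr1 mdeg).
  rewrite !mdeg_content !size_wordJI => e; apply/eqP/ord_inj => /=; lia.
pose act s := (cmp J1 s, cmp I1 s).
have tact s : t (act s) = h s * c.
  by rewrite /t /act /= monJI_cmp CZ C1 /h; ring.
pose st := #|[set s : 'S_(2 * k) | act s == act 1%g]|.
have stE s0 : #|[set s | act s == act s0]| = st.
  rewrite /st -[RHS](card_imset _ (mulgI s0)); apply: eq_card => s; rewrite inE.
  have E u : act (s0 * u)%g == act s0 = (act u == act 1%g).
    rewrite /act !cmpM !cmp1 -!pair_eqE /pair_eq /=.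
    by rewrite (inj_eq (@cmp_inj _ _ s0)) (inj_eq (@cmp_inj _ _ s0)).
  apply/idP/imsetP => [e|[u + ->]]; last by rewrite inE E.
  by exists (s0^-1 * s)%g; rewrite ?mulKVg // inE -E mulKVg.
have st0 : (0 < st)%N by apply/card_gt0P; exists 1%g; rewrite inE eqxx.
have : \sum_s h s * c = 0.
  transitivity (\sum_y \sum_(s | act s == y) t y).
    rewrite (exchange_big_dep xpredT) //=; apply: eq_bigr => s _.
    by rewrite (big_pred1 (act s)) ?tact // => y; rewrite eq_sym.
  rewrite (eq_bigr (fun y => t y *+ st)); first by rewrite sumrMnl tot mul0rn.
  move=> y _; have [ey|ny] := eqVneq (content (wordJI y.1 y.2)) mu.
    have [s0 [e1 e2]] := wordJI_orbit ey.
    have -> : y = act s0 by rewrite /act -e1 -e2; case: (y).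
    by rewrite sumr_const -(stE s0) cardsE.
  by rewrite /t CN // mulr0 mul0rn big1.
rewrite -mulr_suml => /eqP; rewrite mulf_eq0 => /orP[/eqP //|].
by rewrite (negbTE (_ : c != 0)) // cn.
Qed.

End Coefficients.

Section Expansion.
Variables (F : fieldType) (m0 m1 : nat).
Local Notation W := 'I_(m0 + m1).
Local Notation pA := (@pA m0 m1).
Local Notation RA := (SR F pA).

Lemma Xk_tuple k (t : k.-tuple (GA m0 m1)) : exists I : {ffun 'I_(2 * k) -> W},
  Xk F I = \prod_(g <- t) gen F pA g.
Proof.
exists [ffun y => let g := tnth t (hf y) in if odd y then (val g).2 else (val g).1].
rewrite big_tuple; apply: eq_bigr => a _; rewrite !ffunE.
have [[h0 o0] [h1 o1]] := (prposK (a, false), prposK (a, true)).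
rewrite h0 h1 o0 o1 /xAr.
by rewrite -surjective_pairing [insub _]valK.
Qed.

Lemma mono_Xk (m : 'X_{1..#|{: GA m0 m1}|}) (fm : sfree pA m) :
  exists k (I : {ffun 'I_(2 * k) -> W}), MkSR (svX F fm) = Xk F I.
Proof.
pose s := flatten [seq nseq (m i) (enum_val i) | i <- index_enum _].
have [I eI] := Xk_tuple (in_tuple s); exists (size s), I; rewrite eI mono_prod.
rewrite big_flatten big_map; apply: eq_bigr => i _.
by elim: (m i) => [|d IH] /=; rewrite ?big_nil // big_cons exprS IH.
Qed.

(* Coefficient families are indexed by plain words, so that words of different lengths coexist. *)
Lemma word_expansion (f : RA) : exists (w : seq W -> F) (B : nat), forall B', (B <= B')%N ->
  f = \sum_(k < B') \sum_(I : {ffun 'I_(2 * k) -> W}) w (fgraph I) *: Xk F I.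
Proof.
move: f; apply: SR_ind => [a g h [wg [Bg eg]] [wh [Bh eh]]||m fm].
- exists (fun s => a * wg s + wh s), (maxn Bg Bh) => B'; rewrite geq_max => /andP[lg lh].
  rewrite {1}(eg _ lg) {1}(eh _ lh) scaler_sumr -big_split; apply: eq_bigr => k _ /=.
  rewrite scaler_sumr -big_split; apply: eq_bigr => I _ /=.
  by rewrite scalerDl scalerA.
- exists (fun _ => 0), 0%N => B' _; rewrite big1 // => k _; rewrite big1 // => I _.
  exact: scale0r.
have [k [I ->]] := mono_Xk fm.
exists (fun s : seq W => (s == (fgraph I : seq W))%:R), k.+1 => B' lt.
rewrite (bigD1 (Ordinal lt)) //= (bigD1 I) //= eqxx scale1r !big1 ?addr0 //.
- move=> k' nk; rewrite big1 // => I' _; rewrite (_ : _ == _ = false) ?scale0r //.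
  apply: contraNF nk => /eqP /(congr1 size); rewrite !size_tuple !card_ord => e.
  by rewrite -val_eqE /=; lia.
move=> I' nI; rewrite (_ : _ == _ = false) ?scale0r //.
apply: contraNF nI => /eqP e; apply/eqP; apply: (can_inj fgraphK); exact: val_inj.
Qed.

End Expansion.

(** * Functions on the symmetric group spanned by relations *)

Section RelationVectors.
Variables (F : fieldType) (k : nat).
Local Notation N := (2 * k)%N.
Variable kap : 'S_N -> int.

Definition relvec (i : option 'S_N * 'S_N) (s : 'S_N) : int :=
  match i.1 with
  | Some h => if h \in Hk k then (s == (h * i.2)%g)%:R - (s == i.2)%:R else 0
  | None => kap (s * i.2^-1)%g
  end.

Lemma sum_scale_delta (E : lmodType F) (s0 : 'S_N) (Z : 'S_N -> E) :
  \sum_s ((s == s0)%:R : int)%:~R *: Z s = Z s0.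
Proof.
rewrite (bigD1 s0) //= eqxx scale1r big1 ?addr0 // => s /negbTE ->.
by rewrite scale0r.
Qed.

Lemma relvec_sum (E : lmodType F) (Z : 'S_N -> E) i :
  \sum_s (relvec i s)%:~R *: Z s =
  match i.1 with
  | Some h => if h \in Hk k then Z (h * i.2)%g - Z i.2 else 0
  | None => \sum_s (kap s)%:~R *: Z (s * i.2)%g
  end.
Proof.
case: i => -[h|] rho; rewrite /relvec /=.
  case: ifP => _; last by rewrite big1 // => s _; rewrite scale0r.
  under eq_bigr => s _ do rewrite rmorphB scalerBl.
  by rewrite sumrB !sum_scale_delta.
rewrite (reindex_inj (mulIg rho)) /=; apply: eq_bigr => s _.
by rewrite mulgK.
Qed.

(** Used with the zero subspace for the form on [V], and with the ideal for monomials in [W]. *)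
Lemma relvec_closed (E : lmodType F) (S : E -> Prop) (T : Type) (p : T -> bool)
    (Y : {ffun 'I_N -> T} -> E) :
  S 0 -> (forall a x, S x -> S (a *: x)) ->
  (forall I h, h \in Hk k -> Y I = csI F p I h *: Y (cmp I h)) ->
  (forall I, S (\sum_s (kap s)%:~R *: (csI F p I s *: Y (cmp I s)))) ->
  forall i I, S (\sum_s (relvec i s)%:~R *: (csI F p I s *: Y (cmp I s))).
Proof.
move=> S0 SZ good Skap [[h|] rho] I; rewrite relvec_sum /=.
  case: ifP => // hH; rewrite csIM cmpM mulrC -scalerA -(good (cmp I rho) h hH) subrr.
  exact: S0.
rewrite (eq_bigr (fun s => csI F p I rho *:
    ((kap s)%:~R *: (csI F p (cmp I rho) s *: Y (cmp (cmp I rho) s))))); last first.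
  by move=> s _; rewrite cmpM csIM !scalerA [csI _ _ (cmp _ _) _ * _]mulrC mulrCA mulrA.
by rewrite -scaler_sumr; apply: SZ.
Qed.

End RelationVectors.

Section SpanOfRelations.
Variables (F : fieldType) (hF : [pchar F] =i pred0) (n r k : nat).
Local Notation N := (2 * k)%N.
Local Notation V := 'I_(n + 2 * r).
Local Notation pV := (@pW n (2 * r)).
(** The Young symmetrizer on the last positions when the rectangle fits, and 0 otherwise; the two
    hypotheses cover both cases. *)
Variable kap : 'S_N -> int.
Hypothesis kap_ann : forall (e : 'I_(K n r) -> 'I_N) (einj : injective e),
  (forall y, e y = N - K n r + y :> nat)%N -> forall x : 'S_N -> F,
  \sum_s (kap s)%:~R * x s =
  \sum_(s in Rt n r) \sum_(t in Ct n r) (-1) ^+ odd_perm t * x (ext einj (s * t)%g).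
Hypothesis kap_om : forall J : {ffun 'I_N -> V},
  \sum_s (kap s)%:~R *: (csI F pV J s *: ((omega (cmp J s))%:~R : F^o)) = 0.

Definition perpV (g : 'S_N -> F) := forall (J : {ffun 'I_N -> V}) rho,
  \sum_s csI F pV J s * (omega (cmp J s))%:~R * g (s * rho)%g = 0.

Lemma relvec_perpV i : perpV (fun s => (relvec kap i s)%:~R).
Proof.
move=> J rho.
have om_good (I : {ffun 'I_N -> V}) h : h \in Hk k ->
    ((omega I)%:~R : F^o) = csI F pV I h *: ((omega (cmp I h))%:~R : F^o).
  by move=> hH; rewrite (omega_good I hH) rmorphM /= -[csI F pV I h]csI_intr.
have H := @relvec_closed F k kap F^o (fun x => x = 0) _ pV (fun J => (omega J)%:~R : F^o) erefl
  _ om_good kap_om i (cmp J rho^-1%g).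
rewrite (reindex_inj (mulIg rho^-1%g)) /=.
transitivity (csI F pV J rho^-1%g * \sum_s (relvec kap i s)%:~R *
    (csI F pV (cmp J rho^-1%g) s * (omega (cmp (cmp J rho^-1%g) s))%:~R)).
  rewrite mulr_sumr; apply: eq_bigr => s _; rewrite mulgKV csIM cmpM; ring.
by rewrite [X in _ * X]H ?mulr0 // => a x ->; rewrite scaler0.
Qed.

Lemma perpV_sum (c : option 'S_N * 'S_N -> F) (g u : 'S_N -> F) : perpV g ->
  (forall s, g s = \sum_i c i * (relvec kap i s)%:~R + u s) -> perpV u.
Proof.
move=> gV e J rho.
have -> : \sum_s csI F pV J s * (omega (cmp J s))%:~R * u (s * rho)%g =
   \sum_s csI F pV J s * (omega (cmp J s))%:~R * g (s * rho)%g -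
   \sum_i c i * (\sum_s csI F pV J s * (omega (cmp J s))%:~R * (relvec kap i (s * rho)%g)%:~R).
  under [X in _ - X]eq_bigr => i _ do rewrite mulr_sumr.
  rewrite exchange_big -sumrB; apply: eq_bigr => s _ /=; rewrite e mulrDr addrAC mulr_sumr -sumrB.
  by rewrite big1 ?add0r // => i _; ring.
rewrite gV sub0r big1 ?oppr0 // => i _.
by rewrite (relvec_perpV i J rho) mulr0.
Qed.

(** The word [id0] has distinct letters, so its rearrangements form a copy of the symmetric group.
    Carried over to them, [u] becomes a function on words to which [ann_eq0] applies. *)
Lemma perp_eq0 (u : 'S_N -> F) : perpV u ->
  (forall i, \sum_s (relvec kap i s)%:~R * u s = 0) -> forall s, u s = 0.
Proof.
move=> uV uR.
have uR' i := etrans (esym (@relvec_sum F k kap F^o u i)) (uR i).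
have uH h rho : h \in Hk k -> u (h * rho)%g = u rho.
  by move=> hH; apply/eqP; rewrite -subr_eq0; have := uR' (Some h, rho); rewrite /= hH => ->.
have uK rho : \sum_s (kap s)%:~R * u (s * rho)%g = 0 := uR' (None, rho).
pose id0 : {ffun 'I_N -> 'I_N} := [ffun x => x].
pose U (I : {ffun 'I_N -> 'I_N}) : F := \sum_rho (I == cmp id0 rho)%:R * u rho.
have Ucmp I s : U (cmp I s) = \sum_rho (I == cmp id0 rho)%:R * u (s * rho)%g.
  rewrite /U (reindex_inj (mulgI s)); apply: eq_bigr => rho _ /=.
  by rewrite cmpM (inj_eq (@cmp_inj _ _ s)).
have id0_inj rho rho' : (cmp id0 rho == cmp id0 rho') = (rho == rho').
  apply/eqP/eqP => [/ffunP e|-> //]; apply/permP => x.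
  by have := e x; rewrite !ffunE.
move=> s; have -> : u s = U (cmp id0 s).
  rewrite /U (bigD1 s) //= eqxx mul1r big1 ?addr0 // => rho nr.
  by rewrite id0_inj eq_sym (negbTE nr) mul0r.
apply: (ann_eq0 hF (n := n) (r := r)); split.
- by move=> I h hH; rewrite Ucmp; apply: eq_bigr => rho _; rewrite uH.
- move=> I J; under eq_bigr => p _ do rewrite Ucmp mulr_sumr.
  rewrite exchange_big big1 // => rho _ /=.
  rewrite (eq_bigr (fun p => (I == cmp id0 rho)%:R *
      (csI F pV J p * (omega (cmp J p))%:~R * u (p * rho)%g))) => [|p _].
    by rewrite -mulr_sumr uV mulr0.
  by rewrite rmorphM /= csI_intr; ring.
move=> e einj eE I; rewrite -(kap_ann einj eE (fun s => U (cmp I s))).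
under eq_bigr => p _ do rewrite Ucmp mulr_sumr.
rewrite exchange_big big1 // => rho _ /=.
rewrite (eq_bigr (fun p => (I == cmp id0 rho)%:R * ((kap p)%:~R * u (p * rho)%g))) => [|p _].
  by rewrite -mulr_sumr uK mulr0.
by rewrite mulrCA.
Qed.

Lemma perpV_span (g : 'S_N -> F) : perpV g ->
  exists c : option 'S_N * 'S_N -> F, forall s, g s = \sum_i c i * (relvec kap i s)%:~R.
Proof.
move=> gV; have [c [u [e ru]]] := orth_decomp hF (relvec kap) g.
exists c => s; rewrite {1}e (perp_eq0 _ ru) ?addr0 //; exact: perpV_sum gV e.
Qed.

Section Reduction.
Variables (m0 m1 : nat) (E : lmodType F) (S : E -> Prop).
Local Notation W := 'I_(m0 + m1).
Local Notation pW := (@pW m0 m1).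
Variable Y : {ffun 'I_N -> W} -> E.
Hypotheses (S0 : S 0) (SD : forall x y, S x -> S y -> S (x + y)) (SZ : forall a x, S x -> S (a *: x)).
Hypothesis Y_good : forall I h, h \in Hk k -> Y I = csI F pW I h *: Y (cmp I h).
Hypothesis kapS : forall I, S (\sum_s (kap s)%:~R *: (csI F pW I s *: Y (cmp I s))).

Lemma relation_span (w : {ffun 'I_N -> W} -> F) :
  (forall J I, \sum_s csI F pV J s * csI F pW I s * (omega (cmp J s))%:~R * w (cmp I s) = 0) ->
  S (\sum_I w I *: Y I).
Proof.
move=> rel; pose g I s := csI F pW I s * w (cmp I s).
have gV I : perpV (g I).
  move=> J rho; rewrite (eq_bigr (fun s => csI F pW I rho * (csI F pV J s *
      csI F pW (cmp I rho) s * (omega (cmp J s))%:~R * w (cmp (cmp I rho) s)))) => [|s _].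
    by rewrite -mulr_sumr rel mulr0.
  by rewrite /g csIM cmpM; ring.
have sumS (T : finType) (x : T -> E) : (forall i, S (x i)) -> S (\sum_i x i).
  by move=> h; apply: big_ind.
have N0 : (N`!)%:R != 0 :> F by apply: (natr_neq0 hF); exact: fact_gt0.
rewrite -[X in S X](scalerK N0); apply: SZ.
(* Averaging over all permutations replaces the coefficients by the functions [g I] on the group,
   which are combinations of relation vectors; the sign inserted twice is 1. *)
have -> : (N`!)%:R *: \sum_I w I *: Y I = \sum_I \sum_s g I s *: (csI F pW I s *: Y (cmp I s)).
  transitivity (\sum_(s : 'S_N) \sum_I w I *: Y I).
    by rewrite sumr_const card_Sn scaler_nat.
  rewrite [RHS]exchange_big; apply: eq_bigr => s _ /=.
  rewrite (reindex_inj (@cmp_inj _ _ s)); apply: eq_bigr => I _ /=.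
  by rewrite scalerA /g mulrAC csI2 mul1r.
apply: (sumS) => I; have [c ec] := perpV_span (gV I).
rewrite (eq_bigr (fun s => \sum_i c i *: ((relvec kap i s)%:~R *: (csI F pW I s *: Y (cmp I s))))).
  rewrite exchange_big /=.
  apply: (sumS _ (fun i => \sum_s c i *: ((relvec kap i s)%:~R *: (csI F pW I s *: Y (cmp I s))))) => i.
  rewrite -scaler_sumr; apply: SZ.
  exact: (@relvec_closed F k kap E S W pW Y).
by move=> s _; rewrite ec scaler_suml; apply: eq_bigr => i _; rewrite [RHS]scalerA.
Qed.

End Reduction.
End SpanOfRelations.

(** * The symmetrizer on the last positions *)

Section LastBlock.
Variables (n r l : nat).
Local Notation K := (K n r).
Local Notation k' := (kk n r).
Local Notation N := (2 * (l + kk n r))%N.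

Lemma first_subproof (y : 'I_(2 * l)) : (y < N)%N.
Proof. by have := ltn_ord y; lia. Qed.
Lemma last_subproof (y : 'I_K) : (2 * l + y < N)%N.
Proof. by rewrite mulnDr ltn_add2l. Qed.

Definition first_pos (y : 'I_(2 * l)) : 'I_N := Ordinal (first_subproof y).
Definition last_pos (y : 'I_K) : 'I_N := Ordinal (last_subproof y).

Lemma last_pos_inj : injective last_pos.
Proof. by move=> x y /(congr1 val) /= /addnI /ord_inj. Qed.

Definition kapL (s : 'S_N) : int :=
  \sum_(sig in Rt n r) \sum_(tau in Ct n r)
    (-1) ^+ odd_perm tau * (s == ext last_pos_inj (sig * tau)%g)%:R.

Lemma kapL_sum (F : fieldType) (E : lmodType F) (Z : 'S_N -> E) :
  \sum_s (kapL s)%:~R *: Z s =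
  \sum_(sig in Rt n r) \sum_(tau in Ct n r)
    (-1) ^+ odd_perm tau *: Z (ext last_pos_inj (sig * tau)%g).
Proof.
rewrite (eq_bigr (fun s => \sum_(sig in Rt n r) \sum_(tau in Ct n r)
    (-1) ^+ odd_perm tau *: (((s == ext last_pos_inj (sig * tau)%g)%:R : int)%:~R *: Z s))).
  rewrite exchange_big; apply: eq_bigr => sig _ /=.
  rewrite exchange_big; apply: eq_bigr => tau _ /=.
  by rewrite -scaler_sumr sum_scale_delta.
move=> s _; rewrite rmorph_sum scaler_suml; apply: eq_bigr => sig _.
rewrite rmorph_sum scaler_suml; apply: eq_bigr => tau _.
by rewrite rmorphM /= rmorphXn /= rmorphN1 scalerA.
Qed.

Lemma ext_unique M K0 (e e' : 'I_K0 -> 'I_M) (i : injective e) (i' : injective e') s :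
  e =1 e' -> ext i s = ext i' s.
Proof.
move=> ee; apply/permP => x; case: (block_case e x) => [[y ->]|h].
  by rewrite ext_e !ee ext_e.
by rewrite !ext_out // => y; rewrite -ee.
Qed.

Lemma kapL_ann (F : fieldType) (e : 'I_K -> 'I_N) (einj : injective e) :
  (forall y, e y = N - K + y :> nat)%N -> forall x : 'S_N -> F,
  \sum_s (kapL s)%:~R * x s =
  \sum_(s in Rt n r) \sum_(t in Ct n r) (-1) ^+ odd_perm t * x (ext einj (s * t)%g).
Proof.
move=> eE x; rewrite (@kapL_sum F F^o x); apply: eq_bigr => s _; apply: eq_bigr => t _.
rewrite (ext_unique last_pos_inj einj) // => y; apply: ord_inj; rewrite eE /= /Defs.K; lia.
Qed.

Section Restriction.
Variable T : Type.

Definition restr M (e : 'I_M -> 'I_N) (I : {ffun 'I_N -> T}) : {ffun 'I_M -> T} := [ffun y => I (e y)].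

Lemma restr_first I s : restr first_pos (cmp I (ext last_pos_inj s)) = restr first_pos I.
Proof.
apply/ffunP => y; rewrite !ffunE ext_out // => z; rewrite -val_eqE /=.
by have := ltn_ord y; lia.
Qed.

Lemma restr_last I s : restr last_pos (cmp I (ext last_pos_inj s)) = cmp (restr last_pos I) s.
Proof. by apply/ffunP => y; rewrite !ffunE ext_e. Qed.

End Restriction.

(** The permutations move only the last block, so the first letters act as a frozen linear factor
    and the signs are those of the last word. *)
Lemma kapL_PfY (F : fieldType) (E E' : lmodType F) m0 m1
    (Y : {ffun 'I_N -> 'I_(m0 + m1)} -> E) (Y' : {ffun 'I_K -> 'I_(m0 + m1)} -> E')
    (L : {ffun 'I_(2 * l) -> 'I_(m0 + m1)} -> {linear E' -> E}) :
  (forall I, Y I = L (restr first_pos I) (Y' (restr last_pos I))) ->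
  forall I, \sum_s (kapL s)%:~R *: (csI F (@pW m0 m1) I s *: Y (cmp I s)) =
    L (restr first_pos I) (PfY Y' (restr last_pos I)).
Proof.
move=> eY I; rewrite kapL_sum exchange_big linear_sum; apply: eq_bigr => tau _ /=.
rewrite linear_sum; apply: eq_bigr => sig _; rewrite [RHS]linearZ /= scalerA eY restr_first restr_last.
congr (_ * _ *: _); rewrite /csI (@cs_ext _ _ _ last_pos_inj F _ _ (2 * l)) //.
by apply: eq_cs => y; rewrite /= ffunE.
Qed.

Lemma prod_split (R : pzRingType) T (I : {ffun 'I_N -> T}) (x : T -> T -> R) :
  \prod_(a < l + k') x (I (prpos (a, false))) (I (prpos (a, true))) =
  (\prod_(a < l) x (restr first_pos I (prpos (a, false))) (restr first_pos I (prpos (a, true)))) *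
  \prod_(a < k') x (restr last_pos I (prpos (a, false))) (restr last_pos I (prpos (a, true))).
Proof.
rewrite big_split_ord /=; congr (_ * _); apply: eq_bigr => a _; rewrite !ffunE;
  congr (x (I _) (I _)); apply: ord_inj => /=; lia.
Qed.

Lemma kapL_omega (F : fieldType) (hF : [pchar F] =i pred0) (J : {ffun 'I_N -> 'I_(n + 2 * r)}) :
  \sum_s (kapL s)%:~R *: (csI F (@pW n (2 * r)) J s *: ((omega (cmp J s))%:~R : F^o)) = 0.
Proof.
pose L (J : {ffun 'I_(2 * l) -> 'I_(n + 2 * r)}) : {linear F^o -> F^o} := *:%R (omega J)%:~R.
have := @kapL_PfY F F^o F^o n (2 * r) (fun J => (omega J)%:~R) (fun J => (@omega n r k' J)%:~R) L.
move=> -> => [|I]; first by rewrite (PfY_small hF) linear0.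
by rewrite /omega prod_split rmorphM.
Qed.

Lemma kapL_Xk (F : fieldType) m0 m1 (I : {ffun 'I_N -> 'I_(m0 + m1)}) :
  \sum_s (kapL s)%:~R *: (csI F (@pW m0 m1) I s *: Xk F (cmp I s)) =
  Xk F (restr first_pos I) * PfA F (restr last_pos I).
Proof.
have lin (a : SR F (@pA m0 m1)) : linear (fun x => a * x : SR F (@pA m0 m1)).
  by move=> c x y; rewrite mulrDr srZAr.
pose L (J : {ffun 'I_(2 * l) -> 'I_(m0 + m1)}) :=
  HB.pack_for {linear SR F (@pA m0 m1) -> SR F (@pA m0 m1)} (fun x => Xk F J * x)
   (GRing.isLinear.Build F _ _ _ _ (lin (Xk F J))).
rewrite (@kapL_PfY F _ _ m0 m1 (fun I => Xk F I) (fun I => @Xk F m0 m1 k' I) L) // => J.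
by rewrite /Xk /= prod_split.
Qed.

End LastBlock.

(** * The ideal of relations *)

Section Ideal.
Variables (F : fieldType) (hF : [pchar F] =i pred0) (n r m0 m1 : nat).
Local Notation W := 'I_(m0 + m1).
Local Notation RA := (SR F (@pA m0 m1)).

Definition std_ideal (x : RA) : Prop := exists a : {ffun 'I_(K n r) -> W} -> RA,
  x = \sum_(I : {ffun 'I_(K n r) -> W} | semistandard (fun x => I x)) a I * PfA F I.

Lemma std_ideal0 : std_ideal 0.
Proof. by exists (fun _ => 0); rewrite big1 // => I _; rewrite mul0r. Qed.

Lemma std_idealD x y : std_ideal x -> std_ideal y -> std_ideal (x + y).
Proof.
move=> [a ->] [b ->]; exists (fun I => a I + b I); rewrite -big_split.
by apply: eq_bigr => I _; rewrite mulrDl.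
Qed.

Lemma std_idealZ c x : std_ideal x -> std_ideal (c *: x).
Proof.
move=> [a ->]; exists (fun I => c *: a I); rewrite scaler_sumr.
by apply: eq_bigr => I _; rewrite srZAl.
Qed.

Lemma std_ideal_PfA b (I : {ffun 'I_(K n r) -> W}) : std_ideal (b * PfA F I).
Proof.
have [c e] := PfY_straight hF (@Xk F m0 m1 (kk n r)) I.
exists (fun J => c J *: b); rewrite /PfA {1}e mulr_sumr; apply: eq_bigr => J _.
by rewrite -srZAr srZAl.
Qed.

Lemma relation_std_ideal k (w : {ffun 'I_(2 * k) -> W} -> F) :
  (forall J I, \sum_s csI F (@pW n (2 * r)) J s * csI F (@pW m0 m1) I s *
     (omega (cmp J s))%:~R * w (cmp I s) = 0) ->
  std_ideal (\sum_I w I *: Xk F I).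
Proof.
case: (leqP (kk n r) k) => [le|lt] rel; last first.
  (* In degrees below that of [Pf] the rectangle does not fit, and the relations of [Hk] alone
     span. *)
  apply: (relation_span hF (kap := fun=> 0) _ _ std_ideal0 std_idealD std_idealZ (@Xk_good _ _ _ _) _ rel).
  - move=> e einj eE; exfalso; have lt' : (2 * k < K n r)%N by rewrite ltn_pmul2l.
    by have := ltn_ord (e (Ordinal lt')); rewrite eE /=; lia.
  - by move=> J; rewrite big1 // => s _; rewrite scale0r.
  by move=> I; rewrite big1 => [|s _]; [exact: std_ideal0|rewrite scale0r].
have [l ek] : exists l, k = (l + kk n r)%N by exists (k - kk n r)%N; lia.
subst k; apply: (relation_span hF (@kapL_ann n r l F) (kapL_omega hF (l := l))
  std_ideal0 std_idealD std_idealZ (@Xk_good _ _ _ _) _ rel).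
by move=> I; rewrite kapL_Xk; apply: std_ideal_PfA.
Qed.

Lemma ker_phir_std_ideal f : phir n r f = 0 -> std_ideal f.
Proof.
have [w [B e]] := word_expansion f.
rewrite (e B (leqnn B)) => f0; apply: big_ind => [||k _]; [exact: std_ideal0|exact: std_idealD|].
apply: relation_std_ideal => J I.
exact: (coef_relation hF (w := fun k I => w (fgraph I)) J I (ltn_ord k) f0).
Qed.

Lemma std_ideal_ker_phir f : std_ideal f -> phir n r f = 0.
Proof.
have pM (x y : RA) : phir n r (x * y) = phir n r x * phir n r y.
  by apply: shomrM; [exact: imgA_comm|exact: (imgA_odd hF)].
move=> [a ->]; rewrite /phir linear_sum; apply: big1 => I _.
by rewrite -[LHS]/(phir n r (a I * PfA F I)) pM (phir_PfA hF) mulr0.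
Qed.

End Ideal.

Theorem theorem4p5 (F : fieldType) (hF : [pchar F] =i pred0)
    (n r m0 m1 : nat) (f : A F m0 m1) :
  svalid (@pA m0 m1) f ->
  (phi n r f = 0 <->
   exists a : {ffun 'I_(K n r) -> 'I_(m0 + m1)} -> A F m0 m1,
     (forall I, svalid (@pA m0 m1) (a I)) /\
     f = \sum_(I : {ffun 'I_(K n r) -> 'I_(m0 + m1)} | semistandard (fun x => I x))
           smul (@pA m0 m1) (a I) (Pf F (fun x => I x))).
Proof.
move=> /svalidP vf; pose f' : SR F (@pA m0 m1) := MkSR vf.
have vS (a : {ffun 'I_(K n r) -> 'I_(m0 + m1)} -> SR F (@pA m0 m1)) :
    val (\sum_(I : {ffun 'I_(K n r) -> 'I_(m0 + m1)} | semistandard (fun x => I x)) a I * PfA F I) =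
    \sum_(I : {ffun 'I_(K n r) -> 'I_(m0 + m1)} | semistandard (fun x => I x))
      smul (@pA m0 m1) (val (a I)) (Pf F (fun x => I x)).
  transitivity (\sum_(I : {ffun 'I_(K n r) -> 'I_(m0 + m1)} | semistandard (fun x => I x))
    val (a I * PfA F I)); first exact: raddf_sum.
  by apply: eq_bigr => I _; rewrite srval_mul Pf_val.
split=> [f0|[a [va ef]]].
  have [a ea] : std_ideal n r f'.
    by apply: (ker_phir_std_ideal hF); apply: val_inj; rewrite (phir_val n r f').
  exists (fun I => val (a I)); split; first by move=> I; apply/svalidP; exact: (valP (a I)).
  by rewrite -vS -ea.
pose a' I : SR F (@pA m0 m1) := MkSR (introT (svalidP _ _) (va I)).
have e' : f' = \sum_(I : {ffun 'I_(K n r) -> 'I_(m0 + m1)} | semistandard (fun x => I x)) a' I * PfA F I.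
  by apply: val_inj; rewrite vS.
have := std_ideal_ker_phir hF (ex_intro _ a' e').
by move=> /(congr1 val); rewrite phir_val.
Qed.
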